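(* Let $(X,\mu)$ be a $\sigma$-finite measure space, let $p$ be a pointwise consistent $\mu$-heat kernel with associated self-adjoint operator $H_p\ge0$ in $\mathsf{L}^2(X,\mathrm{d}\mu)$, let $q\ge1$, and let $F_1:X\to(0,\infty)$ be an $\mathsf{L}^q$-control function for $p$. Let $E\to X$ be a measurable Hermitian vector bundle of rank $d\in\mathbb{N}$ which is countably generated, and let $\tilde H$ be a self-adjoint nonnegative operator in $\Gamma_{\mathsf{L}^2}(X,E;\mathrm{d}\mu)$ which satisfies the Kato domination property $\tilde H\succeq H_p$. Assume that $W\in\Gamma(X,\mathrm{End}(E))$ admits a decomposition $W=W_1+W_2$ with $W_j\in\Gamma(X,\mathrm{End}(E))$ pointwise self-adjoint and - either $q=1$ and $$|W_1|\in\mathsf{L}^2(X,F_1\mathrm{d}\mu),\quad |W_2|\in\mathsf{L}^\infty_\infty(X,\mathrm{d}\mu)\cap\mathsf{L}_\infty(X,F_1\mathrm{d}\mu),$$ - or $q>1$, $F_1\equiv1$ and $$|W_1|\in\mathsf{L}^{2q}(X,\mathrm{d}\mu),\quad |W_2|\in\mathsf{L}^\infty_\infty(X,\mathrm{d}\mu).$$ Then for all $a>0$ the operator $\hat W(\tilde H+a)^{-1}$ is compact in $\Gamma_{\mathsf{L}^2}(X,E;\mathrm{d}\mu)$. In particular, $\mathrm{Dom}(\tilde H+\hat W)=\mathrm{Dom}(\tilde H)$, and $\tilde H+\hat W$ is self-adjoint and semibounded from below with $\sigma_{\mathrm{ess}}(\tilde H+\hat W)=\sigma_{\mathrm{ess}}(\tilde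 H)$.
   Context: Heat kernels. A measurable map $p:(0,\infty)\times X\times X\to[0,\infty)$ is called a pointwise consistent $\mu$-heat kernel if (1) $p(t+s,x,y)=\int_X p(t,x,z)p(s,z,y)\,\mathrm{d}\mu(z)$ for all $t,s>0$, $x,y\in X$; (2) $p(t,x,y)=p(t,y,x)$ for all $t>0$, $x,y\in X$; (3) $\int_X p(t,x,y)\,\mathrm{d}\mu(y)\le1$ for all $t>0$, $x\in X$; (4) with $P_tf(x):=\int_X p(t,x,y)f(y)\,\mathrm{d}\mu(y)$, $t>0$, $f\in\mathsf{L}^2(X,\mathrm{d}\mu)$, one has $\lim_{t\to0+}\|P_tf-f\|_{\mathsf{L}^2(X,\mathrm{d}\mu)}=0$. With $P_0:=\mathrm{id}$, $(P_t)_{t\ge0}$ is a strongly continuous contraction semigroup of self-adjoint operators, and $H_p$ is the unique self-adjoint nonnegative operator in $\mathsf{L}^2(X,\mathrm{d}\mu)$ with $\mathrm{e}^{-tH_p}=P_t$ for all $t\ge0$. Control functions. Given $q\ge1$, a measurable $F_1:X\to(0,\infty)$ is an $\mathsf{L}^q$-control function for $p$ if there is a measurable $F_2:(0,\infty)\to(0,\infty)$ with $p(t,x,x)\le F_1(x)F_2(t)$ for all $t>0$, $x\in X$, and $\int_0^\infty\mathrm{e}^{-t}F_2(t)^{1/(2q)}\,\mathrm{d}t<\infty$. Function spaces. $F_1\mathrm{d}\mu$ is the measure with density $F_1$ with respect to $\mu$. For a measure $\nu$ on $X$, $\mathsf{L}_\infty(X,\mathrm{d}\nu)$ is the set of $\nu$-equivalence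 classes of measurable $h:X\to\mathbb{C}$ with $\nu\{|h|\ge c\}<\infty$ for all $c>0$, and $\mathsf{L}^\infty_\infty(X,\mathrm{d}\nu):=\mathsf{L}^\infty(X,\mathrm{d}\nu)\cap\mathsf{L}_\infty(X,\mathrm{d}\nu)$. Bundles. A (complex) measurable vector bundle over $X$ of rank $d$ is a surjective measurable map $\pi:E\to X$ of measurable spaces such that each fiber $E_x:=\pi^{-1}\{x\}$ is a complex linear space and each $x\in X$ lies in a measurable set $U\subset X$ for which there is a measurable bijection $\phi:\pi^{-1}(U)\to U\times\mathbb{C}^d$ with measurable inverse (a vector bundle chart with domain $U$) such that $\mathrm{pr}_1\circ\phi=\pi$ and $\phi^{-1}(y,\cdot):\mathbb{C}^d\to E_y$ is a linear isomorphism for every $y\in U$. It is countably generated if $X$ is a countable union of measurable sets each of which is the domain of a vector bundle chart. $\Gamma(U,E)$ denotes the measurable sections over $U$. A measurable Hermitian structure is a family of complex scalar products $(\cdot,\cdot)_x$ on $E_x$, $x\in X$, such that $x\mapsto(\psi_1(x),\psi_2(x))_x$ is measurable for all $\psi_1,\psi_2\in\Gamma(X,E)$; $|\cdot|_x$ denotes the induced norm on $E_x$ and also the operator norm on $\mathrm{End}(E_x)$. $\mathrm{End}(E)=\bigsqcup_x\mathrm{End}(E_x)\to X$ is a measurable vector bundle of rank $d^2$ via the charts induced by those of $E$. $\Gamma_{\mathsf{L}^2}(X,E;\mathrm{d}\mu)$ is the Hilbert space of $\mu$-equivalence classes of measurable sections $f$ with $\int_X|f(x)|_x^2\,\mathrm{d}\mu(x)<\infty$.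 For $W\in\Gamma(X,\mathrm{End}(E))$, $\hat W$ is the maximally defined multiplication operator: $\mathrm{Dom}(\hat W)=\{f\in\Gamma_{\mathsf{L}^2}(X,E;\mathrm{d}\mu):Wf\in\Gamma_{\mathsf{L}^2}(X,E;\mathrm{d}\mu)\}$, $\hat Wf(x)=W(x)f(x)$; and $|W|$ is the function $x\mapsto|W(x)|_x$. The sum $\tilde H+\hat W$ is defined on $\mathrm{Dom}(\tilde H)\cap\mathrm{Dom}(\hat W)$. Domination. For self-adjoint nonnegative $S$ in $\mathsf{L}^2(X,\mathrm{d}\mu)$ and $T$ in $\Gamma_{\mathsf{L}^2}(X,E;\mathrm{d}\mu)$, one writes $T\succeq S$ ($T$ dominates $S$ in the Kato sense) if for all $t\ge0$ and $f\in\Gamma_{\mathsf{L}^2}(X,E;\mathrm{d}\mu)$ one has $|\mathrm{e}^{-tT}f(x)|_x\le\mathrm{e}^{-tS}|f|(x)$ for $\mu$-a.e. $x$; equivalently, for all $a>0$ and all such $f$, $|(T+a)^{-1}f(x)|_x\le(S+a)^{-1}|f|(x)$ for $\mu$-a.e. $x\in X$. *)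

(* Defs.v *)
From HB Require Import structures.
From mathcomp Require Import all_boot all_order all_algebra.
From mathcomp Require Import all_classical all_reals all_analysis.
From mathcomp Require Import measurable_realfun complex ring lra.

Set Implicit Arguments.
Unset Strict Implicit.
Unset Printing Implicit Defensive.
Import Order.TTheory GRing.Theory Num.Theory numFieldNormedType.Exports.

Local Open Scope classical_set_scope.
Local Open Scope ring_scope.
Local Open Scope quotient_scope.

Definition cmatrix (R : realType) (m n : nat) : Type := 'M[R[i]]_(m, n).

Section cmatrix_measurable.
Variables (R : realType) (m n : nat).

HB.instance Definition _ := GRing.Lmodule.copy (cmatrix R m n) 'M[R[i]]_(m, n).
HB.instance Definition _ := isPointed.Build (cmatrix R m n) 0.

(* The coordinate maps Re z_ij, Im z_ij generate the Borel sigma-algebra. *)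
Definition cmatrix_gen : set_system (cmatrix R m n) :=
  [set A | exists i j (B : set R), measurable B /\
     (A = [set v : cmatrix R m n | B (complex.Re (v i j))] \/
      A = [set v : cmatrix R m n | B (complex.Im (v i j))])].

HB.instance Definition _ := @isMeasurable.Build (sigma_display cmatrix_gen)
  (cmatrix R m n) <<s cmatrix_gen >> (@sigma_algebra0 _ setT _)
  (@sigma_algebraC (cmatrix R m n) cmatrix_gen) (@sigma_algebra_bigcup _ setT _).

End cmatrix_measurable.

Definition Cmeasurable_fun d (X : measurableType d) (R : realType)
    (D : set X) (f : X -> R[i]) : Prop :=
  measurable_fun D (fun x => complex.Re (f x)) /\
  measurable_fun D (fun x => complex.Im (f x)).

Definition Cintegral d (X : measurableType d) (R : realType)
    (mu : {measure set X -> \bar R}) (f : X -> R[i]) : R[i] :=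
  Complex (Rintegral mu setT (fun x => complex.Re (f x)))
          (Rintegral mu setT (fun x => complex.Im (f x))).

(* A bundle is given by its family of fibres E_x; the total space is then
   {x : X & E_x} (with its own sigma-algebra), the projection is projT1, and the
   fibre over x is E_x, so that surjectivity of the projection is automatic. *)
Section charts.
Context dX (X : measurableType dX) (R : realType) (r : nat).
Variables (E : X -> lmodType R[i]) (M : set_system {x : X & E x}).

(* phi is the fibre part of a chart pi^-1(U) -> U x C^r, and psi that of its
   inverse; their values outside U are irrelevant. *)
Record is_chart (U : set X) (phi : forall x, E x -> cmatrix R r 1)
    (psi : forall x, cmatrix R r 1 -> E x) : Prop := {
  chart_dom : measurable U ;
  chart_linear : forall x, U x -> linear (phi x) ;
  chartK : forall x, U x -> cancel (phi x) (psi x) ;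
  chartVK : forall x, U x -> cancel (psi x) (phi x) ;
  chart_meas : forall B : set (X * cmatrix R r 1), measurable B ->
    M [set e | U (projT1 e) /\ B (projT1 e, phi (projT1 e) (projT2 e))] ;
  chartV_meas : forall A, M A ->
    measurable [set z : X * cmatrix R r 1 |
                 U z.1 /\ A (existT _ z.1 (psi z.1 z.2))] }.

Definition chart_domain (U : set X) : Prop := exists phi psi, is_chart U phi psi.

Definition measurable_section (f : forall x, E x) : Prop :=
  forall A, M A -> measurable [set x | A (existT _ x (f x))].

End charts.

Record vbundle dX (X : measurableType dX) (R : realType) (r : nat) := VBundle {
  fiber :> X -> lmodType R[i] ;
  bundle_meas : set_system {x : X & fiber x} ;
  bundle_sigma : sigma_algebra setT bundle_meas ;
  bundle_proj : forall U : set X, measurable U ->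
    bundle_meas [set e | U (projT1 e)] ;
  bundle_triv : forall x : X, exists2 U, U x & chart_domain r bundle_meas U }.

Definition countably_generated dX (X : measurableType dX) (R : realType) r
    (E : vbundle X R r) : Prop :=
  exists U : nat -> set X,
    \bigcup_n U n = setT /\ forall n, chart_domain r (@bundle_meas _ _ _ _ E) (U n).

(* Hermitian bundles are bundled with countable generation, which makes the sum
   of two measurable sections measurable. *)
Record hbundle dX (X : measurableType dX) (R : realType) (r : nat) := HBundle {
  hb_bundle :> vbundle X R r ;
  herm : forall x, {dot (hb_bundle x) for Num.conj} ;
  herm_meas : forall f g : (forall x, hb_bundle x),
    measurable_section (@bundle_meas _ _ _ _ hb_bundle) f ->
    measurable_section (@bundle_meas _ _ _ _ hb_bundle) g ->
    Cmeasurable_fun setT (fun x => herm x (f x) (g x)) ;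
  hb_cg : countably_generated hb_bundle }.

Section fibre_norms.
Context dX (X : measurableType dX) (R : realType) (r : nat) (E : hbundle X R r).

Definition sqfnorm x (v : E x) : R := complex.Re (herm E x v v).
Definition fnorm x (v : E x) : R := Num.sqrt (sqfnorm v).

Definition fopnorm x (A : E x -> E x) : R :=
  sup [set fnorm (A v) | v in [set v | fnorm v <= 1]].

End fibre_norms.

Section measurable_sections.
Context dX (X : measurableType dX) (R : realType).

Lemma measurable_cmatrix (D : set X) m n (g : X -> cmatrix R m n) :
  (forall i j, Cmeasurable_fun D (fun x => g x i j)) -> measurable_fun D g.
Proof.
move=> mg mD; move: {+}mD; apply: (measurability (@cmatrix_gen R m n)) => //.
move=> _ [B [i [j [C [mC BE]]]] <-].
have [mr mi] := mg i j.
by case: BE => ->; [exact: (mr mD)|exact: (mi mD)].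
Qed.

Lemma measurable_fun_pairD d1 d2 (Y : measurableType d1) (Z : measurableType d2)
    (D : set X) (f : X -> Y) (g : X -> Z) :
  measurable_fun D f -> measurable_fun D g ->
  measurable_fun D (fun x => (f x, g x)).
Proof.
move=> mf mg mD; move: {+}mD.
apply: (measurability _ (measurable_prod_measurableType Y Z)).
move=> _ [_ [A mA [B mB <-]] <-].
have := measurableI _ _ (mf mD _ mA) (mg mD _ mB).
by congr measurable; apply/seteqP; split => x /=; tauto.
Qed.

Context (r : nat) (E : vbundle X R r).
Local Notation msec := (measurable_section (@bundle_meas _ _ _ _ E)).

Lemma chart_coord U (phi : forall x, E x -> cmatrix R r 1) psi (f : forall x, E x) :
  is_chart (@bundle_meas _ _ _ _ E) U phi psi -> msec f ->
  forall i j, Cmeasurable_fun U (fun x => phi x (f x) i j).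
Proof.
move=> ch mf i j.
have H (h : R[i] -> R) :
   (forall B : set R, measurable B ->
     cmatrix_gen [set v : cmatrix R r 1 | B (h (v i j))]) ->
   measurable_fun U (fun x => h (phi x (f x) i j)).
  move=> gh mU B mB.
  have mB' : measurable [set v : cmatrix R r 1 | B (h (v i j))].
    by apply: sub_sigma_algebra; exact: gh.
  have := mf _ (chart_meas ch (measurableX measurableT mB')).
  by congr measurable; apply/seteqP; split => x /= [] //; tauto.
split; apply: H => B mB; exists i, j, B; split=> //; [by left|by right].
Qed.

Lemma coord_section (U : nat -> set X)
    (phi : nat -> forall x, E x -> cmatrix R r 1) psi (f : forall x, E x) :
  \bigcup_n U n = setT ->
  (forall n, is_chart (@bundle_meas _ _ _ _ E) (U n) (phi n) (psi n)) ->
  (forall n i j, Cmeasurable_fun (U n)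
     (fun x => phi n x (f x) i j)) ->
  msec f.
Proof.
move=> UT ch mf A mA.
have -> : [set x | A (existT _ x (f x))] =
  \bigcup_n (U n `&` [set x | A (existT _ x (psi n x (phi n x (f x))))]).
  apply/seteqP; split => x /=.
    move=> Afx; have : (\bigcup_n U n) x by rewrite UT.
    by move=> [n _ Ux]; exists n => //; split=> //=; rewrite (chartK (ch n)).
  by move=> [n _ [Ux /=]]; rewrite (chartK (ch n)).
apply: bigcupT_measurable => n.
have mp : measurable_fun (U n) (fun x => (x, phi n x (f x) : cmatrix R r 1)).
  by apply: measurable_fun_pairD => //; exact: measurable_cmatrix.
have := mp (chart_dom (ch n)) _ (chartV_meas (ch n) mA).
by congr measurable; apply/seteqP; split => x /= []; tauto.
Qed.

Lemma CmeasurableD (D : set X) (f g : X -> R[i]) : Cmeasurable_fun D f ->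
  Cmeasurable_fun D g -> Cmeasurable_fun D (fun x => f x + g x).
Proof.
move=> [fr fi] [gr gi]; split.
  under eq_fun do rewrite raddfD; exact: measurable_funD.
under eq_fun do rewrite raddfD; exact: measurable_funD.
Qed.

Lemma complex_ReM (a z : R[i]) :
  complex.Re (a * z) =
    complex.Re a * complex.Re z - complex.Im a * complex.Im z.
Proof. by case: a z => [a b] [c e]. Qed.

Lemma complex_ImM (a z : R[i]) :
  complex.Im (a * z) =
    complex.Re a * complex.Im z + complex.Im a * complex.Re z.
Proof. by case: a z => [a b] [c e]. Qed.

Lemma CmeasurableM (D : set X) (f g : X -> R[i]) : Cmeasurable_fun D f ->
  Cmeasurable_fun D g -> Cmeasurable_fun D (fun x => f x * g x).
Proof.
move=> [fr fi] [gr gi]; split.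
  under eq_fun do rewrite complex_ReM.
  by apply: measurable_funB; apply: measurable_funM.
under eq_fun do rewrite complex_ImM.
by apply: measurable_funD; apply: measurable_funM.
Qed.

Lemma Cmeasurable_cst (D : set X) (a : R[i]) : Cmeasurable_fun D (fun=> a : R[i]).
Proof. by split; exact: measurable_cst. Qed.

Lemma measurable_sectionP : countably_generated E ->
  forall (a : R[i]) (f g : forall x, E x), msec f -> msec g ->
  msec (fun x => a *: f x + g x).
Proof.
move=> [U [UT chU]] a f g mf mg.
have /choice[phi H] := chU; have /choice[psi ch] := H.
apply: (coord_section UT ch) => n i j.
have mV h : msec h -> Cmeasurable_fun (U n) (fun x => phi n x (h x) i j).
  by move=> mh; exact: (chart_coord (ch n) mh).
have := CmeasurableD (CmeasurableM (Cmeasurable_cst (U n) a) (mV _ mf)) (mV _ mg).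
have E1 x : U n x -> a * phi n x (f x) i j + phi n x (g x) i j =
    phi n x (a *: f x + g x) i j.
  by move=> Ux; rewrite (chart_linear (ch n) Ux) !mxE.
move=> [mr mi]; split.
  apply: eq_measurable_fun mr => x /set_mem Ux.
  by rewrite E1.
apply: eq_measurable_fun mi => x /set_mem Ux.
by rewrite E1.
Qed.

End measurable_sections.

Section sections_lmod.
Context dX (X : measurableType dX) (R : realType) (E : X -> lmodType R[i]).

Definition sections : Type := forall x, E x.

HB.instance Definition _ := gen_eqMixin sections.
HB.instance Definition _ := gen_choiceMixin sections.

Implicit Types f g h : sections.
Let sadd f g : sections := fun x => f x + g x.
Let sopp f : sections := fun x => - f x.
Let szero : sections := fun x => 0.
Let sscale (a : R[i]) f : sections := fun x => a *: f x.

Let saddA : associative sadd.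
Proof. by move=> f g h; apply: functional_extensionality_dep => x; exact: addrA. Qed.
Let saddC : commutative sadd.
Proof. by move=> f g; apply: functional_extensionality_dep => x; exact: addrC. Qed.
Let sadd0 : left_id szero sadd.
Proof. by move=> f; apply: functional_extensionality_dep => x; exact: add0r. Qed.
Let saddN : left_inverse szero sopp sadd.
Proof. by move=> f; apply: functional_extensionality_dep => x; exact: addNr. Qed.

HB.instance Definition _ := GRing.isZmodule.Build sections saddA saddC sadd0 saddN.

Let sscaleA a b f : sscale a (sscale b f) = sscale (a * b) f.
Proof. by apply: functional_extensionality_dep => x; exact: scalerA. Qed.
Let sscale1 : left_id 1 sscale.
Proof. by move=> f; apply: functional_extensionality_dep => x; exact: scale1r. Qed.
Let sscaleDr : right_distributive sscale +%R.
Proof.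
by move=> a f g; apply: functional_extensionality_dep => x; exact: scalerDr.
Qed.
Let sscaleDl f : {morph sscale^~ f : a b / a + b}.
Proof. by move=> a b; apply: functional_extensionality_dep => x; exact: scalerDl. Qed.

HB.instance Definition _ :=
  GRing.Zmodule_isLmodule.Build R[i] sections sscaleA sscale1 sscaleDr sscaleDl.

End sections_lmod.

Section Cintegral_theory.
Context dX (X : measurableType dX) (R : realType).
Variable mu : {measure set X -> \bar R}.
Implicit Types f g : X -> R[i].

Definition Cintegrable f : Prop :=
  mu.-integrable setT (EFin \o (fun x => complex.Re (f x))) /\
  mu.-integrable setT (EFin \o (fun x => complex.Im (f x))).

Lemma CintegralD f g : Cintegrable f -> Cintegrable g ->
  Cintegral mu (fun x => f x + g x) = Cintegral mu f + Cintegral mu g.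
Proof.
move=> [fr fi] [gr gi]; rewrite /Cintegral.
under eq_Rintegral do rewrite raddfD.
rewrite RintegralD//.
under [X in Complex _ X]eq_Rintegral do rewrite raddfD.
by rewrite RintegralD.
Qed.

Lemma CintegrableZ (a : R[i]) f : Cintegrable f -> Cintegrable (fun x => a * f x).
Proof.
move=> [fr fi]; have intZ (c : R) h : mu.-integrable setT (EFin \o h) ->
    mu.-integrable setT (EFin \o (fun x => c * h x)).
  by move=> ih; apply: eq_integrable (integrableZl measurableT c ih).
split.
  have := integrableB measurableT (intZ (complex.Re a) _ fr) (intZ (complex.Im a) _ fi).
  by apply: eq_integrable => // x _ /=; rewrite complex_ReM EFinB.
have := integrableD measurableT (intZ (complex.Re a) _ fi) (intZ (complex.Im a) _ fr).
by apply: eq_integrable => // x _ /=; rewrite complex_ImM EFinD.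
Qed.

Lemma CintegralZ (a : R[i]) f : Cintegrable f ->
  Cintegral mu (fun x => a * f x) = a * Cintegral mu f.
Proof.
move=> [fr fi]; have intZ (c : R) h : mu.-integrable setT (EFin \o h) ->
    mu.-integrable setT (EFin \o (fun x => c * h x)).
  by move=> ih; apply: eq_integrable (integrableZl measurableT c ih).
apply/eqP; rewrite eq_complex complex_ReM complex_ImM /=; apply/andP; split.
  under eq_Rintegral do rewrite complex_ReM.
  by rewrite RintegralB ?RintegralZl//; exact: intZ.
under eq_Rintegral do rewrite complex_ImM.
by rewrite RintegralD ?RintegralZl//; exact: intZ.
Qed.

Lemma Cintegral_conj f : Cintegrable f ->
  Cintegral mu (fun x => Num.conj (f x)) = Num.conj (Cintegral mu f).
Proof.
move=> [fr fi]; rewrite /Cintegral -[RHS]/(Complex _ (- _)); congr Complex.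
  by apply: eq_Rintegral => x _; case: (f x).
rewrite -mulN1r -RintegralZl//; apply: eq_Rintegral => x _.
by rewrite mulN1r; case: (f x).
Qed.

Lemma ae_eq_Cintegral f g : Cmeasurable_fun setT f -> Cmeasurable_fun setT g ->
  {ae mu, forall x, f x = g x} -> Cintegral mu f = Cintegral mu g.
Proof.
move=> [fr fi] [gr gi] fg; congr Complex; congr fine; apply: ae_eq_integral => //;
  try exact/measurable_EFinP; by apply: filterS fg => x -> _.
Qed.

End Cintegral_theory.

Section L2.
Context dX (X : measurableType dX) (R : realType).
Context (mu : {measure set X -> \bar R}) (r : nat) (E : hbundle X R r).

Local Notation msec := (measurable_section (@bundle_meas _ _ _ _ E)).

Lemma Im_herm x (v : E x) : complex.Im (herm E x v v) = 0.
Proof. by have := dnorm_ge0 (herm E x) v; rewrite lecE => /andP[/eqP]. Qed.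

Lemma sqfnorm_ge0 x (v : E x) : 0 <= sqfnorm v.
Proof. by have := dnorm_ge0 (herm E x) v; rewrite lecE => /andP[]. Qed.

Lemma sqfnorm0 x : sqfnorm (0 : E x) = 0.
Proof. by rewrite /sqfnorm linear0l. Qed.

Lemma sqfnormZ x a (v : E x) :
  sqfnorm (a *: v) = (complex.Re a ^+ 2 + complex.Im a ^+ 2) * sqfnorm v.
Proof.
rewrite /sqfnorm linearZl_LR linearZr_LR /= mulrA.
have -> : a * Num.conj a = (complex.Re a ^+ 2 + complex.Im a ^+ 2)%:C%C.
  case: a => b c; apply/eqP; rewrite eq_complex /= !expr2 mulrN opprK eqxx /=.
  by rewrite mulrN addrC mulrC subrr.
by rewrite complex_ReM /= mul0r subr0.
Qed.

Lemma sqfnormD x (u v : E x) :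
  sqfnorm (u + v) = sqfnorm u + sqfnorm v + complex.Re (herm E x u v) *+ 2.
Proof.
rewrite /sqfnorm dnormD !raddfD /= mulr2n; congr (_ + (_ + _)).
by case: (herm E x u v).
Qed.

Lemma sqfnormB x (u v : E x) :
  sqfnorm (u - v) = sqfnorm u + sqfnorm v - complex.Re (herm E x u v) *+ 2.
Proof.
rewrite sqfnormD /sqfnorm hnormN linearNr /= raddfN /= mulNrn //.
Qed.

Lemma Re_herm_le x (u v : E x) :
  `|complex.Re (herm E x u v)| <= sqfnorm u + sqfnorm v.
Proof.
have h1 := sqfnorm_ge0 (u + v); have h2 := sqfnorm_ge0 (u - v).
move: h1 h2; rewrite sqfnormD sqfnormB.
have := sqfnorm_ge0 u; have := sqfnorm_ge0 v.
move: (complex.Re _) (sqfnorm u) (sqfnorm v) => a b c c0 b0 h1 h2.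
rewrite ler_norml; apply/andP; split; lra.
Qed.

Lemma Im_herm_le x (u v : E x) :
  `|complex.Im (herm E x u v)| <= sqfnorm u + sqfnorm v.
Proof.
have := Re_herm_le ((- 'i%C) *: u) v.
rewrite sqfnormZ linearZl_LR complex_ReM /=.
by rewrite oppr0 mul0r sub0r mulNr mul1r opprK expr0n add0r sqrrN expr1n mul1r.
Qed.

Lemma sqfnorm_le x a (u v : E x) : sqfnorm (a *: u + v) <=
  2 * (complex.Re a ^+ 2 + complex.Im a ^+ 2) * sqfnorm u + 2 * sqfnorm v.
Proof.
have := sqfnorm_ge0 (a *: u - v).
rewrite -mulrA -sqfnormZ sqfnormB sqfnormD => h.
lra.
Qed.

Definition sqint : {pred sections E} := fun f =>
  `[< msec f /\ (\int[mu]_x (sqfnorm (f x))%:E < +oo)%E >].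

Lemma measurable_sqfnorm (f : sections E) : msec f ->
  measurable_fun setT (fun x => sqfnorm (f x)).
Proof. by move=> mf; have [] := herm_meas mf mf. Qed.

Lemma sqint_integrable f : sqint f ->
  mu.-integrable setT (EFin \o (fun x => sqfnorm (f x))).
Proof.
move=> /asboolP[mf fi]; apply/integrableP; split.
  exact/measurable_EFinP/measurable_sqfnorm.
by under eq_integral do rewrite gee0_abs ?lee_fin ?sqfnorm_ge0//.
Qed.

Lemma measurable_section0 : msec (0 : sections E).
Proof.
have [U [UT chU]] := hb_cg E.
have /choice[phi H] := chU; have /choice[psi ch] := H.
apply: (coord_section UT ch) => n i j.
have E1 x : U n x -> phi n x 0 i j = 0.
  move=> Ux; have := chart_linear (ch n) Ux (-1) 0 0.
  by rewrite scaler0 add0r scaleN1r addNr => ->; rewrite mxE.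
have mc : measurable_fun (U n) (cst 0 : X -> R) by exact: measurable_cst.
by split; apply: eq_measurable_fun mc => x /set_mem Ux /=; rewrite E1.
Qed.

Lemma sqint_submod_closed : submod_closed sqint.
Proof.
split.
  apply/asboolP; split; first exact: measurable_section0.
  by under eq_integral do rewrite sqfnorm0; rewrite integral0.
move=> a f g sf sg.
have [/asboolP[mf _] /asboolP[mg _]] := (sf, sg).
have mh : msec (a *: f + g) by exact: (measurable_sectionP (hb_cg E)).
apply/asboolP; split=> //.
have := integrableD measurableT
  (integrableZl measurableT (2 * (complex.Re a ^+ 2 + complex.Im a ^+ 2))
     (sqint_integrable sf))
  (integrableZl measurableT 2 (sqint_integrable sg)).
move=> /integrableP[mi]; apply: le_lt_trans; apply: ge0_le_integral => //.
- by move=> x _; rewrite lee_fin sqfnorm_ge0.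
- exact/measurable_EFinP/measurable_sqfnorm.
- exact: measurableT_comp.
- move=> x _; apply: le_trans (lee_abs _).
  by rewrite -!EFinM -EFinD lee_fin; exact: sqfnorm_le.
Qed.

HB.instance Definition _ :=
  GRing.isSubmodClosed.Build R[i] (sections E) sqint sqint_submod_closed.

Definition L2pre : Type := {f : sections E | sqint f}.
HB.instance Definition _ := SubChoice.on L2pre.
HB.instance Definition _ := [SubChoice_isSubLmodule of L2pre by <:].

Definition null_section : {pred L2pre} := fun f =>
  `[< {ae mu, forall x, (\val f : sections E) x = 0} >].

Lemma null_zmod_closed : zmod_closed null_section.
Proof.
split; first by apply/asboolP; exact: aeW.
move=> f g /asboolP f0 /asboolP g0; apply/asboolP.
apply: filterS2 f0 g0 => x f0 g0.
by rewrite -[LHS]/((\val f : sections E) x - (\val g : sections E) x) f0 g0 subr0.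
Qed.

HB.instance Definition _ := GRing.isZmodClosed.Build L2pre null_section
  null_zmod_closed.

Definition L2 : Type := Quotient.quot (null_section : zmodClosed L2pre).
HB.instance Definition _ := GRing.Zmodule.on L2.
HB.instance Definition _ := ZmodQuotient.on L2.

Definition L2rep (f : L2) : forall x, E x := \val (repr f : L2pre).

Lemma L2P (f g : L2pre) :
  \pi_L2 f = \pi_L2 g <-> {ae mu, forall x, (\val f : sections E) x = (\val g : sections E) x}.
Proof.
have fgE x : (\val (f - g) : sections E) x =
    (\val f : sections E) x - (\val g : sections E) x by [].
split=> [/eqP|fg].
  rewrite -Quotient.idealrBE => /asboolP; apply: filterS => x.
  by rewrite fgE => /eqP; rewrite subr_eq0 => /eqP.
by apply/eqP; rewrite -Quotient.idealrBE; apply/asboolP; apply: filterS fg => x fg; rewrite fgE fg subrr.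
Qed.

Lemma L2rep_pi (f : L2pre) :
  {ae mu, forall x, L2rep (\pi_L2 f) x = (\val f : sections E) x}.
Proof. by apply/L2P; rewrite reprK. Qed.

Lemma L2_ext (f g : L2) : {ae mu, forall x, L2rep f x = L2rep g x} -> f = g.
Proof. by move=> /L2P; rewrite !reprK. Qed.

Let L2scale (a : R[i]) (f : L2) : L2 := \pi_L2 (a *: repr f).

Let L2scale_pi a (f : L2pre) : L2scale a (\pi_L2 f) = \pi_L2 (a *: f).
Proof.
apply/L2P; apply: filterS (L2rep_pi f) => x fx.
by rewrite -[LHS]/(a *: L2rep (\pi_L2 f) x) fx.
Qed.

Let L2scaleA a b f : L2scale a (L2scale b f) = L2scale (a * b) f.
Proof. by elim/quotW: f => f; rewrite (L2scale_pi b) !L2scale_pi scalerA. Qed.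
Let L2scale1 : left_id 1 L2scale.
Proof. by elim/quotW=> f; rewrite L2scale_pi scale1r. Qed.
Let L2scaleDr : right_distributive L2scale +%R.
Proof.
move=> a; elim/quotW=> f; elim/quotW=> g.
by rewrite -raddfD (L2scale_pi a f) (L2scale_pi a g) L2scale_pi scalerDr raddfD.
Qed.
Let L2scaleDl f : {morph L2scale^~ f : a b / a + b}.
Proof.
by elim/quotW: f => f a b; rewrite !L2scale_pi scalerDl raddfD.
Qed.

HB.instance Definition _ := GRing.Zmodule_isLmodule.Build R[i] L2
  L2scaleA L2scale1 L2scaleDr L2scaleDl.

Lemma L2rep_linear a (f g : L2) :
  {ae mu, forall x, L2rep (a *: f + g) x = a *: L2rep f x + L2rep g x}.
Proof.
elim/quotW: f => f; elim/quotW: g => g.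
have -> : a *: \pi_L2 f + \pi_L2 g = \pi_L2 (a *: f + g).
  by rewrite [a *: _](L2scale_pi a f) raddfD.
apply: filterS3 (L2rep_pi (a *: f + g)) (L2rep_pi f) (L2rep_pi g) => x.
by move=> -> -> ->.
Qed.

Lemma L2rep_sqint (f : L2) : sqint (L2rep f).
Proof. exact: (valP (repr f : L2pre)). Qed.

Lemma L2rep_meas (f : L2) : msec (L2rep f).
Proof. by have /asboolP[] := L2rep_sqint f. Qed.

Definition L2ip (f g : L2) : R[i] :=
  Cintegral mu (fun x => herm E x (L2rep f x) (L2rep g x)).

Lemma L2ip_integrable (f g : L2) :
  Cintegrable mu (fun x => herm E x (L2rep f x) (L2rep g x)).
Proof.
have [mr mi] := herm_meas (L2rep_meas f) (L2rep_meas g).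
have := integrableD measurableT (sqint_integrable (L2rep_sqint f))
  (sqint_integrable (L2rep_sqint g)).
move=> sI; split; apply: le_integrable sI => //; try exact/measurable_EFinP.
- move=> x _; apply: le_trans (lee_abs _).
  by rewrite -EFinD lee_fin; exact: Re_herm_le.
- move=> x _; apply: le_trans (lee_abs _).
  by rewrite -EFinD lee_fin; exact: Im_herm_le.
Qed.

Let L2ip_linear a (f g h : L2) : L2ip (a *: f + g) h = a * L2ip f h + L2ip g h.
Proof.
have [m1 m2] := (herm_meas (L2rep_meas f) (L2rep_meas h),
  herm_meas (L2rep_meas g) (L2rep_meas h)).
have [i1 i2] := (L2ip_integrable f h, L2ip_integrable g h).
rewrite -CintegralZ// -CintegralD//; last exact: CintegrableZ.
apply: ae_eq_Cintegral.
- by apply: herm_meas; exact: L2rep_meas.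
- by apply: CmeasurableD => //; apply: CmeasurableM => //; exact: Cmeasurable_cst.
apply: filterS (L2rep_linear a f g) => x ->.
by rewrite linearDl /= linearZl_LR.
Qed.

Let L2ip_herm (f g : L2) : L2ip f g = Num.conj (L2ip g f).
Proof.
rewrite -Cintegral_conj; last exact: L2ip_integrable.
congr Cintegral; apply: funext => x.
by rewrite hermC expr0 mul1r.
Qed.

Let L2ip_linearl h : linear_for *%R (L2ip ^~ h).
Proof. by move=> a f g; exact: L2ip_linear. Qed.

Let L2ip_linearr h : linear_for (Num.conj \; *%R) (L2ip h).
Proof.
move=> a f g; rewrite [LHS]L2ip_herm L2ip_linear rmorphD rmorphM /=.
by rewrite [L2ip h f]L2ip_herm [L2ip h g]L2ip_herm.
Qed.

HB.instance Definition _ := bilinear_isBilinear.Build R[i] L2 L2 R[i]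
  *%R (Num.conj \; *%R) L2ip (conj L2ip_linearl L2ip_linearr).

Let L2ip_hermitian (f g : L2) :
  L2ip f g = (-1) ^+ false * Num.conj (L2ip g f).
Proof. by rewrite expr0 mul1r -L2ip_herm. Qed.

HB.instance Definition _ := isHermitianSesquilinear.Build R[i] L2 false Num.conj
  L2ip L2ip_hermitian.

Let L2ip_gt0 (f : L2) : f != 0 -> 0 < L2ip f f.
Proof.
move=> f0; have sf := sqint_integrable (L2rep_sqint f).
rewrite ltcE /=; apply/andP; split.
  rewrite (@eq_Rintegral _ _ _ mu setT (cst 0)) ?Rintegral_cst ?mul0r//.
  by move=> x _; exact: Im_herm.
rewrite lt_neqAle Rintegral_ge0 ?andbT; last by move=> x _; exact: sqfnorm_ge0.
apply: contra f0 => /eqP/esym I0; apply/eqP/L2_ext.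
have : (\int[mu]_x `|(EFin \o (fun x => sqfnorm (L2rep f x))) x| = 0)%E.
  under eq_integral do rewrite gee0_abs ?lee_fin ?sqfnorm_ge0//.
  by rewrite -[LHS]fineK ?integrable_fin_num// [fine _]I0.
move=> /(ae_eq_integral_abs mu measurableT (measurable_int _ sf)).
have := L2rep_pi (0 : L2pre); rewrite raddf0; apply: filterS2 => x -> /(_ I) [sf0].
apply/eqP; rewrite -(dnorm_eq0 (herm E x)) eq_complex /= Im_herm eqxx andbT.
exact/eqP.
Qed.

HB.instance Definition _ := isDotProduct.Build R[i] L2 L2ip L2ip_gt0.

End L2.

Definition L2dot dX (X : measurableType dX) (R : realType)
    (mu : {measure set X -> \bar R}) r (E : hbundle X R r) :
  {dot (L2 mu E) for Num.conj} := @L2ip dX X R mu r E.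

(* L^2(X, mu) is obtained as the space of L^2 sections of the trivial line bundle
   X x C; see line_sectionP for its measurable sections. *)
Section Cdot.
Variable R : realType.

Definition Cdot (u v : R[i]^o) : R[i] := u * Num.conj v.

Let Cdot_linearl v : linear_for *%R (Cdot ^~ v).
Proof. by move=> a x y; rewrite /Cdot mulrDl mulrA. Qed.
Let Cdot_linearr u : linear_for (Num.conj \; *%R) (Cdot u).
Proof. by move=> a x y; rewrite /Cdot rmorphD rmorphM mulrDr /= mulrCA. Qed.
HB.instance Definition _ := bilinear_isBilinear.Build R[i] R[i]^o R[i]^o R[i]
  *%R (Num.conj \; *%R) Cdot (conj Cdot_linearl Cdot_linearr).
Let Cdot_hermitian (u v : R[i]^o) :
  Cdot u v = (-1) ^+ false * Num.conj (Cdot v u).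
Proof. by rewrite expr0 mul1r /Cdot rmorphM /= conjCK mulrC. Qed.
HB.instance Definition _ := isHermitianSesquilinear.Build R[i] R[i]^o false
  Num.conj Cdot Cdot_hermitian.
Let Cdot_gt0 (u : R[i]^o) : u != 0 -> 0 < Cdot u u.
Proof. by move=> u0; rewrite mul_conjC_gt0. Qed.
HB.instance Definition _ := isDotProduct.Build R[i] R[i]^o Cdot Cdot_gt0.

End Cdot.

Section line_bundle.
Context dX (X : measurableType dX) (R : realType).

Let line_fiber (x : X) : lmodType R[i] := R[i]^o.

Let line_meas : set_system {x : X & line_fiber x} :=
  [set A | measurable
    [set z : X * cmatrix R 1 1 | A (existT line_fiber z.1 (z.2 0 0))]].

Let line_sigma : sigma_algebra setT line_meas.
Proof.
split=> [|A mA|F mF]; rewrite /line_meas /=.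
- exact: measurable0.
- have := measurableC mA; congr measurable; apply/seteqP; split => z /=.
    by move=> ?; split.
  by move=> [].
- exact: bigcupT_measurable mF.
Qed.

Let line_proj (U : set X) : measurable U -> line_meas [set e | U (projT1 e)].
Proof.
move=> mU; rewrite /line_meas /=.
have := measurableX mU (@measurableT _ (cmatrix R 1 1)).
by congr measurable; apply/seteqP; split => z /=; tauto.
Qed.

Let line_is_chart : is_chart line_meas setT
  (fun x (v : line_fiber x) => const_mx v : cmatrix R 1 1)
  (fun x (w : cmatrix R 1 1) => w 0 0).
Proof.
split.
- exact: measurableT.
- by move=> x _ a u v; apply/matrixP => i j; rewrite !mxE.
- by move=> x _ v; rewrite mxE.
- by move=> x _ w; apply/matrixP => i j; rewrite mxE !ord1.
- move=> B mB; rewrite /line_meas /=; move: mB.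
  congr measurable; apply/seteqP; split => -[x w] /=.
    by move=> Bw; split=> //; congr (B (_, _)): Bw;
      apply/matrixP => i j; rewrite mxE !ord1.
  by move=> [_]; congr (B (_, _)); apply/matrixP => i j; rewrite mxE !ord1.
- move=> A mA; move: mA; rewrite /line_meas /=.
  by congr measurable; apply/seteqP; split => z /=; tauto.
Qed.

Let line_chart : chart_domain 1 line_meas setT.
Proof. by do 2!eexists; exact: line_is_chart. Qed.

Definition line_vbundle : vbundle X R 1 :=
  @VBundle _ X R 1 line_fiber line_meas line_sigma line_proj
    (fun x => ex_intro2 _ _ setT I line_chart).

Lemma line_sectionP (f : X -> R[i]) :
  measurable_section (@bundle_meas _ _ _ _ line_vbundle) f <->
  Cmeasurable_fun setT f.
Proof.
split=> [mf|[fr fi]].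
  have [mr mi] := chart_coord (E := line_vbundle) line_is_chart mf 0 0.
  split; first by apply: eq_measurable_fun mr => x _; rewrite mxE.
  by apply: eq_measurable_fun mi => x _; rewrite mxE.
apply: (coord_section (E := line_vbundle) _ (fun n : nat => line_is_chart)).
  by apply/seteqP; split=> // x _; exists 0%N.
move=> _ i j; split; first by apply: eq_measurable_fun fr => x _; rewrite mxE.
by apply: eq_measurable_fun fi => x _; rewrite mxE.
Qed.

Let line_herm_meas (f g : forall x, line_vbundle x) :
  measurable_section (@bundle_meas _ _ _ _ line_vbundle) f ->
  measurable_section (@bundle_meas _ _ _ _ line_vbundle) g ->
  Cmeasurable_fun setT (fun x => @Cdot R (f x) (g x)).
Proof.
move=> /line_sectionP mf /line_sectionP[gr gi]; apply: CmeasurableM => //.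
split; first by apply: eq_measurable_fun gr => x _; case: (g x).
have := measurable_funN gi.
by apply: eq_measurable_fun => x _ /=; case: (g x).
Qed.

Let line_cg : countably_generated line_vbundle.
Proof.
exists (fun=> setT); split=> [|_]; last exact: line_chart.
by apply/seteqP; split=> // x _; exists 0%N.
Qed.

Definition line_bundle : hbundle X R 1 :=
  @HBundle _ X R 1 line_vbundle (fun=> @Cdot R) line_herm_meas line_cg.

End line_bundle.

Section absolute_value.
Context dX (X : measurableType dX) (R : realType).
Context (mu : {measure set X -> \bar R}) (r : nat) (E : hbundle X R r).

Lemma line_sqfnorm (x : X) (a : R) :
  sqfnorm (a%:C%C : line_bundle X R x) = a ^+ 2.
Proof.
by rewrite -[LHS]/(complex.Re (a%:C%C * Num.conj a%:C%C)) complex_ReM /= mul0r subr0.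
Qed.

Lemma sqint_fnorm (f : L2 mu E) :
  @sqint _ X R mu 1 (line_bundle X R) (fun x => (fnorm (L2rep f x))%:C%C).
Proof.
apply/asboolP; split.
  apply/line_sectionP; split; last exact: measurable_cst.
  apply: (@measurableT_comp _ _ _ _ _ _ (@Num.sqrt R)).
    by apply: continuous_measurable_fun => x; exact: sqrt_continuous.
  exact/measurable_sqfnorm/L2rep_meas.
have /asboolP[_] := L2rep_sqint f; congr (_ < _)%E; apply: eq_integral => x _.
by rewrite line_sqfnorm sqr_sqrtr// sqfnorm_ge0.
Qed.

Definition L2abs (f : L2 mu E) : L2 mu (line_bundle X R) :=
  \pi_(L2 mu (line_bundle X R))
    (exist (@sqint _ X R mu 1 (line_bundle X R)) _ (sqint_fnorm f)).

End absolute_value.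

Section operators.
Context (R : realType) (V : lmodType R[i]) (ip : {dot V for Num.conj}).

Definition hnorm (f : V) : R := Num.sqrt (complex.Re (ip f f)).

(* A possibly unbounded operator is identified with its graph; two operators
   are equal, domains included, when their graphs are. *)
Definition operator : Type := set (V * V).

Implicit Types T S K : operator.

Definition dom T : set V := [set f | exists g, T (f, g)].

Definition is_operator T : Prop :=
  [/\ T 0, (forall a u v, T u -> T v -> T (a *: u + v)) &
      forall g, T (0, g) -> g = 0].

Definition op_comp S T : operator :=
  [set u | exists2 g, T (u.1, g) & S (g, u.2)].

Definition op_sum S T : operator :=
  [set u | exists g h, [/\ S (u.1, g), T (u.1, h) & u.2 = g + h]].

Definition op_inv T : operator := [set u | T (u.2, u.1)].

Definition op_shift T (z : R[i]) : operator :=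
  [set u | T (u.1, u.2 - z *: u.1)].

Definition densely_defined T : Prop :=
  forall f e, 0 < e -> exists2 g, dom T g & hnorm (f - g) < e.

Definition op_adjoint T : operator :=
  [set u | forall f g, T (f, g) -> ip g u.1 = ip f u.2].

Definition selfadjoint T : Prop :=
  [/\ is_operator T, densely_defined T & T = op_adjoint T].

Definition nonnegative T : Prop := forall f g, T (f, g) -> 0 <= ip g f.

Definition semibounded_below T : Prop :=
  exists c : R, forall f g, T (f, g) -> c%:C%C * ip f f <= ip g f.

Definition compact_operator K : Prop :=
  [/\ is_operator K, dom K = setT &
   forall u v : nat -> V, (forall n, K (u n, v n)) ->
     (exists C : R, forall n, hnorm (u n) <= C) ->
     exists (s : nat -> nat) (g : V), {homo s : m n / (m < n)%N} /\
       hnorm (v (s n) - g) @[n --> \oo] --> (0 : R)].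

Definition resolvent_set T : set R[i] :=
  [set z | (forall h, exists! f, op_shift T (- z) (f, h)) /\
     exists C : R, forall f h, op_shift T (- z) (f, h) -> hnorm f <= C * hnorm h].

Definition spectrum T : set R[i] := ~` resolvent_set T.

Definition eigenspace T (z : R[i]) : set V := [set f | T (f, z *: f)].

Definition finite_dimensional (A : set V) : Prop :=
  exists n (b : 'I_n -> V), forall f, A f ->
    exists c : 'I_n -> R[i], f = \sum_(i < n) c i *: b i.

Definition discrete_spectrum T : set R[i] :=
  [set z | [/\ spectrum T z,
     exists2 e : R, 0 < e &
       forall w, spectrum T w -> `|w - z| < e%:C%C -> w = z,
     exists2 f, f != 0 & eigenspace T z f &
     finite_dimensional (eigenspace T z)]].

Definition essential_spectrum T : set R[i] := spectrum T `\` discrete_spectrum T.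

(* U is only relevant at times 0 <= t. *)
Record contraction_semigroup (U : R -> V -> V) : Prop := {
  sg_linear : forall t, 0 <= t -> linear (U t) ;
  sg_id : forall f, U 0 f = f ;
  sg_add : forall s t f, 0 <= s -> 0 <= t -> U (s + t) f = U s (U t f) ;
  sg_contr : forall t f, 0 <= t -> hnorm (U t f) <= hnorm f ;
  sg_cont : forall f, hnorm (U t f - f) @[t --> 0^'+] --> (0 : R) }.

Definition generator (U : R -> V -> V) : operator :=
  [set u | hnorm ((t^-1)%:C%C *: (U t u.1 - u.1) - u.2) @[t --> 0^'+]
             --> (0 : R)].

Definition op_opp T : operator := [set u | T (u.1, - u.2)].

(* U t = e^{-tT} for all t >= 0: for self-adjoint T >= 0 this is the strongly
   continuous contraction semigroup generated by -T. *)
Definition exp_semigroup T (U : R -> V -> V) : Prop :=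
  contraction_semigroup U /\ generator U = op_opp T.

End operators.

Definition weighted dX (X : measurableType dX) (R : realType)
    (mu : {measure set X -> \bar R}) (F : X -> R)
    (mF : measurable_fun setT F) (F_gt0 : forall x, 0 < F x) (A : set X) : \bar R :=
  (\int[mu]_(x in A) (F x)%:E)%E.

Section weighted_measure.
Context dX (X : measurableType dX) (R : realType).
Variables (mu : {measure set X -> \bar R}) (F : X -> R).
Variables (mF : measurable_fun setT F) (F_gt0 : forall x, 0 < F x).

Let weighted0 : weighted mu mF F_gt0 set0 = 0%E.
Proof. by rewrite /weighted integral_set0. Qed.

Let weighted_ge0 A : (0 <= weighted mu mF F_gt0 A)%E.
Proof. by apply: integral_ge0 => x _; rewrite lee_fin ltW. Qed.

Let weighted_sigma_additive : semi_sigma_additive (weighted mu mF F_gt0).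
Proof.
move=> A mA tA mUA; rewrite /weighted ge0_integral_bigcup//; last 2 first.
- by apply/measurable_EFinP; exact: measurable_funTS.
- by move=> x _; rewrite lee_fin ltW.
apply: is_cvg_ereal_nneg_natsum_cond => n _ _.
exact: weighted_ge0.
Qed.

HB.instance Definition _ := isMeasure.Build dX X R (weighted mu mF F_gt0)
  weighted0 weighted_ge0 weighted_sigma_additive.

End weighted_measure.

Definition L_infty dX (X : measurableType dX) (R : realType)
    (nu : {measure set X -> \bar R}) (h : X -> R) : Prop :=
  measurable_fun setT h /\
  forall c : R, 0 < c -> (nu [set x | (c <= `|h x|)%R] < +oo)%E.

Section heat_kernels.
Context dX (X : measurableType dX) (R : realType).
Context (mu : {measure set X -> \bar R}).
Local Notation L2X := (L2 mu (line_bundle X R)).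

Definition heat_op (p : R -> X -> X -> R) (t : R) (f : L2X) (x : X) : R[i] :=
  Cintegral mu (fun y => (p t x y)%:C%C * (L2rep f y : R[i])).

Record heat_kernel (p : R -> X -> X -> R) : Prop := {
  hk_ge0 : forall t x y, 0 < t -> 0 <= p t x y ;
  hk_meas : measurable_fun [set z : R * (X * X) | 0 < z.1]
              (fun z => p z.1 z.2.1 z.2.2) ;
  hk_semigroup : forall t s x y, 0 < t -> 0 < s ->
    ((p (t + s) x y)%:E = \int[mu]_z (p t x z * p s z y)%:E)%E ;
  hk_sym : forall t x y, 0 < t -> p t x y = p t y x ;
  hk_sub : forall t x, 0 < t -> (\int[mu]_y (p t x y)%:E <= 1)%E ;
  hk_cont : forall f : L2X,
    Lnorm mu 2%:E (fun x =>
      (fnorm (heat_op p t f x - L2rep f x : line_bundle X R x))%:E)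
    @[t --> 0^'+] --> 0%E }.

(* H = H_p, the operator with e^{-tH} = P_t. *)
Definition heat_operator (p : R -> X -> X -> R) (H : operator L2X) : Prop :=
  [/\ selfadjoint (L2dot mu (line_bundle X R)) H,
      nonnegative (L2dot mu (line_bundle X R)) H &
   exists2 U, exp_semigroup (L2dot mu (line_bundle X R)) H U &
     forall t f, 0 < t ->
       {ae mu, forall x, (L2rep (U t f) x : R[i]) = heat_op p t f x}].

Record Lq_control (p : R -> X -> X -> R) (q : R) (F1 : X -> R) : Prop := {
  control_meas : measurable_fun setT F1 ;
  control_gt0 : forall x, 0 < F1 x ;
  control_bound : exists F2 : R -> R,
    [/\ measurable_fun (`]0, +oo[%classic : set R) F2, (forall t, 0 < t -> 0 < F2 t),
        (forall t x, 0 < t -> p t x x <= F1 x * F2 t) &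
        (\int[lebesgue_measure]_(t in (`]0%R, +oo[%classic : set R))
           (expR (- t) * F2 t `^ (2 * q)^-1)%:E < +oo)%E] }.

End heat_kernels.

Section endomorphisms.
Context dX (X : measurableType dX) (R : realType) (r : nat) (E : hbundle X R r).

(* The fibre part of the chart of End(E) induced by a chart (phi, psi) of E. *)
Definition End_chart (phi : forall x, E x -> cmatrix R r 1)
    (psi : forall x, cmatrix R r 1 -> E x) x (A : {linear E x -> E x}) :
    cmatrix R r r :=
  \matrix_(i, j) phi x (A (psi x (delta_mx j 0))) i 0.

(* The sigma-algebra of End(E) is generated by the induced charts. *)
Definition End_meas : set_system {x : X & {linear E x -> E x}} :=
  <<s [set A | exists U phi psi (B : set (X * cmatrix R r r)),
     [/\ is_chart (@bundle_meas _ _ _ _ E) U phi psi, measurable B &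
         A = [set e | U (projT1 e) /\
                B (projT1 e, End_chart phi psi (projT2 e))]]] >>.

Definition End_section (W : forall x, {linear E x -> E x}) : Prop :=
  forall A, End_meas A -> measurable [set x | A (existT _ x (W x))].

Definition pointwise_selfadjoint (W : forall x, {linear E x -> E x}) : Prop :=
  forall x (u v : E x), herm E x (W x u) v = herm E x u (W x v).

(* The maximal multiplication operator: the pairs of classes (f, g) with
   g = W f almost everywhere. *)
Definition mul_operator (mu : {measure set X -> \bar R})
    (W : forall x, {linear E x -> E x}) : operator (L2 mu E) :=
  [set u | {ae mu, forall x, L2rep u.2 x = W x (L2rep u.1 x)}].

(* The order of R[i] compares real parts of numbers with equal imaginary parts,
   so that the inequality includes that e^{-tS}|f| is real a.e. *)
Definition kato_dominates (mu : {measure set X -> \bar R})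
    (T : operator (L2 mu E)) (S : operator (L2 mu (line_bundle X R))) : Prop :=
  exists U V,
    [/\ exp_semigroup (L2dot mu E) T U,
        exp_semigroup (L2dot mu (line_bundle X R)) S V &
        forall t f, 0 <= t ->
          {ae mu, forall x, (fnorm (L2rep (U t f) x))%:C%C <=
                            (L2rep (V t (L2abs f)) x : R[i])}].

End endomorphisms.

Arguments mul_operator {dX X R r E} mu W _.

(* Main.v *)
(* Kato domination turns the bound p(t,x,x) <= F1(x) F2(t) into
   |e^{-tH} f|^2(x) <= F1(x) F2(2t) |f|^2 almost everywhere.  Hence 1_A e^{-tH} is
   Hilbert-Schmidt when F1 is integrable over A, and 1_A (H+a)^{-1} is compact, as
   the norm limit of 1_A e^{-tH} (H+a)^{-1} for t -> 0.  Writing the resolvent as a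
   Laplace transform, the same bound controls the norm of w (H+a)^{-1}, for a >= 2,
   by the integral of |w|^{2q} F1, with a constant that is small with this integral.
   For A = {|W1| <= n} /\ ({|W1| >= e} \/ {|W2| >= e}) the function F1 is integrable
   over A, W is bounded on A, and |W| <= C |W1| 1_{|W1| > n} + 2 e off A.  Therefore
   W 1_{A^c} (H+a)^{-1} has small norm uniformly in a >= 2: so W (H+a)^{-1} is compact,
   and of norm < 1 for a large.  Self-adjointness and semiboundedness of H + W follow
   as in the Kato-Rellich theorem.  The essential spectrum is stable because z is
   outside it iff the pencil 1 - (z+a) (H+a)^{-1} is Fredholm, which is insensitive
   to compact perturbations of (H+a)^{-1}. *)
Require Import Defs.
From HB Require Import structures.
From mathcomp Require Import all_boot all_order all_algebra.
From mathcomp Require Import all_classical all_reals all_analysis.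
From mathcomp Require Import measurable_realfun ess_sup_inf complex ring lra.

Set Implicit Arguments.
Unset Strict Implicit.
Unset Printing Implicit Defensive.
Import Order.TTheory GRing.Theory Num.Theory numFieldNormedType.Exports.

Local Open Scope classical_set_scope.
Local Open Scope ring_scope.

(** * Hilbert spaces and compactness *)

(** Neither a spectral theorem nor a functional calculus is used, and three obstacles shape the
    work. Domination bounds $e^{-tH}f$ almost everywhere but gives no integral kernel on E, and the
    null set depends on f; the Hilbert-Schmidt bound therefore goes through the coordinates in a
    measurable frame and a countable set of coefficients. The norm of $w(H+a)^{-1}$ is found by
    testing $u=(H+a)^{-1}f$ against $w^2u$: the diagonal bound at time s/2 involves $F_2(s)$, so the
    Laplace integral is written with s/2, its weight becomes $e^{-as/2}$, and a >= 2 brings it below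
    $e^{-s}$; the square root of $F_2^{1/q}$ is the origin of the exponent 1/(2q). Finally, discrete
    points are given only as isolated points with a finite-dimensional eigenspace, so that passing
    from there to the Fredholm property needs a gap estimate; it is obtained from Cauchy-Schwarz for
    positive forms, without spectral projections. *)

Lemma sqr_le_mul (R : realFieldType) (a b c : R) : 0 <= c ->
  (forall t, 0 <= a + 2 * t * b + t ^+ 2 * c) -> b ^+ 2 <= a * c.
Proof.
move=> c0 H; have [c1|c1] := eqVneq c 0.
  subst c; have [->|b0] := eqVneq b 0; first by rewrite expr0n mulr0.
  (* When c = 0 the polynomial is affine, and at this t it takes the value -1. *)
  have := H (- (a + 1) / (2 * b)); rewrite leNgt => /negP; case.
  have -> : a + 2 * (- (a + 1) / (2 * b)) * b + (- (a + 1) / (2 * b)) ^+ 2 * 0 = -1.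
    by field.
  by rewrite oppr_lt0.
have cp : 0 < c by rewrite lt_def c1.
have := H (- b / c).
have -> : a + 2 * (- b / c) * b + (- b / c) ^+ 2 * c = (a * c - b ^+ 2) / c by field.
by rewrite pmulr_lge0 ?invr_gt0// subr_ge0.
Qed.

(** Dividing by n and letting n grow removes the additive error k. This absorbs rounding errors in
    Bessel's inequality and the constant in a comparison of exponential growth. *)
Lemma ler_of_natM (R : archiRealFieldType) (a b k : R) :
  (forall n : nat, n%:R * a <= n%:R * b + k) -> a <= b.
Proof.
move=> H; rewrite leNgt; apply/negP => ab.
have d0 : 0 < a - b by rewrite subr_gt0.
have k0 : 0 <= `|k / (a - b)| by [].
have := archi_boundP k0; set n := Num.bound _ => hn.
have {hn} := le_lt_trans (ler_norm _) hn.
by rewrite ltr_pdivrMr// ltNge mulrBr lerBlDl H.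
Qed.

Lemma inv_natS_small (R : archiRealFieldType) (eps : R) : 0 < eps ->
  exists N : nat, forall n, (N <= n)%N -> n.+1%:R^-1 < eps.
Proof.
move=> e0; exists (Num.bound (eps^-1)) => n hn.
rewrite invf_plt ?posrE//; apply: lt_le_trans (archi_boundP _) _.
  by rewrite invr_ge0 ltW.
by rewrite ler_nat; apply: leq_trans hn _.
Qed.

Section complex_modulus.
Context (R : realType).
Implicit Types a b : R[i].
Local Notation normc := ComplexField.Normc.normc.

Lemma normc_ge0 a : 0 <= normc a.
Proof. by case: a => x y; exact: sqrtr_ge0. Qed.

Lemma normc_sqr a : normc a ^+ 2 = complex.Re a ^+ 2 + complex.Im a ^+ 2.
Proof. by case: a => x y; rewrite sqr_sqrtr// addr_ge0 ?sqr_ge0. Qed.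

Lemma normcR (x : R) : normc x%:C%C = `|x|.
Proof. by rewrite /= expr0n addr0 sqrtr_sqr. Qed.

Lemma Re_le_normc a : `|complex.Re a| <= normc a.
Proof. by case: a => x y /=; rewrite -sqrtr_sqr ler_wsqrtr// lerDl sqr_ge0. Qed.

Lemma Im_le_normc a : `|complex.Im a| <= normc a.
Proof. by case: a => x y /=; rewrite -sqrtr_sqr ler_wsqrtr// lerDr sqr_ge0. Qed.

Lemma conjcE a : Num.conj a = Complex (complex.Re a) (- complex.Im a).
Proof. by case: a. Qed.

Lemma conjcR (x : R) : Num.conj (x%:C%C : R[i]) = x%:C%C.
Proof. by rewrite conjcE /= oppr0. Qed.

Lemma normc_conj a : normc (Num.conj a) = normc a.
Proof. by case: a => x y /=; rewrite sqrrN. Qed.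

Lemma mulc_conj a : a * Num.conj a = (normc a ^+ 2)%:C%C.
Proof.
rewrite normc_sqr; case: a => b c; apply/eqP; rewrite eq_complex /= !expr2.
by rewrite mulrN opprK eqxx /= mulrN addrC mulrC subrr.
Qed.

Lemma normc_eq0 a : (normc a == 0) = (a == 0).
Proof.
apply/eqP/eqP => [|->]; last exact: ComplexField.Normc.normc0.
exact: ComplexField.Normc.eq0_normc.
Qed.

Lemma normc_le_ReIm a : normc a <= `|complex.Re a| + `|complex.Im a|.
Proof.
rewrite -ler_sqr ?nnegrE ?normc_ge0 ?addr_ge0// normc_sqr sqrrD !real_normK ?num_real//.
by rewrite -addrA lerD2l lerDr mulrn_wge0 // mulr_ge0.
Qed.

End complex_modulus.
Notation normc := ComplexField.Normc.normc.

Section inner_product.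
Context (R : realType) (V : lmodType R[i]) (ip : {dot V for Num.conj}).
Implicit Types (u v w f g h e : V) (a z : R[i]) (s : seq V).
Local Notation nrm := (hnorm ip).

Definition rip u v : R := complex.Re (ip u v).

Lemma ip_conj u v : ip u v = Num.conj (ip v u).
Proof. by rewrite hermC expr0 mul1r. Qed.

Lemma ripC u v : rip u v = rip v u.
Proof. by rewrite /rip ip_conj conjcE. Qed.

Lemma ipDl u v w : ip (u + v) w = ip u w + ip v w.
Proof. exact: linearDl. Qed.
Lemma ipDr u v w : ip u (v + w) = ip u v + ip u w.
Proof. exact: linearDr. Qed.
Lemma ipNl u v : ip (- u) v = - ip u v.
Proof. exact: linearNl. Qed.
Lemma ipNr u v : ip u (- v) = - ip u v.
Proof. exact: linearNr. Qed.
Lemma ipBl u v w : ip (u - v) w = ip u w - ip v w.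
Proof. by rewrite ipDl ipNl. Qed.
Lemma ipBr u v w : ip u (v - w) = ip u v - ip u w.
Proof. by rewrite ipDr ipNr. Qed.
Lemma ipZl a u v : ip (a *: u) v = a * ip u v.
Proof. exact: linearZl_LR. Qed.
Lemma ipZr a u v : ip u (a *: v) = Num.conj a * ip u v.
Proof. exact: linearZr_LR. Qed.
Lemma ip0l u : ip 0 u = 0. Proof. exact: linear0l. Qed.
Lemma ip0r u : ip u 0 = 0. Proof. exact: linear0r. Qed.

Lemma ip0C u v : ip u v = 0 -> ip v u = 0.
Proof. by move=> h; rewrite ip_conj h rmorph0. Qed.

Lemma ripDl u v w : rip (u + v) w = rip u w + rip v w.
Proof. by rewrite /rip ipDl raddfD. Qed.
Lemma ripDr u v w : rip u (v + w) = rip u v + rip u w.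
Proof. by rewrite /rip ipDr raddfD. Qed.
Lemma ripNl u v : rip (- u) v = - rip u v.
Proof. by rewrite /rip ipNl raddfN. Qed.
Lemma ripNr u v : rip u (- v) = - rip u v.
Proof. by rewrite /rip ipNr raddfN. Qed.
Lemma ripZl (x : R) u v : rip (x%:C%C *: u) v = x * rip u v.
Proof. by rewrite /rip ipZl complex_ReM /= mul0r subr0. Qed.
Lemma ripZr (x : R) u v : rip u (x%:C%C *: v) = x * rip u v.
Proof. by rewrite ripC ripZl ripC. Qed.
Lemma rip0l u : rip 0 u = 0. Proof. by rewrite /rip ip0l. Qed.
Lemma rip0r u : rip u 0 = 0. Proof. by rewrite /rip ip0r. Qed.
Definition ripE := (ripDl, ripDr, ripNl, ripNr, ripZl, ripZr).

Lemma ip_self u : ip u u = (rip u u)%:C%C.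
Proof.
have := dnorm_ge0 ip u; rewrite lecE => /andP[/eqP h _].
by apply/eqP; rewrite eq_complex /= eqxx /=; exact/eqP.
Qed.

Lemma rip_ge0 u : 0 <= rip u u.
Proof. by have := dnorm_ge0 ip u; rewrite lecE => /andP[]. Qed.

Lemma rip_eq0 u : rip u u = 0 -> u = 0.
Proof.
by move=> h; apply/eqP; rewrite -(dnorm_eq0 ip) ip_self h eqxx.
Qed.

Lemma nrm_sqr u : nrm u ^+ 2 = rip u u.
Proof. by rewrite sqr_sqrtr// rip_ge0. Qed.

Lemma nrm_ge0 u : 0 <= nrm u. Proof. exact: sqrtr_ge0. Qed.

Lemma nrm0 : nrm 0 = 0. Proof. by rewrite /hnorm ip0l sqrtr0. Qed.

Lemma nrm_eq0 u : (nrm u == 0) = (u == 0).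
Proof.
apply/eqP/eqP => [h|->]; last exact: nrm0.
by apply: rip_eq0; rewrite -nrm_sqr h expr0n.
Qed.

Lemma nrm_gt0 u : (0 < nrm u) = (u != 0).
Proof. by rewrite lt_def nrm_ge0 andbT nrm_eq0. Qed.

Lemma nrmN u : nrm (- u) = nrm u.
Proof. by rewrite /hnorm ipNl ipNr opprK. Qed.

Lemma nrmZ a u : nrm (a *: u) = normc a * nrm u.
Proof.
apply/eqP; rewrite -(@eqrXn2 _ 2)// ?mulr_ge0 ?nrm_ge0 ?normc_ge0// exprMn !nrm_sqr.
by rewrite /rip ipZl ipZr mulrA mulc_conj complex_ReM /= mul0r subr0.
Qed.

Lemma nrmZR (x : R) u : nrm (x%:C%C *: u) = `|x| * nrm u.
Proof. by rewrite nrmZ normcR. Qed.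

Lemma nrm_distC u v : nrm (u - v) = nrm (v - u).
Proof. by rewrite -nrmN opprB. Qed.

Lemma nrmD_sqr u v : nrm (u + v) ^+ 2 = nrm u ^+ 2 + nrm v ^+ 2 + 2 * rip u v.
Proof. by rewrite !nrm_sqr !ripE (ripC v u); ring. Qed.

Lemma rip_CS u v : `|rip u v| <= nrm u * nrm v.
Proof.
rewrite -ler_sqr ?nnegrE ?mulr_ge0 ?nrm_ge0// real_normK ?num_real// exprMn !nrm_sqr.
apply: sqr_le_mul; first exact: rip_ge0.
move=> t; have := rip_ge0 (u + t%:C%C *: v); rewrite !ripE (ripC v u).
by congr (_ <= _); ring.
Qed.

Lemma rip_le u v : rip u v <= nrm u * nrm v.
Proof. exact: le_trans (ler_norm _) (rip_CS u v). Qed.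

Lemma ip_CS u v : normc (ip u v) <= nrm u * nrm v.
Proof.
have [h|h] := eqVneq (ip u v) 0.
  by rewrite h ComplexField.Normc.normc0 mulr_ge0 ?nrm_ge0.
have n0 : 0 < normc (ip u v) by rewrite lt_def normc_ge0 andbT normc_eq0.
have := rip_le (Num.conj (ip u v) *: u) v.
rewrite {1}/rip ipZl mulrC mulc_conj /= nrmZ normc_conj expr2 -mulrA.
by rewrite ler_pM2l.
Qed.

Lemma nrmD u v : nrm (u + v) <= nrm u + nrm v.
Proof.
rewrite -ler_sqr ?nnegrE ?addr_ge0 ?nrm_ge0// nrmD_sqr.
have := rip_le u v; nra.
Qed.

Lemma nrmB u v : nrm (u - v) <= nrm u + nrm v.
Proof. by rewrite -(nrmN v) nrmD. Qed.

Lemma nrm_dist_tri u v w : nrm (u - w) <= nrm (u - v) + nrm (v - w).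
Proof. by apply: le_trans (nrmD _ _); rewrite addrA subrK. Qed.

Lemma nrmB_ge u v : nrm u - nrm v <= nrm (u - v).
Proof. by rewrite lerBlDr -{1}(subrK v u) nrmD. Qed.

Lemma nrm_sum (I : Type) (r : seq I) (F : I -> V) :
  nrm (\sum_(i <- r) F i) <= \sum_(i <- r) nrm (F i).
Proof.
elim: r => [|i r IH]; first by rewrite !big_nil nrm0.
by rewrite !big_cons; apply: le_trans (nrmD _ _) _; rewrite lerD2l.
Qed.

Lemma ip_ext u v : (forall w, ip u w = ip v w) -> u = v.
Proof.
move=> h; apply/eqP; rewrite -subr_eq0; apply/eqP/rip_eq0.
by rewrite /rip ipBl h subrr.
Qed.

Definition vcvg (x : nat -> V) l : Prop :=
  forall eps : R, 0 < eps -> exists N, forall n, (N <= n)%N -> nrm (x n - l) < eps.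

Definition vcauchy (x : nat -> V) : Prop :=
  forall eps : R, 0 < eps ->
    exists N, forall m n, (N <= m)%N -> (N <= n)%N -> nrm (x m - x n) < eps.

Definition complete_ip : Prop := forall x, vcauchy x -> exists l, vcvg x l.

Definition bounded_by (c : R) (K : V -> V) : Prop :=
  forall f, nrm (K f) <= c * nrm f.

Lemma vcvg_cauchy x l : vcvg x l -> vcauchy x.
Proof.
move=> h eps e0; have [|N hN] := h (eps / 2); first by rewrite divr_gt0.
exists N => m n hm hn; apply: le_lt_trans (nrm_dist_tri _ l _) _.
by rewrite (splitr eps) ltrD ?hN// nrm_distC hN.
Qed.

Lemma vcvg_uniq x l l' : vcvg x l -> vcvg x l' -> l = l'.
Proof.
move=> h h'; apply/eqP; rewrite -subr_eq0 -nrm_eq0 eq_le nrm_ge0 andbT.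
apply/ler_addgt0Pr => eps e0; rewrite add0r.
have [|N hN] := h (eps / 2); first by rewrite divr_gt0.
have [|N' hN'] := h' (eps / 2); first by rewrite divr_gt0.
apply: le_trans (nrm_dist_tri _ (x (maxn N N')) _) _.
by rewrite (splitr eps) lerD// ltW ?hN' ?leq_maxr// nrm_distC hN// leq_maxl.
Qed.

Lemma vcvg_ext x y l : (forall n, x n = y n) -> vcvg x l -> vcvg y l.
Proof. by move=> xy; rewrite (funext xy). Qed.

Lemma vcvgD x y l m : vcvg x l -> vcvg y m -> vcvg (fun n => x n + y n) (l + m).
Proof.
move=> h h' eps e0; have [|N hN] := h (eps / 2); first by rewrite divr_gt0.
have [|N' hN'] := h' (eps / 2); first by rewrite divr_gt0.
exists (maxn N N') => n; rewrite geq_max => /andP[n1 n2].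
rewrite opprD addrACA; apply: le_lt_trans (nrmD _ _) _.
by rewrite (splitr eps) ltrD ?hN ?hN'.
Qed.

Lemma vcvg_map (K : V -> V) c x l : {morph K : u v / u - v} -> bounded_by c K ->
  vcvg x l -> vcvg (K \o x) (K l).
Proof.
move=> KB bK h eps e0; have c1 : 0 < `|c| + 1 by rewrite ltr_wpDl.
have [|N hN] := h (eps / (`|c| + 1)); first by rewrite divr_gt0.
exists N => n /hN; rewrite ltr_pdivlMr//= -KB => H.
apply: le_lt_trans (bK _) _; apply: le_lt_trans H.
rewrite mulrC ler_wpM2l ?nrm_ge0//; apply: le_trans (ler_norm _) _.
by rewrite lerDl.
Qed.

Lemma vcvgN x l : vcvg x l -> vcvg (fun n => - x n) (- l).
Proof.
apply: (@vcvg_map (-%R) 1); first by move=> u v; rewrite opprD.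
by move=> f; rewrite nrmN mul1r.
Qed.

Lemma vcvgB x y l m : vcvg x l -> vcvg y m -> vcvg (fun n => x n - y n) (l - m).
Proof. by move=> h /vcvgN; exact: vcvgD. Qed.

Lemma vcvg_ip x l w : vcvg x l -> forall eps : R, 0 < eps ->
  exists N, forall n, (N <= n)%N -> normc (ip (x n) w - ip l w) < eps.
Proof.
move=> h eps e0; have w1 : 0 < nrm w + 1 by rewrite ltr_wpDl ?nrm_ge0.
have [|N hN] := h (eps / (nrm w + 1)); first by rewrite divr_gt0.
exists N => n /hN; rewrite ltr_pdivlMr// -ipBl => H.
apply: le_lt_trans (ip_CS _ _) _; apply: le_lt_trans H.
by rewrite ler_wpM2l ?nrm_ge0// lerDl.
Qed.

Lemma vcvg_ip_eq x l w z : vcvg x l -> (forall n, ip (x n) w = z) -> ip l w = z.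
Proof.
move=> h hz; apply/eqP; rewrite -subr_eq0 -normc_eq0 eq_le normc_ge0 andbT.
apply/ler_addgt0Pr => eps /(vcvg_ip w h)[N /(_ N (leqnn N))].
by rewrite hz add0r -(normcN (z - _)) opprB => /ltW.
Qed.

End inner_product.

(** * Orthogonal projections and finite orthonormal systems *)

Section projections.
Context (R : realType) (V : lmodType R[i]) (ip : {dot V for Num.conj}).
Implicit Types (u v w f g h e : V) (a z : R[i]) (s : seq V).
Local Notation nrm := (hnorm ip).

Definition in_closure (D : set V) g : Prop :=
  forall eps : R, 0 < eps -> exists2 m, D m & nrm (g - m) < eps.

Definition is_subspace (D : set V) : Prop :=
  D 0 /\ forall a u v, D u -> D v -> D (a *: u + v).

(** [D] is stable under multiplication by i, so the real parts over all of [D] determine the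
    imaginary parts. *)
Lemma ip_eq0_rip (D : set V) u : is_subspace D -> (forall m, D m -> rip ip u m = 0) ->
  forall m, D m -> ip u m = 0.
Proof.
move=> [D0 DP] h m Dm; have := h _ (DP 'i%C _ _ Dm D0).
have := h m Dm; rewrite addr0 /rip ipZr conjcE complex_ReM /=.
case: (ip u m) => x y /= -> h2; apply/eqP; rewrite eq_complex eqxx /=; apply/eqP.
by move: h2; rewrite mul0r mulN1r opprK add0r.
Qed.

(** [D] need not be closed, so the nearest point is found only in its closure, as the limit of a
    minimizing sequence. *)
Lemma projection_thm (D : set V) f : complete_ip ip -> is_subspace D ->
  exists2 g, in_closure D g & forall m, D m -> ip (f - g) m = 0.
Proof.
move=> cV [D0 DP]; pose S : set R := [set r | exists2 m, D m & r = nrm (f - m) ^+ 2].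
have S0 : S !=set0 by exists (nrm (f - 0) ^+ 2), 0.
have Sb : has_lbound S by exists 0 => _ [m _ ->]; exact: sqr_ge0.
have hS : has_inf S by split.
set c := inf S.
have cle m : D m -> c <= nrm (f - m) ^+ 2 by move=> Dm; apply: ge_inf => //; exists m.
have /choice[m hm] (n : nat) : exists m, D m /\ nrm (f - m) ^+ 2 < c + n.+1%:R^-1.
  have [|_ [m Dm ->] h] := @inf_adherent _ S n.+1%:R^-1 _ hS; first by rewrite invr_gt0.
  by exists m.
have Dm n : D (m n) by case: (hm n).
have cau : vcauchy ip m.
  move=> eps e0; have [|N hN] := inv_natS_small (eps := eps ^+ 2 / 4).
    by rewrite divr_gt0// exprn_gt0.
  exists N => i j /hN hi /hN hj; rewrite -ltr_sqr ?nnegrE ?nrm_ge0 ?ltW//.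
  (* The midpoint of [m i] and [m j] lies in [D], so the parallelogram law bounds the squared
     distance of the two by 2/(i+1) + 2/(j+1). *)
  have Dij : D ((2^-1)%:C%C *: (m i + m j)).
    have Dij : D (1 *: m i + m j) by exact: (DP).
    by rewrite -[_ *: _]addr0 -[m i]scale1r; exact: (DP).
  have := cle _ Dij; have [_ hmi] := hm i; have [_ hmj] := hm j.
  have -> : m i - m j = (f - m j) - (f - m i).
    by rewrite opprB [RHS]addrC addrA subrK.
  have -> : f - (2^-1)%:C%C *: (m i + m j) = (2^-1)%:C%C *: ((f - m j) + (f - m i)).
    have c2 : (2^-1)%:C%C *: f + (2^-1)%:C%C *: f = f.
      rewrite -scalerDl -[RHS]scale1r; congr (_ *: _).
      by apply/eqP; rewrite eq_complex /= addr0 eqxx andbT; apply/eqP; lra.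
    by rewrite -[in LHS]c2 !scalerDr !scalerN opprD addrACA addrC.
  move: hmi hmj; rewrite !nrm_sqr !ripE.
  rewrite (ripC _ (m i) f) (ripC _ (m j) f) (ripC _ (m j) (m i)).
  move: hi hj; move: (i.+1%:R^-1) (j.+1%:R^-1) => A B; lra.
have [g hg] := cV _ cau; exists g.
  by move=> eps /hg[N /(_ N (leqnn N)) h]; exists (m N) => //; rewrite nrm_distC.
apply: ip_eq0_rip => // w Dw.
(* [m n] is minimal up to 1/(n+1) only; varying it in the direction w gives a quadratic in t whose
   discriminant retains this error. *)
have key n : rip ip (f - m n) w ^+ 2 <= n.+1%:R^-1 * nrm w ^+ 2.
  apply: sqr_le_mul; first exact: sqr_ge0.
  move=> t; have Dt : D ((- t)%:C%C *: w + m n) by exact: DP.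
  have := cle _ Dt; have [_] := hm n.
  have -> : f - ((- t)%:C%C *: w + m n) = (f - m n) + t%:C%C *: w.
    by rewrite raddfN scaleNr opprD opprK addrCA addrC.
  rewrite (nrmD_sqr _ (f - m n)) => h1.
  by rewrite nrmZR exprMn real_normK ?num_real// ripZr; move: h1; move: (n.+1%:R^-1) => A; lra.
have key2 n : rip ip (f - g) w ^+ 2 <= 2 * (n.+1%:R^-1 + nrm (m n - g) ^+ 2) * nrm w ^+ 2.
  have -> : f - g = (f - m n) + (m n - g) by rewrite addrA subrK.
  rewrite ripDl; have := key n; have := rip_CS ip (m n - g) w.
  rewrite -ler_sqr ?nnegrE ?mulr_ge0 ?nrm_ge0// real_normK ?num_real// exprMn.
  have := sqr_ge0 (rip ip (f - m n) w - rip ip (m n - g) w).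
  by move: (n.+1%:R^-1) (rip _ _ _) (rip _ _ _) => A x y; nra.
apply/eqP; rewrite -sqrf_eq0 eq_le sqr_ge0 andbT; apply/ler_addgt0Pr => eps e0.
pose dl := eps / (4 * (nrm w ^+ 2 + 1)).
have w0 : 0 < nrm w ^+ 2 + 1 by rewrite ltr_wpDl ?sqr_ge0.
have dl0 : 0 < dl by rewrite divr_gt0 ?mulr_gt0.
have [N1 h1] := inv_natS_small dl0.
have [|N2 h2] := hg (Num.min 1 dl); first by rewrite lt_min ltr01.
have /h1 k1 := leq_maxl N1 N2; have := leq_maxr N1 N2; move=> /h2.
rewrite lt_min => /andP[k2 k3]; apply: le_trans (key2 (maxn N1 N2)) _; rewrite add0r.
have A0 : 0 < (maxn N1 N2).+1%:R^-1 :> R by rewrite invr_gt0.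
move: A0 k1; move: (_.+1%:R^-1) => A A0 k1; set B := nrm (_ - g) in k2 k3 *.
have B0 : 0 <= B := nrm_ge0 _ _.
have k4 : B ^+ 2 <= dl by rewrite expr2; nra.
have -> : eps = 2 * (dl + dl) * (nrm w ^+ 2 + 1).
  by rewrite /dl; field; rewrite lt0r_neq0.
have W0 := sqr_ge0 (nrm w); have B2 := sqr_ge0 B.
by apply: ler_pM; lra.
Qed.

Lemma dense_range_orth (D : set V) : complete_ip ip -> is_subspace D ->
  (forall u, (forall m, D m -> ip u m = 0) -> u = 0) -> forall f, in_closure D f.
Proof.
move=> cV sD h f; have [g gD gP] := projection_thm f cV sD.
by have /eqP := h _ gP; rewrite subr_eq0 => /eqP ->.
Qed.

Definition fproj s v := \sum_(e <- s) ip v e *: e.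

Fixpoint pons s : Prop :=
  if s is e :: s' then
    [/\ rip ip e e = 1 \/ e = 0, forall e', e' \in s' -> ip e e' = 0 & pons s']
  else True.

(** If [v] depends on [s], the residual is 0 and the new entry is the zero vector, without a case
    distinction. *)
Definition cons_gs v s :=
  let r := v - fproj s v in (nrm r)^-1%:C%C *: r :: s.

Definition gram_schmidt s := foldr cons_gs [::] s.

Lemma fproj_linear s : linear (fproj s).
Proof.
move=> a u v; rewrite /fproj scaler_sumr -big_split /=; apply: eq_bigr => e _.
by rewrite ipDl ipZl scalerDl scalerA.
Qed.

Lemma ip_fproj0 s v w : (forall e, e \in s -> ip e w = 0) -> ip (fproj s v) w = 0.
Proof.
elim: s => [|e s IH] h; first by rewrite /fproj big_nil ip0l.
rewrite /fproj big_cons ipDl ipZl h ?mem_head// mulr0 add0r IH// => e' e's.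
by rewrite h// in_cons e's orbT.
Qed.

Lemma ip_fproj s v e : pons s -> e \in s -> ip (fproj s v) e = ip v e.
Proof.
elim: s => //= e0 s IH [n0 o0 ps]; rewrite /fproj big_cons ipDl ipZl in_cons.
case/orP=> [/eqP->|es].
  rewrite [X in _ + X]ip_fproj0 ?addr0; last by move=> e' /o0 /ip0C.
  case: n0 => [n0|->]; last by rewrite ip0r mul0r.
  by rewrite (ip_self _ e0) n0 mulr1.
by rewrite (o0 _ es) mulr0 add0r IH.
Qed.

Lemma ip_sub_fproj s v e : pons s -> e \in s -> ip (v - fproj s v) e = 0.
Proof. by move=> ps es; rewrite ipBl ip_fproj// subrr. Qed.

Lemma fproj_orth s v w : pons s -> ip (v - fproj s v) (fproj s w) = 0.
Proof.
move=> ps; apply: ip0C; apply: ip_fproj0 => e es; apply: ip0C.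
exact: ip_sub_fproj.
Qed.

Lemma rip_fproj s v : pons s ->
  nrm (fproj s v) ^+ 2 = \sum_(e <- s) normc (ip v e) ^+ 2.
Proof.
move=> ps; rewrite nrm_sqr.
have -> : rip ip (fproj s v) (fproj s v) = rip ip v (fproj s v).
  apply/eqP; rewrite eq_sym -subr_eq0 -ripNl -ripDl; apply/eqP.
  by rewrite /rip fproj_orth.
rewrite /fproj; elim: {ps} s => [|e s IH]; first by rewrite !big_nil rip0r.
rewrite !big_cons ripDr IH; congr (_ + _).
by rewrite /rip ipZr mulrC mulc_conj.
Qed.

Lemma bessel s v : pons s -> nrm (fproj s v) <= nrm v.
Proof.
move=> ps; rewrite -ler_sqr ?nnegrE ?nrm_ge0//.
rewrite -[in leRHS](subrK (fproj s v) v) nrmD_sqr /rip fproj_orth//= mulr0 addr0.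
by rewrite lerDr sqr_ge0.
Qed.

Lemma parseval s v : pons s -> fproj s v = v ->
  nrm v ^+ 2 = \sum_(e <- s) normc (ip v e) ^+ 2.
Proof. by move=> ps; rewrite -rip_fproj// => ->. Qed.

Lemma pons_le1 s e : pons s -> e \in s -> nrm e <= 1.
Proof.
elim: s => //= e0 s IH [n0 _ ps]; rewrite in_cons => /orP[/eqP->|]; last exact: IH.
by case: n0 => [n0|->]; rewrite ?nrm0// -(@ler_pXn2r _ 2)// ?nnegrE ?nrm_ge0// nrm_sqr n0 expr1n.
Qed.

Lemma pons_cons_gs v s : pons s -> pons (cons_gs v s).
Proof.
move=> ps /=; split=> //.
  have [->|h] := eqVneq (v - fproj s v) 0; first by right; rewrite scaler0.
  left; rewrite ripZl ripZr -nrm_sqr mulrA -expr2 -exprMn mulVf ?expr1n//.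
  by rewrite nrm_eq0.
by move=> e es; rewrite ipZl ip_sub_fproj// mulr0.
Qed.

Lemma fproj_cons_gs v s : pons s -> fproj (cons_gs v s) v = v.
Proof.
move=> ps; rewrite /fproj /= big_cons -/(fproj s v).
set r := v - fproj s v.
have vr x : ip v (x *: r) = ip r (x *: r).
  by rewrite -[in LHS](subrK (fproj s v) v) ipDl !ipZr (ip0C (fproj_orth v v ps)) mulr0 addr0.
rewrite vr ipZr conjcR scalerA ip_self -nrm_sqr.
have [r0|h] := eqVneq r 0.
  by rewrite r0 scaler0 add0r; apply/esym/eqP; rewrite -subr_eq0 -/r r0.
have -> : (nrm r)^-1%:C%C * (nrm r ^+ 2)%:C%C * (nrm r)^-1%:C%C = 1 :> R[i].
  by rewrite -!rmorphM /= expr2 mulKf ?nrm_eq0// divff// nrm_eq0.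
by rewrite scale1r /r subrK.
Qed.

Lemma fproj_cons_gs_id u v s : pons s -> fproj s u = u -> fproj (cons_gs v s) u = u.
Proof.
move=> ps su; rewrite /fproj /= big_cons -/(fproj s u) su.
by rewrite ipZr -su ip0C ?mulr0 ?scale0r ?add0r// fproj_orth.
Qed.

Lemma pons_gram_schmidt s : pons (gram_schmidt s).
Proof. by elim: s => //= v s IH; exact: pons_cons_gs. Qed.

Lemma fproj_gram_schmidt s v : v \in s -> fproj (gram_schmidt s) v = v.
Proof.
elim: s => //= u s IH; rewrite in_cons => /orP[/eqP->|vs].
  exact/fproj_cons_gs/pons_gram_schmidt.
by apply: fproj_cons_gs_id (IH vs); exact: pons_gram_schmidt.
Qed.

Lemma size_gram_schmidt s : size (gram_schmidt s) = size s.
Proof. by elim: s => //= v s ->. Qed.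

Lemma fproj_orth0 s v : (forall e, e \in s -> ip v e = 0) -> fproj s v = 0.
Proof.
by move=> h; rewrite /fproj big_seq big1// => e /h ->; rewrite scale0r.
Qed.

Lemma subspace_fproj (D : set V) s v : is_subspace D -> (forall e, e \in s -> D e) -> D (fproj s v).
Proof.
move=> [D0 DP]; elim: s => [|e s IH] h; first by rewrite /fproj big_nil.
rewrite /fproj big_cons; apply: (DP); first by apply: h; rewrite mem_head.
by apply: IH => e' h'; apply: h; rewrite in_cons h' orbT.
Qed.

End projections.

(** Compactness of a segment gives a cluster point p of the image ultrafilter. The ultrafilter must
    contain the preimage of a small ball around p, since the complement would stay away from p. *)
Lemma ultra_bounded_seq (R : realType) (G : set_system nat) (x : nat -> R) (C eps : R) :
  UltraFilter G -> (forall n, `|x n| <= C) -> 0 < eps ->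
  exists2 A, G A & forall m n, A m -> A n -> `|x m - x n| < eps.
Proof.
move=> UG xC e0.
have FP : ProperFilter (x @ G) by exact: fmap_proper_filter.
have [|p [_ px]] := @segment_compact R (- C) C (x @ G) _.
  by rewrite /fmap /=; apply: filterE => n /=; rewrite in_itv /= -ler_norml.
have [GA|GA] := in_ultra_setVsetC [set n | `|x n - p| < eps / 2] UG.
  exists [set n | `|x n - p| < eps / 2] => // m n /= hm hn.
  have -> : x m - x n = (x m - p) - (x n - p) by rewrite opprB addrA subrK.
  by apply: le_lt_trans (ler_normB _ _) _; rewrite (splitr eps) ltrD.
pose S := ~` [set n | `|x n - p| < eps / 2].
have : (x @ G) (x @` S).
  suff : G [set n | (x @` S) (x n)] by [].
  by apply: (filterS _ GA) => n Sn; exact: imageP.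
have e20 : 0 < eps / 2 by rewrite divr_gt0.
move=> /px /(_ (nbhsx_ballx p _ e20)) [_ [[n Sn <-]]] pn.
by exfalso; apply: Sn; rewrite /= distrC.
Qed.

(** * Compact operators *)

Section compactness.
Context (R : realType) (V : lmodType R[i]) (ip : {dot V for Num.conj}).
Implicit Types (u v w f g h e : V) (a z : R[i]) (s : seq V) (K L B : V -> V).
Local Notation nrm := (hnorm ip).

(* For bounded linear K this is compactness: K is small on the orthogonal
   complement of a finite set. *)
Definition cpt K : Prop := forall eps : R, 0 < eps ->
  exists s, forall f, (forall e, e \in s -> ip f e = 0) -> nrm (K f) <= eps * nrm f.

Lemma linB K : linear K -> {morph K : u v / u - v}.
Proof. exact: zmod_morphism_linear. Qed.
Lemma lin0 K : linear K -> K 0 = 0.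
Proof. by move=> hK; have := linB hK 0 0; rewrite !subrr. Qed.
Lemma linD K u v : linear K -> K (u + v) = K u + K v.
Proof. by move=> hK; have := hK 1 u v; rewrite !scale1r. Qed.
Lemma linZ K a u : linear K -> K (a *: u) = a *: K u.
Proof. by move=> hK; have := hK a u 0; rewrite (lin0 hK) !addr0. Qed.

Lemma lin_sum K (I : Type) (t : seq I) (F : I -> V) : linear K ->
  K (\sum_(i <- t) F i) = \sum_(i <- t) K (F i).
Proof.
move=> hK; elim: t => [|i t IH]; first by rewrite !big_nil lin0.
by rewrite !big_cons linD// IH.
Qed.

Lemma linear_comp K L : linear K -> linear L -> linear (K \o L).
Proof. by move=> hK hL a u v /=; rewrite hL hK. Qed.

Lemma cpt_bounded_by_comp K L c : cpt K -> (forall f, nrm (L f) <= c * nrm (K f)) -> cpt L.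
Proof.
move=> cK h eps e0; have c1 : 0 < `|c| + 1 by rewrite ltr_wpDl.
have [|s hs] := cK (eps / (`|c| + 1)); first by rewrite divr_gt0.
exists s => f /hs H; apply: le_trans (h f) _.
apply: (@le_trans _ _ ((`|c| + 1) * nrm (K f))).
  rewrite ler_wpM2r ?nrm_ge0//; apply: le_trans (ler_norm _) _; by rewrite lerDl.
by move: H; rewrite mulrAC ler_pdivlMr// mulrC.
Qed.

Lemma cpt_lim K : (forall eps : R, 0 < eps ->
  exists2 K', cpt K' & forall f, nrm (K f - K' f) <= eps * nrm f) -> cpt K.
Proof.
move=> h eps e0; have e2 : 0 < eps / 2 by rewrite divr_gt0.
have [K' cK' hK'] := h _ e2; have [s hs] := cK' _ e2; exists s => f /hs H.
rewrite -(subrK (K' f) (K f)); apply: le_trans (nrmD _ _ _) _.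
by rewrite (splitr eps) mulrDl lerD.
Qed.

(** If f is orthogonal to every [Bt e], then [B f] is orthogonal to every e; the finite set for the
    composite is thus the image under [Bt] of the one for [K]. *)
Lemma cpt_comp K B Bt c : cpt K -> bounded_by ip c B ->
  (forall f g, ip (B f) g = ip f (Bt g)) -> cpt (K \o B).
Proof.
move=> cK bB adj eps e0; have c1 : 0 < `|c| + 1 by rewrite ltr_wpDl.
have [|s hs] := cK (eps / (`|c| + 1)); first by rewrite divr_gt0.
exists [seq Bt e | e <- s] => f h /=.
apply: le_trans (hs (B f) _) _.
  by move=> e es; rewrite adj h// map_f.
rewrite mulrAC ler_pdivrMr// -mulrA ler_wpM2l ?(ltW e0)// mulrC.
apply: le_trans (bB f) _; rewrite ler_wpM2r ?nrm_ge0//.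
by apply: le_trans (ler_norm _) _; rewrite lerDl.
Qed.

Lemma cpt_fproj s : cpt (fproj ip s).
Proof.
by move=> eps e0; exists s => f /fproj_orth0 ->; rewrite nrm0 mulr_ge0 ?nrm_ge0 ?ltW.
Qed.

(** Take a system s whose sum is within eps^2 of the supremum. A unit vector orthogonal to s can be
    appended to it, so its image has squared norm below eps^2. *)
Lemma hilbert_schmidt_cpt K (S : R) : linear K ->
  (forall s, pons ip s -> \sum_(e <- s) nrm (K e) ^+ 2 <= S) -> cpt K.
Proof.
move=> lK hS eps e0.
pose T : set R := [set r | exists2 s, pons ip s & r = \sum_(e <- s) nrm (K e) ^+ 2].
have T0 : T !=set0 by exists (\sum_(e <- [::]) nrm (K e) ^+ 2), [::].
have Tb : has_ubound T by exists S => _ [s ps ->]; exact: hS.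
have hT : has_sup T by split.
have [|_ [s ps ->] hs] := @sup_adherent _ T (eps ^+ 2) _ hT; first by rewrite exprn_gt0.
exists s => f fs; have [->|f0] := eqVneq f 0; first by rewrite lin0// nrm0 mulr0.
pose e := (nrm f)^-1%:C%C *: f.
have pes : pons ip (e :: s).
  split=> //; last by move=> e' es; rewrite ipZl fs ?mulr0.
  by left; rewrite ripZl ripZr -nrm_sqr mulrA -expr2 -exprMn mulVf ?expr1n// nrm_eq0.
have : \sum_(e' <- e :: s) nrm (K e') ^+ 2 <= sup T.
  by apply: ub_le_sup => //; exists (e :: s).
rewrite big_cons => he; have {he} : nrm (K e) ^+ 2 < eps ^+ 2.
  by move: he hs; set A := nrm (K e) ^+ 2; set D := \sum_(_ <- _) _; lra.
rewrite ltr_sqr ?nnegrE ?nrm_ge0 ?(ltW e0)// linZ// nrmZR gtr0_norm ?invr_gt0 ?nrm_gt0//.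
by rewrite mulrC ltr_pdivrMr ?nrm_gt0// => /ltW.
Qed.

Lemma ip_ultra (G : set_system nat) (u : nat -> V) (C dl : R) s : UltraFilter G ->
  (forall n, nrm (u n) <= C) -> 0 < dl ->
  exists2 A, G A & forall m n, A m -> A n ->
    forall e, e \in s -> normc (ip (u m - u n) e) < dl.
Proof.
move=> UG uC d0; elim: s => [|e s [A GA hA]]; first by exists setT => //; exact: filterT.
have d2 : 0 < dl / 2 by rewrite divr_gt0.
have bd n : normc (ip (u n) e) <= C * nrm e.
  by apply: le_trans (ip_CS _ _ _) _; rewrite ler_wpM2r ?nrm_ge0.
have [|A1 GA1 h1] := @ultra_bounded_seq R G (fun n => complex.Re (ip (u n) e)) (C * nrm e) _ UG _ d2.
  by move=> n; apply: le_trans (Re_le_normc _) (bd n).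
have [|A2 GA2 h2] := @ultra_bounded_seq R G (fun n => complex.Im (ip (u n) e)) (C * nrm e) _ UG _ d2.
  by move=> n; apply: le_trans (Im_le_normc _) (bd n).
exists (A `&` (A1 `&` A2)); first by apply: filterI => //; exact: filterI.
move=> m n [Am [A1m A2m]] [An [A1n A2n]] e'; rewrite in_cons => /orP[/eqP->|]; last exact: hA.
apply: le_lt_trans (normc_le_ReIm _) _; rewrite ipBl !raddfB /= (splitr dl).
by rewrite ltrD ?h1 ?h2.
Qed.

(** A difference of two terms splits into its projection on a finite system, small because finitely
    many coordinates are Cauchy along the ultrafilter, and a remainder on which [K] is small. *)
Lemma cpt_ultra K c (G : set_system nat) (u : nat -> V) C : linear K -> bounded_by ip c K ->
  cpt K -> UltraFilter G -> (forall n, nrm (u n) <= C) -> forall eps : R, 0 < eps ->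
  exists2 A, G A & forall m n, A m -> A n -> nrm (K (u m) - K (u n)) < eps.
Proof.
move=> lK bK cK UG uC eps e0.
have C0 : 0 <= C := le_trans (nrm_ge0 _ _) (uC 0%N).
have C1 : 0 < 8 * (C + 1) by rewrite mulr_gt0// ltr_wpDl.
(* The remainder has norm at most 4 C, so this constant leaves eps / 2 for it; [dl] spreads the
   other half over the coordinates. *)
have [|s0 hs0] := cK (eps / (8 * (C + 1))); first by rewrite divr_gt0.
pose s := gram_schmidt ip s0.
have hs f : (forall e, e \in s -> ip f e = 0) -> nrm (K f) <= eps / (8 * (C + 1)) * nrm f.
  move=> h; apply: hs0 => e es0; rewrite -(fproj_gram_schmidt ip es0).
  by apply: ip0C; apply: ip_fproj0 => e' /h; exact: ip0C.
have ps : pons ip s := pons_gram_schmidt ip s0.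
have c1 : 0 < `|c| + 1 by rewrite ltr_wpDl.
have s1 : 0 < (size s)%:R + 1 :> R by rewrite ltr_wpDl.
pose dl := eps / (2 * (`|c| + 1) * ((size s)%:R + 1)).
have d0 : 0 < dl by rewrite divr_gt0// !mulr_gt0.
have [A GA hA] := ip_ultra s UG uC d0; exists A => // m n Am An.
rewrite -linB//; set f := u m - u n; have {Am An} hf := hA _ _ Am An.
rewrite -(subrK (fproj ip s f) f) linD// (splitr eps).
apply: le_lt_trans (nrmD _ _ _) _; apply: ler_ltD.
  apply: le_trans (hs _ _) _; first by move=> e es; exact: ip_sub_fproj.
  have nf : nrm (f - fproj ip s f) <= 4 * C.
    apply: le_trans (nrmB _ _ _) _; have := bessel f ps.
    have : nrm f <= C + C by apply: le_trans (nrmB _ _ _) _; rewrite lerD.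
    lra.
  apply: (@le_trans _ _ (eps / (8 * (C + 1)) * (4 * (C + 1)))).
    by rewrite ler_wpM2l ?divr_ge0 ?(ltW e0) ?(ltW C1)//; apply: le_trans nf _; rewrite ler_pM2l// lerDl.
  by have -> : eps / (8 * (C + 1)) * (4 * (C + 1)) = eps / 2 by field; rewrite lt0r_neq0// ltr_wpDl.
apply: le_lt_trans (bK _) _.
apply: (@le_lt_trans _ _ ((`|c| + 1) * nrm (fproj ip s f))).
  by rewrite ler_wpM2r ?nrm_ge0//; apply: le_trans (ler_norm _) _; rewrite lerDl.
have -> : eps / 2 = (`|c| + 1) * (((size s)%:R + 1) * dl).
  by rewrite /dl; field; rewrite !lt0r_neq0.
rewrite ltr_pM2l//; apply: (@le_lt_trans _ _ ((size s)%:R * dl)); last first.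
  by rewrite ltr_pM2r// ltrDl.
apply: le_trans (nrm_sum _ _ _) _.
have n1 e : e \in s -> nrm e <= 1 by exact: pons_le1.
elim: (s) hf n1 => [|e t IH] hf n1; first by rewrite big_nil mul0r.
rewrite big_cons /= -natr1 mulrDl mul1r addrC lerD//.
  apply: IH => e' he'; last by apply: n1; rewrite in_cons he' orbT.
  by apply: hf; rewrite in_cons he' orbT.
rewrite nrmZ -[dl]mulr1 ler_pM ?normc_ge0 ?nrm_ge0//; last by apply: n1; rewrite mem_head.
by apply: ltW; apply: hf; rewrite mem_head.
Qed.

(** One ultrafilter finer than the cofinite filter replaces a diagonal extraction: finite
    intersections of its members are again members and are unbounded, so increasing indices can be
    picked in the decreasing sets [B j]. *)
Lemma cpt_subseq K c (u : nat -> V) C : complete_ip ip -> linear K -> bounded_by ip c K ->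
  cpt K -> (forall n, nrm (u n) <= C) ->
  exists (k : nat -> nat) (g : V), {homo k : m n / (m < n)%N} /\
    vcvg ip (fun n => K (u (k n))) g.
Proof.
move=> cV lK bK cK uC.
have [G [UG subG]] := ultraFilterLemma (@eventually_filter).
have i0 (j : nat) : 0 < j.+1%:R^-1 :> R by rewrite invr_gt0.
have /choice[A hA] j : exists A, G A /\ forall m n, A m -> A n -> nrm (K (u m) - K (u n)) < j.+1%:R^-1.
  by have [A GA hA] := cpt_ultra lK bK cK UG uC (i0 j); exists A.
pose B (j : nat) : set nat := \bigcap_(i in [set i | (i <= j)%N]) A i.
have GB j : G (B j).
  rewrite /B; elim: j => [|j IH].
    have -> : [set i | (i <= 0)%N] = [set 0%N].
      by apply/seteqP; split => i /=; rewrite leqn0 => /eqP.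
    by rewrite bigcap_set1; have [] := hA 0%N.
  apply: (@filterS _ G _ ((\bigcap_(i in [set i | (i <= j)%N]) A i) `&` A j.+1)).
    move=> n [h1 h2] i /=; rewrite leq_eqVlt => /orP[/eqP->//|]; rewrite ltnS; exact: h1.
  by apply: filterI => //; have [] := hA j.+1.
have /choice[nx hnx] (p : nat * nat) : exists n, (p.2 < n)%N /\ B p.1 n.
  have GN : G [set n | (p.2 < n)%N] by apply: subG; exists p.2.+1.
  have GI : G ([set n | (p.2 < n)%N] `&` B p.1) by exact: filterI.
  by have [n [h1 h2]] := filter_ex GI; exists n.
pose k := fix k n := if n is n'.+1 then nx (n, k n') else nx (0%N, 0%N).
have kB n : B n (k n) by case: n => [|n]; [have [] := hnx (0%N, 0%N)|have [] := hnx (n.+1, k n)].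
have kS n : (k n < k n.+1)%N by rewrite /=; case: (hnx (n.+1, k n)).
have hk : {homo k : m n / (m < n)%N} by exact: (homo_ltn (r := fun i j => (i < j)%N) ltn_trans kS).
have cau : vcauchy ip (fun n => K (u (k n))).
  move=> eps e0; exists (Num.bound (eps^-1)) => m n hm hn.
  set N := Num.bound _ in hm hn.
  have [_ hAN] := hA N; apply: lt_le_trans (hAN _ _ _ _) _.
  - exact: (kB m N hm).
  - exact: (kB n N hn).
  rewrite invf_ple ?posrE//; apply: ltW; apply: lt_le_trans (archi_boundP _) _.
    by rewrite invr_ge0 ltW.
  by rewrite ler_nat.
by have [g hg] := cV _ cau; exists k, g.
Qed.

End compactness.

(** * Resolvents and relatively bounded perturbations *)

(** Log-convexity makes the ratios of successive terms nondecreasing. If the first ratio q exceeded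
    r, then b n would be at least q^n b 0, which by Bernoulli outgrows C r^n. *)
Lemma log_convex_bound (R : realType) (b : nat -> R) (r C : R) :
  (forall n, 0 <= b n) -> (forall n, b n.+1 ^+ 2 <= b n * b n.+2) -> 0 < r ->
  (forall n, b n <= C * r ^+ n) -> b 1%N <= r * b 0%N.
Proof.
move=> b0 bc r0 bC; rewrite leNgt; apply/negP => h.
have b00 : 0 < b 0%N.
  rewrite lt_def b0 andbT; apply/negP => /eqP b00.
  have := bc 0%N; rewrite b00 mul0r => h1.
  have : b 1%N ^+ 2 = 0 by apply/eqP; rewrite eq_le h1 sqr_ge0.
  by move=> /eqP; rewrite sqrf_eq0 => /eqP b10; move: h; rewrite b10 b00 mulr0 ltxx.
pose q := b 1%N / b 0%N; have rq : r < q by rewrite ltr_pdivlMr.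
have q0 : 0 < q := lt_trans r0 rq.
have step n : 0 < b n /\ q * b n <= b n.+1.
  elim: n => [|n [bn0 IH]]; first by rewrite /q divfK ?lt0r_neq0.
  have bn1 : 0 < b n.+1 by apply: lt_le_trans IH; rewrite mulr_gt0.
  split=> //; rewrite -(ler_pM2l bn0); apply: le_trans (bc n).
  by rewrite mulrCA mulrA expr2 ler_wpM2r// ltW.
have bq n : q ^+ n * b 0%N <= b n.
  elim: n => [|n IH]; first by rewrite expr0 mul1r.
  rewrite exprS -mulrA; apply: le_trans (step n).2; by rewrite ler_pM2l.
have bern (x : R) n : 0 <= x -> 1 + n%:R * x <= (1 + x) ^+ n.
  move=> x0; elim: n => [|n IH]; first by rewrite mul0r addr0 expr0.
  rewrite exprS -natr1; apply: le_trans (ler_wpM2l _ IH); last by rewrite addr_ge0.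
  have := mulr_ge0 (mulr_ge0 (ler0n R n) x0) x0; lra.
pose x := q / r - 1; have x0 : 0 < x by rewrite subr_gt0 ltr_pdivlMr// mul1r.
suff : x <= 0 by rewrite leNgt x0.
apply: (@ler_of_natM _ _ _ (C / b 0%N)) => n; rewrite mulr0 add0r.
apply: le_trans (_ : (1 + x) ^+ n <= _).
  by apply: le_trans (bern x n (ltW x0)); rewrite lerDr.
rewrite /x addrC subrK expr_div_n ler_pdivlMr// mulrAC ler_pdivrMr ?exprn_gt0//.
exact: le_trans (bq n) (bC n).
Qed.

Section operator_theory.
Context (R : realType) (V : lmodType R[i]) (ip : {dot V for Num.conj}).
Hypothesis cV : complete_ip ip.
Implicit Types (u v w f g h e : V) (a z : R[i]) (s : seq V) (K L B G : V -> V).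
Local Notation nrm := (hnorm ip).

Definition sym_op G : Prop := forall f g, ip (G f) g = ip f (G g).

Lemma psd_form_CS (Q : V -> V) u v : linear Q -> sym_op Q ->
  (forall f, 0 <= rip ip (Q f) f) ->
  rip ip (Q u) v ^+ 2 <= rip ip (Q u) u * rip ip (Q v) v.
Proof.
move=> lQ sQ pQ; apply: sqr_le_mul; first exact: pQ.
move=> t; have := pQ (u + t%:C%C *: v); rewrite (linD _ _ lQ) (linZ _ _ lQ) !ripE.
have -> : rip ip (Q v) u = rip ip (Q u) v by rewrite ripC /rip sQ.
by congr (_ <= _); ring.
Qed.

Lemma vcvg_ip_eq2 x y l m w w' : vcvg ip x l -> vcvg ip y m ->
  (forall n : nat, ip (x n) w = ip (y n) w') -> ip l w = ip m w'.
Proof.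
move=> hx hy xy; apply/eqP; rewrite -subr_eq0 -normc_eq0 eq_le normc_ge0 andbT.
apply/ler_addgt0Pr => eps e0; rewrite add0r; have e2 : 0 < eps / 2 by rewrite divr_gt0.
have [N hN] := vcvg_ip w hx e2; have [N' hN'] := vcvg_ip w' hy e2.
have := hN _ (leq_maxl N N'); have := hN' _ (leq_maxr N N').
set n := maxn N N' => h1 h2.
have -> : ip l w - ip m w' = - (ip (x n) w - ip l w) + (ip (y n) w' - ip m w').
  by rewrite xy opprB addrA subrK.
apply: le_trans (le_normcD _ _) _; rewrite normcN (splitr eps).
by rewrite lerD// ltW.
Qed.

Lemma in_closure_seq (D : set V) g : in_closure ip D g ->
  exists2 x : nat -> V, (forall n, D (x n)) & vcvg ip x g.
Proof.
move=> h; have /choice[x hx] (n : nat) : exists x, D x /\ nrm (x - g) < n.+1%:R^-1.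
  by have [|x Dx hx] := h n.+1%:R^-1; [rewrite invr_gt0|exists x; rewrite nrm_distC].
exists x => [n|eps /inv_natS_small[N hN]]; first by have [] := hx n.
by exists N => n /hN; apply: lt_trans; have [] := hx n.
Qed.

(** The lower bound makes preimages of a Cauchy sequence Cauchy, so the range is closed, and being
    dense it is everything. *)
Lemma closed_range (L : V -> V) c M : linear L -> bounded_by ip M L ->
  (forall f, nrm f <= c * nrm (L f)) -> (forall h, in_closure ip (range L) h) ->
  forall h, exists f, L f = h.
Proof.
move=> lL bL bel dn h; have [y yR yh] := in_closure_seq (dn h).
have /choice[x hx] n : exists x, L x = y n by have [x _ hx] := yR n; exists x.
have c1 : 0 < `|c| + 1 by rewrite ltr_wpDl.
have cau : vcauchy ip x.
  move=> eps e0; have [|N hN] := vcvg_cauchy yh (eps := eps / (`|c| + 1)).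
    by rewrite divr_gt0.
  exists N => m n hm hn; have := hN m n hm hn; rewrite ltr_pdivlMr// -!hx -linB// => H.
  apply: le_lt_trans (bel _) _; apply: le_lt_trans H.
  by rewrite mulrC ler_wpM2l ?nrm_ge0//; apply: le_trans (ler_norm _) _; rewrite lerDl.
have [f hf] := cV cau; exists f.
apply: (vcvg_uniq (x := L \o x)); first exact: vcvg_map (linB lL) bL hf.
by apply: vcvg_ext yh => n /=; rewrite hx.
Qed.

(** Density of the range replaces the Neumann series: [1 + K] is bounded below by 1 - k, and adding
    the residual to an approximate preimage multiplies the residual by - K. *)
Lemma neumann K (k : R) : linear K -> bounded_by ip k K -> 0 <= k -> k < 1 ->
  exists N, [/\ linear N, bounded_by ip (1 - k)^-1 N,
    forall h, N h + K (N h) = h & forall f, N (f + K f) = f].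
Proof.
move=> lK bK k0 k1; have k2 : 0 < 1 - k by rewrite subr_gt0.
pose L f := f + K f.
have lL : linear L by move=> a u v; rewrite /L lK scalerDr addrACA.
have bel f : nrm f <= (1 - k)^-1 * nrm (L f).
  rewrite mulrC ler_pdivlMr// mulrBr mulr1 lerBlDr; apply: le_trans (_ : nrm (L f - K f) <= _).
    by rewrite /L addrK.
  by apply: le_trans (nrmB _ _ _) _; rewrite lerD2l mulrC bK.
have bL : bounded_by ip (1 + k) L.
  by move=> f; apply: le_trans (nrmD _ _ _) _; rewrite mulrDl mul1r lerD2l bK.
have dn h : in_closure ip (range L) h.
  have res n : exists2 f, range L f & nrm (h - f) <= k ^+ n * nrm h.
    elim: n => [|n [_ [f _ <-] IH]]; first by exists (L 0); [exists 0|rewrite lin0// subr0 mul1r].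
    exists (L (f + (h - L f))); first by exists (f + (h - L f)).
    have -> : h - L (f + (h - L f)) = - K (h - L f).
      rewrite linD// opprD addrA; set r := h - L f.
      by rewrite /L opprD addrA subrr add0r.
    rewrite nrmN exprS -mulrA; apply: le_trans (bK _) _; exact: ler_wpM2l.
  have kn : (fun n => k ^+ n * nrm h) @ \oo --> (0 : R).
    by rewrite -[X in _ --> X](mul0r (nrm h)); apply: cvgMl; apply: cvg_expr; rewrite ger0_norm.
  move=> eps e0; have [N _ hN] := cvgr0_norm_lt _ kn _ e0.
  have [f fR hf] := res N; exists f => //; apply: le_lt_trans hf _.
  by apply: le_lt_trans (ler_norm _) (hN N (leqnn N)).
have /choice[N hN] := closed_range lL bL bel dn.
have inj f g : L f = L g -> f = g.
  move=> E; apply/eqP; rewrite -subr_eq0 -(nrm_eq0 ip) eq_le nrm_ge0 andbT.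
  by apply: le_trans (bel _) _; rewrite linB// E subrr nrm0 mulr0.
exists N; split => [a u v|h|//|f].
- by apply: inj; rewrite lL !hN.
- by rewrite -{2}(hN h) bel.
- by apply: inj; rewrite hN.
Qed.

(** Nonnegativity bounds T + a below by a. A vector u orthogonal to the range lies in the domain of
    the adjoint, which is T, with T u = - a u; this forces u = 0. *)
Lemma selfadjoint_nonneg_resolvent (T : operator V) (a : R) : selfadjoint ip T ->
  nonnegative ip T -> 0 < a -> exists Ra, [/\ linear Ra, sym_op Ra,
    bounded_by ip a^-1 Ra & T = [set u | exists f, u = (Ra f, f - a%:C%C *: Ra f)]].
Proof.
move=> [[T0 TP Tf] dT adjT] nT a0.
pose S := op_shift T a%:C%C.
have S0 : S (0, 0) by rewrite /S /op_shift /= scaler0 subr0.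
have SP b u v u' v' : S (u, v) -> S (u', v') -> S (b *: u + u', b *: v + v').
  rewrite /S /op_shift /= => h h'; have := TP b _ _ h h'.
  congr T; congr pair => /=; rewrite scalerBr scalerDr opprD addrACA.
  by rewrite !scalerA [b * _]mulrC.
have bel f h : S (f, h) -> nrm f <= a^-1 * nrm h.
  rewrite /S /op_shift /= => /nT; rewrite lecE => /andP[_]; rewrite -/(rip ip _ f) !ripE => h0.
  have [->|f0] := eqVneq f 0; first by rewrite nrm0 mulr_ge0 ?nrm_ge0// invr_ge0 ltW.
  rewrite mulrC ler_pdivlMr// mulrC -(@ler_pM2r _ (nrm f)) ?nrm_gt0//.
  apply: le_trans (rip_le ip h f); rewrite -mulrA -expr2 nrm_sqr; move: h0; rewrite /=; lra.
pose D : set V := [set h | exists f, S (f, h)].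
have sD : is_subspace D.
  split; first by rewrite /D /=; exists 0.
  by move=> b u v [f hf] [g hg]; rewrite /D /=; exists (b *: f + g); exact: SP.
have dn h : in_closure ip D h.
  apply: dense_range_orth => // u hu; have Tu : T (u, - (a%:C%C *: u)).
    rewrite adjT => f g Tfg /=; have := hu (g + a%:C%C *: f).
    have Df : D (g + a%:C%C *: f) by exists f; rewrite /S /op_shift /= addrK.
    move=> /(_ Df) /ip0C; rewrite ipDl ipZl ipNr ipZr conjcR => /eqP.
    by rewrite addr_eq0 => /eqP.
  have := nT _ _ Tu; rewrite lecE => /andP[_]; rewrite -/(rip ip _ u) !ripE /= => h0.
  apply: (@rip_eq0 _ _ ip); apply/eqP; rewrite eq_le rip_ge0 andbT.
  by move: h0; rewrite oppr_ge0 pmulr_rle0.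
have sur h : exists f, S (f, h).
  have [y yD yh] := in_closure_seq (dn h).
  have /choice[x hx] n : exists x, S (x, y n) := yD n.
  have cau : vcauchy ip x.
    move=> eps e0; have [|N hN] := vcvg_cauchy yh (eps := eps * a); first by rewrite mulr_gt0.
    exists N => m n hm hn; have Smn : S (x m - x n, y m - y n).
      have := SP (-1) _ _ _ _ (hx n) (hx m); rewrite !scaleN1r.
      by rewrite ![- _ + _]addrC.
    apply: le_lt_trans (bel _ _ Smn) _.
    by rewrite mulrC ltr_pdivrMr// hN.
  have [f hf] := cV cau; exists f; rewrite /S /op_shift /= adjT => f' g' T' /=.
  have yax : vcvg ip (fun n => y n - a%:C%C *: x n) (h - a%:C%C *: f).
    apply: vcvgB yh _; apply: (@vcvg_map _ _ _ (fun v => a%:C%C *: v) `|a|) hf.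
      by move=> u v; rewrite scalerBr.
    by move=> v; rewrite nrmZR.
  rewrite (ip_conj ip g') (ip_conj ip f'); congr (Num.conj _).
  apply: vcvg_ip_eq2 hf yax _ => n; have := hx n; rewrite /S /op_shift /= adjT.
  by move=> /(_ _ _ T') /= E; rewrite ip_conj E -ip_conj.
have /choice[Ra hR] := sur.
have uniqS f f' h : S (f, h) -> S (f', h) -> f = f'.
  move=> h1 h2; apply/eqP; rewrite -subr_eq0 -(nrm_eq0 ip) eq_le nrm_ge0 andbT.
  have := bel _ _ (SP (-1) _ _ _ _ h2 h1); rewrite !scaleN1r addNr nrm0 mulr0.
  by rewrite addrC.
exists Ra; split.
- by move=> b u v; apply: uniqS (hR _) _; exact: SP.
- move=> f g; have := hR f; have := hR g; rewrite /S /op_shift /= => hg hf.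
  have := hf; rewrite {1}adjT => /(_ _ _ hg) /=.
  rewrite ipBl ipBr ipZl ipZr conjcR => /eqP; rewrite -subr_eq0 opprB addrA subrK subr_eq0.
  by move=> /eqP E; rewrite ip_conj E -ip_conj.
- by move=> f; exact: bel.
- apply/seteqP; split => [[f g] Tfg|_ [f ->]]; last exact: hR.
  have Sf : S (f, g + a%:C%C *: f) by rewrite /S /op_shift /= addrK.
  exists (g + a%:C%C *: f); have E := uniqS _ _ _ (hR _) Sf.
  by rewrite E addrK.
Qed.

End operator_theory.

Section perturbation.
Context (R : realType) (V : lmodType R[i]) (ip : {dot V for Num.conj}).
Hypothesis cV : complete_ip ip.
Implicit Types (u v w f g h e : V) (z : R[i]) (s : seq V) (K L G : V -> V) (T H B : operator V).
Local Notation nrm := (hnorm ip).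

(* G = (T + c)^{-1}. *)
Definition resolvent_at T (c : R) G : Prop :=
  T = [set u | exists f, u = (G f, f - c%:C%C *: G f)].

Lemma dom_resolvent_at T c G : resolvent_at T c G -> dom T = range G.
Proof.
move=> ->; apply/seteqP; split => [_ [_ [f [-> _]]]|_ [f _ <-]]; first by exists f.
by exists (f - c%:C%C *: G f), f.
Qed.

(** The range of G is the dense domain, so the symmetric G is injective and T is single-valued.
    Testing a pair (u1, u2) of the adjoint against the vectors G w gives u1 = G (u2 + c u1). *)
Lemma resolvent_at_selfadjoint T c G : linear G -> sym_op ip G -> resolvent_at T c G ->
  densely_defined ip T -> selfadjoint ip T.
Proof.
move=> lG sG rT dT; have injG f : G f = 0 -> f = 0.
  move=> Gf; apply: (@rip_eq0 _ _ ip); apply/eqP; rewrite -nrm_sqr sqrf_eq0 eq_le nrm_ge0 andbT.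
  apply/ler_addgt0Pr => e e0; rewrite add0r.
  have [x] := dT f e e0; rewrite (dom_resolvent_at rT) => -[g _ <-] hg.
  have fG : ip f (G g) = 0 by rewrite -sG Gf ip0l.
  have [->|f0] := eqVneq f 0; first by rewrite nrm0 ltW.
  rewrite -(ler_pM2r (x := nrm f)) ?nrm_gt0// -expr2 nrm_sqr.
  have -> : rip ip f f = rip ip (f - G g) f.
    by rewrite ripDl ripNl (ripC _ (G g)) {3}/rip fG subr0.
  by apply: le_trans (rip_le _ _ _) _; rewrite ler_wpM2r ?nrm_ge0// ltW.
have memT f : T (G f, f - c%:C%C *: G f) by rewrite rT; exists f.
split=> //.
  split.
  - rewrite [X in X 0]rT; exists 0; by rewrite lin0// scaler0 subr0.
  - move=> b u v; rewrite rT => -[f ->] [g ->]; exists (b *: f + g).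
    rewrite lG scalerDr opprD; congr pair => /=.
    by rewrite scalerBr !scalerA addrACA [b * _]mulrC.
  - move=> g; rewrite [X in X (0, g)]rT => -[f [/esym /injG -> ->]].
    by rewrite lin0// scaler0 subr0.
apply/seteqP; split => [[u1 u2]|[u1 u2] Tu]; rewrite /op_adjoint /=.
  rewrite rT => -[f [-> ->]] f' g' [h [-> ->]].
  by rewrite ipBl ipBr ipZl ipZr conjcR !sG.
have E : u1 = G (u2 + c%:C%C *: u1).
  apply: (ip_ext (ip := ip)) => w; rewrite ip_conj [RHS]ip_conj; congr Num.conj.
  have := Tu _ _ (memT w); rewrite /= ipBl ipZl linD// linZ// ipDr ipZr conjcR !sG.
  by move=> /eqP; rewrite subr_eq => /eqP ->.
have := memT (u2 + c%:C%C *: u1); rewrite -E; by rewrite addrK.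
Qed.

(* Lax: an operator that is bounded by k in norm and symmetric for the form
   <., A .> is bounded by k for that form, since n |-> <K^n f, A K^n f> is
   logarithmically convex. *)
Lemma lax_form_bound A K (k M : R) : linear A -> sym_op ip A ->
  (forall f, 0 <= rip ip f (A f)) -> bounded_by ip M A ->
  (forall f g, ip (K f) (A g) = ip f (A (K g))) -> bounded_by ip k K -> 0 < k ->
  forall f, `|rip ip (K f) (A f)| <= k * rip ip f (A f).
Proof.
move=> lA sA pA bA sK bK k0 f.
have CS u v : rip ip u (A v) ^+ 2 <= rip ip u (A u) * rip ip v (A v).
  have := @psd_form_CS _ _ ip A u v lA sA; rewrite /rip !sA; apply => g.
  by rewrite sA; exact: pA.
pose b n := rip ip (iter n K f) (A (iter n K f)).
have bKn n : nrm (iter n K f) <= k ^+ n * nrm f.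
  elim: n => [|n IH]; first by rewrite mul1r.
  rewrite iterS exprS -mulrA; apply: le_trans (bK _) _; exact: ler_wpM2l (ltW k0) _ _ _.
have : b 1%N <= k ^+ 2 * b 0%N.
  apply: (@log_convex_bound _ _ _ (`|M| * nrm f ^+ 2)).
  - by move=> n; exact: pA.
  - move=> n; apply: le_trans (CS _ _).
    by rewrite {1}/b {1}iterS /rip sK -!iterS.
  - by rewrite exprn_gt0.
  - move=> n; apply: le_trans (rip_le _ _ _) _.
    apply: (@le_trans _ _ (nrm (iter n K f) * (`|M| * nrm (iter n K f)))).
      rewrite ler_wpM2l ?nrm_ge0//; apply: le_trans (bA _) _.
      by rewrite ler_wpM2r ?nrm_ge0// ler_norm.
    rewrite mulrCA -mulrA ler_wpM2l// -expr2 -exprM mulnC exprM -exprMn [_ * k ^+ _]mulrC.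
    by rewrite ler_sqr ?nnegrE ?mulr_ge0 ?nrm_ge0 ?exprn_ge0 ?(ltW k0).
rewrite /b /= => hb; rewrite -ler_sqr ?nnegrE ?mulr_ge0 ?pA ?(ltW k0)//.
rewrite real_normK ?num_real// exprMn [rip ip f _ ^+ 2]expr2 mulrA.
by apply: le_trans (CS _ _) _; rewrite ler_wpM2r.
Qed.

(** As K = B G has norm below 1, H + B + a = (1 + K) G^{-1} has the inverse G (1 + K)^{-1}. The last
    clause makes the difference of the resolvents compact as soon as K is. *)
Theorem relative_perturbation H B (a k M : R) G K :
  resolvent_at H a G -> linear G -> sym_op ip G -> bounded_by ip M G ->
  densely_defined ip H -> nonnegative ip H ->
  (forall f g g', B (f, g) -> B (f, g') -> g = g') ->
  (forall f g f' g', B (f, g) -> B (f', g') -> ip g f' = ip f g') ->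
  (forall f, B (G f, K f)) -> linear K -> bounded_by ip k K -> 0 < k -> k < 1 -> 0 < a ->
  [/\ dom (op_sum H B) = dom H, selfadjoint ip (op_sum H B),
      semibounded_below ip (op_sum H B) &
      exists G' M', [/\ linear G', sym_op ip G', bounded_by ip M' G',
        resolvent_at (op_sum H B) a G' & forall f, G' f - G f = - G' (K f)]].
Proof.
move=> rH lG sG bG dH nH fB sB BG lK bK k0 k1 a0.
have [N [lN bN N1 N2]] := neumann cV lK bK (ltW k0) k1.
have memH f : H (G f, f - a%:C%C *: G f) by rewrite rH; exists f.
have sumP : op_sum H B = [set u | exists f, u = (G f, f - a%:C%C *: G f + K f)].
  apply/seteqP; split => [[u1 u2] [g [h [/= H1 B1 ->]]]|_ [f ->]].
    move: H1; rewrite rH => -[f [E1 ->]]; exists f; rewrite E1; congr (_, _ + _).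
    by apply: fB B1 _; rewrite E1.
  by exists (f - a%:C%C *: G f), (K f); split; [exact: memH|exact: BG|].
have rS : resolvent_at (op_sum H B) a (G \o N).
  rewrite /resolvent_at sumP; apply/seteqP; split => [_ [f ->]|_ [f ->]] /=.
    exists (f + K f); rewrite /= N2; congr pair; by rewrite addrAC.
  by exists (N f); rewrite /= addrAC N1.
have dS : dom (op_sum H B) = dom H.
  rewrite sumP (dom_resolvent_at rH); apply/seteqP; split => [_ [_ [f [-> _]]]|_ [f _ <-]].
    by exists f.
  by exists (f - a%:C%C *: G f + K f), f.
have symH f g : ip (f - a%:C%C *: G f) (G g) = ip (G f) (g - a%:C%C *: G g).
  by rewrite ipBl ipBr ipZl ipZr conjcR !sG.
have lGN : linear (G \o N) by exact: linear_comp.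
have sGN : sym_op ip (G \o N).
  move=> f g /=; rewrite -{1}(N1 g) -{2}(N1 f).
  have := symH (N f) (N g); have := sB _ _ _ _ (BG (N f)) (BG (N g)).
  rewrite ipBl ipBr ipZl ipZr conjcR ipDl ipDr => -> /eqP.
  by rewrite -subr_eq0 opprB addrA subrK subr_eq0 => /eqP ->.
have G0 f : 0 <= rip ip f (G f).
  have := nH _ _ (memH f); rewrite lecE => /andP[_]; rewrite -/(rip ip _ (G f)) ripDl ripNl ripZl.
  rewrite subr_ge0; apply: le_trans; by rewrite mulr_ge0 ?rip_ge0 ?(ltW a0).
split=> //.
- apply: resolvent_at_selfadjoint rS _ => //.
  by move=> f e e0; rewrite dS; exact: dH.
(* K is symmetric for the form <., G .>, so Lax's bound reads |<B u, u>| <= k <(H + a) u, u> with u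
   = G f; since k < 1 and H >= 0, what remains below is - k a |u|^2. *)
- exists (- (k * a)) => u1 u2; rewrite sumP => -[f [-> ->]].
  rewrite lecE; have symK g h : ip (K g) (G h) = ip g (G (K h)).
    by rewrite (sB _ _ _ _ (BG g) (BG h)) sG.
  have real_im v w : ip v w = ip w v -> complex.Im (ip v w) = 0.
    rewrite [in RHS]ip_conj; case: (ip v w) => x y /= [] //; lra.
  apply/andP; split.
    rewrite real_im; first by rewrite ip_self complex_ImM /= mul0r mulr0 addr0.
    by rewrite ipDl ipDr symH (sB _ _ _ _ (BG f) (BG f)).
  rewrite -!/(rip ip _ _) ip_self -rmorphM /= ripDl.
  have := nH _ _ (memH f); rewrite lecE => /andP[_]; rewrite -/(rip ip _ (G f)) /= => h1.
  have := @lax_form_bound G K k M lG sG G0 bG symK bK k0 f; rewrite ler_norml => /andP[h2 _].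
  have h3 : rip ip f (G f) = rip ip (f - a%:C%C *: G f) (G f) + a * rip ip (G f) (G f).
    by rewrite ripDl ripNl ripZl subrK.
  move: h1 h2; rewrite h3; set x := rip ip (_ - _) _; set y := rip ip (G f) _ => h1 h2.
  have := mulr_ge0 h1 (ltW k0); have : 0 <= (1 - k) * x by rewrite mulr_ge0// subr_ge0 ltW.
  nra.
- exists (G \o N), (`|M| * (1 - k)^-1); split=> //.
    move=> f /=; apply: le_trans (bG _) _; rewrite -mulrA.
    apply: le_trans (_ : _ <= `|M| * nrm (N f)) _; first by rewrite ler_wpM2r ?nrm_ge0// ler_norm.
    by rewrite ler_wpM2l.
  move=> f /=; have -> : G f = G (N f) + G (N (K f)).
    by rewrite -(linD _ _ lG) -(linD _ _ lN) N2.
  by rewrite opprD addrA subrr add0r.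
Qed.

End perturbation.

(** * Stability of the essential spectrum *)

Section orthonormal_systems.
Context (R : realType) (V : lmodType R[i]) (ip : {dot V for Num.conj}).
Implicit Types (u v w f g h e : V) (s : seq V).
Local Notation nrm := (hnorm ip).

(** As long as a finite system does not span N, some vector of N has a nonzero residual, whose
    normalization extends the system; a choice function iterates this. *)
Lemma finite_basis_or_orthonormal_seq (N : set V) : is_subspace N ->
  (exists s, [/\ pons ip s, (forall e, e \in s -> N e) &
     forall v, N v -> fproj ip s v = v]) \/
  (exists x : nat -> V, [/\ (forall n, N (x n)), (forall n, rip ip (x n) (x n) = 1) &
     forall m n, (m < n)%N -> ip (x n) (x m) = 0]).
Proof.
move=> sN; have [N0 NP] := sN.
pose good s := pons ip s /\ forall e, e \in s -> N e.
have [h|h] := pselect (exists s, good s /\ forall v, N v -> fproj ip s v = v).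
  by left; have [s [[p1 p2] p3]] := h; exists s.
right; have /choice[nx hnx] s : exists e, good s ->
    [/\ N e, rip ip e e = 1 & forall e', e' \in s -> ip e e' = 0].
  have [gs|gs] := pselect (good s); last by exists 0.
  have [v Nv vs] : exists2 v, N v & fproj ip s v <> v.
    by apply: contra_notP h => hs; exists s; split=> // v Nv; apply: contra_notP hs => ?; exists v.
  pose r := v - fproj ip s v; have r0 : r != 0.
    by rewrite subr_eq0; apply/eqP => /esym.
  exists ((nrm r)^-1%:C%C *: r) => _; have [ps Ns] := gs; split.
  - have Nr : N r by rewrite /r addrC -scaleN1r; apply: (NP) => //; exact: subspace_fproj.
    by rewrite -[_ *: r]addr0; exact: (NP).
  - by rewrite ripZl ripZr -nrm_sqr mulrA -expr2 -exprMn mulVf ?expr1n// nrm_eq0.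
  - by move=> e es; rewrite ipZl ip_sub_fproj// mulr0.
pose S := fix S n := if n is n'.+1 then nx (S n') :: S n' else [::].
have gS n : good (S n).
  elim: n => [|n IH]; first by split.
  have [h1 h2 h3] := hnx _ IH; have [p1 p2] := IH; split => /=.
    by split=> //; left.
  by move=> e; rewrite in_cons => /orP[/eqP->|/p2].
have SS m n : (m < n)%N -> nx (S m) \in S n.
  elim: n => // n IH; rewrite ltnS leq_eqVlt => /orP[/eqP->|/IH h1] /=.
    by rewrite mem_head.
  by rewrite in_cons h1 orbT.
exists (fun n => nx (S n)); split => [n|n|m n mn].
- by have [] := hnx _ (gS n).
- by have [] := hnx _ (gS n).
- by have [_ _] := hnx _ (gS n); apply; exact: SS.
Qed.

(** Two orthonormal vectors are at distance sqrt 2. *)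
Lemma orthonormal_seq_dist (x : nat -> V) : (forall n, rip ip (x n) (x n) = 1) ->
  (forall m n, (m < n)%N -> ip (x n) (x m) = 0) ->
  forall k : nat -> nat, {homo k : m n / (m < n)%N} -> ~ vcauchy ip (x \o k).
Proof.
move=> x1 xo k hk /(_ 1 ltr01)[N /(_ N.+1 N (leqnSn N) (leqnn N))] /=.
rewrite -(@ltr_pXn2r _ 2)// ?nnegrE ?nrm_ge0// expr1n nrm_sqr !ripE !x1.
have o : rip ip (x (k N.+1)) (x (k N)) = 0 by rewrite /rip xo ?hk.
by rewrite (ripC _ (x (k N))) o; lra.
Qed.

(** Double counting of the squared coefficients of n + 1 orthonormal vectors on a Gram-Schmidt
    system of n vectors: Parseval makes the sum n + 1, Bessel makes it at most n. *)
Lemma finite_dimensional_no_orthonormal_seq (N : set V) (x : nat -> V) :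
  finite_dimensional N -> (forall n, N (x n)) -> (forall n, rip ip (x n) (x n) = 1) ->
  ~ (forall m n, (m < n)%N -> ip (x n) (x m) = 0).
Proof.
move=> [n [b hb]] Nx x1 xo.
pose t := gram_schmidt ip [seq b i | i <- enum 'I_n].
have pt : pons ip t by exact: pons_gram_schmidt.
have tb i : fproj ip t (b i) = b i by rewrite fproj_gram_schmidt// map_f// mem_enum.
have tx k : fproj ip t (x k) = x k.
  have [c ->] := hb _ (Nx k); elim/big_ind: _ => [|u v hu hv|i _].
  - by rewrite (lin0 (fproj_linear _ _)).
  - by rewrite (linD _ _ (fproj_linear _ _)) hu hv.
  - by rewrite (linZ _ _ (fproj_linear _ _)) tb.
pose X m := [seq x i | i <- rev (iota 0 m)].
have pX m : pons ip (X m).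
  elim: m => // m IH; rewrite /X -[m.+1]addn1 iotaD add0n rev_cat /=; split=> //; first by left.
  by move=> _ /mapP[i hi ->]; apply: xo; move: hi; rewrite mem_rev mem_iota.
have E : \sum_(u <- X n.+1) \sum_(e <- t) normc (ip u e) ^+ 2 = n.+1%:R.
  rewrite [in RHS](_ : n.+1 = size (X n.+1)); last by rewrite size_map size_rev size_iota.
  rewrite -sum1_size natr_sum big_seq [RHS]big_seq; apply: eq_bigr => u /mapP[i _ ->].
  by rewrite -parseval// nrm_sqr x1.
have : \sum_(u <- X n.+1) \sum_(e <- t) normc (ip u e) ^+ 2 <= n%:R.
  rewrite exchange_big /= [leRHS](_ : n%:R = (size t)%:R); last by rewrite size_gram_schmidt size_map size_enum_ord.
  rewrite -sum1_size natr_sum !(big_seq _ _ t) ; apply: ler_sum => e et.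
  apply: (@le_trans _ _ (nrm e ^+ 2)); last by rewrite expr_le1// ?nrm_ge0// (pons_le1 pt et).
  have := bessel e (pX n.+1); rewrite -ler_sqr ?nnegrE ?nrm_ge0// rip_fproj//.
  apply: le_trans; rewrite le_eqVlt; apply/orP; left; apply/eqP.
  by apply: eq_bigr => u _; rewrite ip_conj normc_conj.
by rewrite E ler_nat ltnn.
Qed.

End orthonormal_systems.

Lemma lin_shift (R : realType) (V : lmodType R[i]) (L : V -> V) (c : R[i]) : linear L ->
  linear (fun f => L f - c *: f).
Proof.
move=> lL a u v; rewrite lL scalerBr [c *: (_ + _)]scalerDr opprD addrACA !scalerA.
by rewrite [c * a]mulrC.
Qed.

(** * A gap around 0 in the spectrum of a bounded symmetric operator *)

Section spectral_gap.
Context (R : realType) (V : lmodType R[i]) (ip : {dot V for Num.conj}).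
Hypothesis cV : complete_ip ip.
Implicit Types (u v w f g h e : V) (s : seq V).
Local Notation nrm := (hnorm ip).
Variables (B : V -> V) (M : R).
Hypotheses (lB : linear B) (sB : sym_op ip B) (bB : bounded_by ip M B).

(* At an approximate minimizer f of |C f| / |f|, C := B - s, the positive form
   |C f|^2 - k^2 |f|^2 almost vanishes, hence so does (C - k) (C + k) f. *)
Lemma shift_bounded_below (dl x : R) :
  (forall y : R, y != 0 -> `|y| < dl ->
     exists c, forall f, nrm f <= c * nrm (B f - y%:C%C *: f)) ->
  x != 0 -> `|x| + `|x| < dl -> forall f, `|x| * nrm f <= nrm (B f - x%:C%C *: f).
Proof.
move=> inv x0 xdl f0; rewrite leNgt; apply/negP => hf0.
have ax0 : 0 < `|x| by rewrite normr_gt0.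
pose C f := B f - x%:C%C *: f.
have lC : linear C by exact: lin_shift.
have sC : sym_op ip C.
  by move=> f g; rewrite /C ipBl ipBr ipZl ipZr conjcR sB.
have f00 : 0 < nrm f0.
  rewrite lt_def nrm_ge0 andbT; apply/eqP => h; move: hf0; rewrite h mulr0.
  by rewrite ltNge nrm_ge0.
pose S : set R := [set r | exists2 f, nrm f = 1 & r = nrm (C f)].
have unitS f : nrm f != 0 -> S ((nrm f)^-1 * nrm (C f)).
  move=> h; exists ((nrm f)^-1%:C%C *: f).
    by rewrite nrmZR ger0_norm ?invr_ge0 ?nrm_ge0// mulVf.
  by rewrite linZ// nrmZR ger0_norm// invr_ge0 nrm_ge0.
have S0 : S !=set0 by exists ((nrm f0)^-1 * nrm (C f0)); apply: unitS; rewrite lt0r_neq0.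
have Sb : has_lbound S by exists 0 => _ [f _ ->]; exact: nrm_ge0.
pose k := inf S.
have kx : k < `|x|.
  apply: (@le_lt_trans _ _ ((nrm f0)^-1 * nrm (C f0))).
    by apply: ge_inf => //; apply: unitS; rewrite lt0r_neq0.
  by rewrite mulrC ltr_pdivrMr.
have k0 : 0 <= k by apply: lb_le_inf => // _ [f _ ->]; exact: nrm_ge0.
have kle f : k * nrm f <= nrm (C f).
  have [->|h] := eqVneq (nrm f) 0; first by rewrite mulr0 nrm_ge0.
  have h0 : 0 < nrm f by rewrite lt_def h nrm_ge0.
  by rewrite -ler_pdivlMr// mulrC; apply: ge_inf => //; exact: unitS.
(* k < |x| keeps x + k and x - k away from 0, and |x| + |x| < dl keeps them where [inv] applies. *)
have side (y : R) : y = x + k \/ y = x - k -> y != 0 /\ `|y| < dl.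
  have := ler_norm x; have := ler_norm (- x); rewrite normrN.
  move: ax0 kx xdl k0; have [x1|x1] := leP 0 x.
    rewrite ger0_norm// => ? ? ? ? ? ? [->|->]; rewrite ltr_norml; (split; first by apply/eqP; lra); apply/andP; split; lra.
  rewrite ltr0_norm// => ? ? ? ? ? ? [->|->]; rewrite ltr_norml; (split; first by apply/eqP; lra); apply/andP; split; lra.
have [y1 y1d] := side _ (or_introl erefl); have [c1 h1] := inv _ y1 y1d.
have [y2 y2d] := side _ (or_intror erefl); have [c2 h2] := inv _ y2 y2d.
pose MC := `|M| + `|x|.
have bC f : nrm (C f) <= MC * nrm f.
  apply: le_trans (nrmB _ _ _) _; rewrite nrmZR mulrDl lerD2r; apply: le_trans (bB f) _.
  by rewrite ler_wpM2r ?nrm_ge0// ler_norm.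
pose P f := C (C f) - (k ^+ 2)%:C%C *: f.
have Pf f : rip ip (P f) f = nrm (C f) ^+ 2 - k ^+ 2 * nrm f ^+ 2.
  by rewrite /P ripDl ripNl ripZl {1}/rip sC !nrm_sqr.
have sP : sym_op ip P.
  by move=> f g; rewrite /P ipBl ipBr ipZl ipZr conjcR !sC.
have lP : linear P by apply: (lin_shift (L := C \o C)); exact: linear_comp.
have Pge0 f : 0 <= rip ip (P f) f.
  rewrite Pf subr_ge0 -exprMn ler_sqr ?nnegrE ?mulr_ge0 ?nrm_ge0//.
have PM f : rip ip (P f) f <= MC ^+ 2 * nrm f ^+ 2.
  rewrite Pf -!exprMn lerBlDr -[leLHS]addr0 lerD ?sqr_ge0//.
  by rewrite ler_sqr ?nnegrE ?mulr_ge0 ?addr_ge0 ?nrm_ge0.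
have Psmall f : nrm (P f) ^+ 2 <= MC ^+ 2 * rip ip (P f) f.
  have [->|h] := eqVneq (nrm (P f)) 0; first by rewrite expr0n mulr_ge0 ?sqr_ge0.
  have n0 : 0 < nrm (P f) ^+ 2 by rewrite exprn_gt0// lt_def h nrm_ge0.
  rewrite -(ler_pM2r n0) -expr2.
  have : (nrm (P f) ^+ 2) ^+ 2 <= rip ip (P f) f * rip ip (P (P f)) (P f).
    by rewrite [X in X ^+ 2]nrm_sqr; exact: psd_form_CS.
  move=> hh; apply: le_trans hh _; rewrite mulrAC [leRHS]mulrC.
  by rewrite ler_wpM2l// PM.
have fact f : P f = (B (C f + k%:C%C *: f) - (x + k)%:C%C *: (C f + k%:C%C *: f)).
  have -> : B (C f + k%:C%C *: f) - (x + k)%:C%C *: (C f + k%:C%C *: f) =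
     C (C f + k%:C%C *: f) - k%:C%C *: (C f + k%:C%C *: f).
    by rewrite {2}/C rmorphD /= scalerDl opprD addrA.
  have -> : C (C f + k%:C%C *: f) = C (C f) + k%:C%C *: C f.
    by rewrite (linD _ _ lC) (linZ _ _ lC).
  rewrite [k%:C%C *: (C f + _)]scalerDr opprD addrA addrK /P scalerA -rmorphM /=.
  by rewrite expr2.
have CkE f : C f + k%:C%C *: f = B f - (x - k)%:C%C *: f.
  by rewrite /C rmorphB /= scalerBl opprB addrA addrAC.
have low f : nrm f <= `|c1| * `|c2| * nrm (P f).
  have := h1 (C f + k%:C%C *: f); rewrite -fact => hh1.
  have := h2 f; rewrite -CkE => hh2; rewrite mulrAC.
  apply: le_trans hh2 _; apply: (@le_trans _ _ (`|c2| * nrm (C f + k%:C%C *: f))).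
    by rewrite ler_wpM2r ?nrm_ge0// ler_norm.
  rewrite [leRHS]mulrC ler_wpM2l//; apply: le_trans hh1 _.
  by rewrite ler_wpM2r ?nrm_ge0// ler_norm.
pose D := (`|c1| * `|c2|) ^+ 2 * MC ^+ 2.
have D0 : 0 <= D by rewrite mulr_ge0 ?sqr_ge0.
(* For a near-minimizer f of norm 1 the lower bound reads 1 <= D <P f, f>; this eta forces D <P f,
   f> < 1. *)
pose eta := (D + 1)^-1; have eta0 : 0 < eta by rewrite invr_gt0 ltr_wpDl.
have [d dk hd] : exists2 d, k < d & d ^+ 2 < k ^+ 2 + eta.
  pose y := Num.min 1 (eta / (2 * k + 2)).
  have k2 : 0 < 2 * k + 2 by rewrite ltr_wpDl// mulr_ge0.
  have yp : 0 < y by rewrite lt_min ltr01 divr_gt0.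
  have yle1 : y <= 1 by rewrite ge_min lexx.
  have : y <= eta / (2 * k + 2) by rewrite ge_min lexx orbT.
  rewrite ler_pdivlMr// => yle; exists (k + y); first by rewrite ltrDl.
  by rewrite sqrrD; nra.
have dk0 : 0 < d - k by rewrite subr_gt0.
have [_ [f f1 ->] hf] := inf_adherent dk0 (conj S0 Sb).
have : 1 <= D * rip ip (P f) f.
  have h : 1 ^+ 2 <= (`|c1| * `|c2| * nrm (P f)) ^+ 2.
    by rewrite ler_sqr ?nnegrE ?mulr_ge0 ?nrm_ge0// -f1.
  move: h; rewrite expr1n exprMn => h; apply: le_trans h _.
  by rewrite /D -[leRHS]mulrA ler_wpM2l ?sqr_ge0.
have : rip ip (P f) f < eta.
  rewrite Pf f1 expr1n mulr1 ltrBlDl; apply: le_lt_trans hd.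
  rewrite ler_sqr ?nnegrE ?nrm_ge0// ?(le_trans k0 (ltW dk))//.
  by move: hf; rewrite addrC subrK => /ltW.
move=> h4 h5; have : D * rip ip (P f) f <= D * eta by rewrite ler_wpM2l// ltW.
have : D * eta < 1 by rewrite /eta ltr_pdivrMr ?ltr_wpDl// mul1r ltrDl.
lra.
Qed.

(* The sum of the nonnegative numbers |Bu|^2 - dl <Bu,u> at u = B v + dl v and
   |Bu|^2 + dl <Bu,u> at u = B v - dl v is 2 (|B B v|^2 - dl^2 |B v|^2). *)
Lemma range_bounded_below (dl x : R) :
  (forall y : R, y != 0 -> `|y| < dl ->
     exists c, forall f, nrm f <= c * nrm (B f - y%:C%C *: f)) ->
  0 < x -> x + x < dl -> forall v, 2 * x * nrm (B v) <= nrm (B (B v)).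
Proof.
move=> inv x0 xdl v.
have q (y : R) f : `|y| = x -> 2 * y * rip ip (B f) f <= nrm (B f) ^+ 2.
  move=> yx; have y0 : y != 0 by rewrite -normr_gt0 yx.
  have yy : `|y| + `|y| < dl by rewrite yx.
  have := shift_bounded_below inv y0 yy f.
  rewrite -ler_sqr ?nnegrE ?mulr_ge0 ?nrm_ge0// exprMn real_normK ?num_real// !nrm_sqr.
  by rewrite !ripE (ripC ip f (B f)); lra.
rewrite -ler_sqr ?nnegrE ?mulr_ge0 ?nrm_ge0 ?(ltW x0)// exprMn !nrm_sqr.
pose w := B v; have e1 : rip ip (B w) v = rip ip w w by rewrite /rip sB.
have := q x (w + (2 * x)%:C%C *: v) (gtr0_norm x0).
have := q (- x) (w - (2 * x)%:C%C *: v); rewrite normrN => /(_ (gtr0_norm x0)).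
rewrite (linB lB) (linD _ _ lB) !(linZ _ _ lB) -/w !nrm_sqr !ripE.
rewrite (ripC _ w (B w)) (ripC _ w v) e1 (ripC _ v w).
set a := rip ip (B w) (B w); set b := rip ip (B w) w; set c := rip ip w w.
set d := rip ip w v; move=> h1 h2; lra.
Qed.

End spectral_gap.

(** * Fredholm pencils and compact perturbations *)

Section weyl.
Context (R : realType) (V : lmodType R[i]) (ip : {dot V for Num.conj}).
Hypothesis cV : complete_ip ip.
Implicit Types (u v f g h e : V) (s : seq V) (z : R[i]) (T : operator V) (G K : V -> V).
Local Notation nrm := (hnorm ip).

(** With G = (T + a)^{-1} and u = G f one has (T - z) u = [pencil G (z + a) f], which moves spectral
    questions about T to a bounded operator. *)
Definition pencil G z f := f - z *: G f.

Definition invertible G z : Prop :=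
  (exists c, forall f, nrm f <= c * nrm (pencil G z f)) /\
  forall h, exists f, pencil G z f = h.

(** A sequential form of having closed range and finite-dimensional kernel; for symmetric bounded G
    and real z this is the Fredholm property. It passes through compact perturbations by mere
    extraction of subsequences. *)
Definition fredholm G z : Prop := forall (u : nat -> V) C, (forall n, nrm (u n) <= C) ->
  vcauchy ip (fun n => pencil G z (u n)) ->
  exists (k : nat -> nat) g, {homo k : m n / (m < n)%N} /\ vcvg ip (u \o k) g.

Lemma pencil_linear G z : linear G -> linear (pencil G z).
Proof.
by move=> lG a u v; rewrite /pencil lG scalerBr scalerDr opprD addrACA !scalerA [z * a]mulrC.
Qed.

Lemma pencil_adj G z f g : sym_op ip G -> ip (pencil G z f) g = ip f (pencil G (Num.conj z) g).
Proof. by move=> sG; rewrite /pencil ipBl ipBr ipZl ipZr conjCK sG. Qed.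

Lemma pencil_bounded G z M : bounded_by ip M G -> bounded_by ip (1 + normc z * M) (pencil G z).
Proof.
move=> bG f; apply: le_trans (nrmB _ _ _) _.
by rewrite mulrDl mul1r lerD2l nrmZ -mulrA ler_wpM2l// normc_ge0.
Qed.

Lemma bounded_below_inj (L : V -> V) c : linear L -> (forall f, nrm f <= c * nrm (L f)) ->
  forall f, L f = 0 -> f = 0.
Proof.
move=> lL h f Lf; apply/eqP; rewrite -(nrm_eq0 ip) eq_le nrm_ge0 andbT.
by apply: le_trans (h f) _; rewrite Lf nrm0 mulr0.
Qed.

(** The lower bound closes the range, whose orthogonal complement is the kernel of the adjoint, the
    pencil at the conjugate of z. *)
Lemma invertible_of_bounded_below G M z : linear G -> sym_op ip G -> bounded_by ip M G ->
  (exists c, forall f, nrm f <= c * nrm (pencil G z f)) ->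
  (forall f, pencil G (Num.conj z) f = 0 -> f = 0) -> invertible G z.
Proof.
move=> lG sG bG [c hc] inj; split; first by exists c.
apply: (closed_range cV (pencil_linear z lG) (pencil_bounded z bG) hc) => h.
apply: dense_range_orth => //.
  split; first by exists 0 => //; rewrite (lin0 (pencil_linear z lG)).
  by move=> a _ _ [f _ <-] [g _ <-]; exists (a *: f + g) => //; rewrite (pencil_linear z lG).
move=> u hu; apply: inj; apply: (ip_ext (ip := ip)) => w.
rewrite ip0l ip_conj -(pencil_adj z w u sG) ip_conj [ip u _]hu ?rmorph0//; by exists w.
Qed.

Lemma invertible_nonreal G M z : linear G -> sym_op ip G -> bounded_by ip M G ->
  complex.Im z != 0 -> invertible G z.
Proof.
move=> lG sG bG.
have bel w : complex.Im w != 0 -> forall f,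
    nrm f <= (1 + normc w / `|complex.Im w|) * nrm (pencil G w f).
  move=> w0 f; have aw : 0 < `|complex.Im w| by rewrite normr_gt0.
  (* Testing against G f isolates Im w, because <f, G f> is real by symmetry of G. *)
  have h : `|complex.Im w| * nrm (G f) <= nrm (pencil G w f).
    have [->|g0] := eqVneq (G f) 0; first by rewrite nrm0 mulr0 nrm_ge0.
    rewrite -(@ler_pM2r _ (nrm (G f))) ?nrm_gt0// -mulrA -expr2 nrm_sqr.
    apply: le_trans (ip_CS _ _ _); apply: le_trans (Im_le_normc _).
    rewrite /pencil ipBl ipZl ip_self raddfB /= complex_ImM /= mulr0 add0r.
    have -> : complex.Im (ip f (G f)) = 0.
      have : ip f (G f) = Num.conj (ip f (G f)) by rewrite -ip_conj sG.
      by rewrite conjcE; case: (ip f (G f)) => x y /= [] yy; lra.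
    by rewrite sub0r normrN normrM (ger0_norm (rip_ge0 _ _)).
  rewrite -[f in leLHS](subrK (w *: G f)); apply: le_trans (nrmD _ _ _) _.
  rewrite -/(pencil G w f) mulrDl mul1r lerD2l nrmZ -mulrA ler_wpM2l ?normc_ge0//.
  by rewrite mulrC ler_pdivlMr// mulrC.
move=> z0; apply: invertible_of_bounded_below bG _ _ => //.
  by exists (1 + normc z / `|complex.Im z|); exact: bel.
apply: (bounded_below_inj (c := 1 + normc (Num.conj z) / `|complex.Im (Num.conj z)|)).
  exact: pencil_linear.
by apply: bel; rewrite conjcE /= oppr_eq0.
Qed.

Lemma fredholm_invertible G z : linear G -> invertible G z -> fredholm G z.
Proof.
move=> lG [[c hc] _] u C _ cau; exists id.
have c1 : 0 < `|c| + 1 by rewrite ltr_wpDl.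
suff : vcauchy ip u by move=> /cV[g hg]; exists g; split.
move=> eps e0; have [|N hN] := cau (eps / (`|c| + 1)); first by rewrite divr_gt0.
exists N => m n hm hn; have := hN m n hm hn; rewrite ltr_pdivlMr//.
rewrite -(linB (pencil_linear z lG)) => H.
apply: le_lt_trans (hc _) _; apply: le_lt_trans H.
by rewrite mulrC ler_wpM2l ?nrm_ge0//; apply: le_trans (ler_norm _) _; rewrite lerDl.
Qed.

(** Along a subsequence (G' - G) u converges, and there the two pencils differ by a convergent
    sequence. *)
Lemma fredholm_cpt_perturbation G G' M z : linear G -> linear G' ->
  bounded_by ip M (fun f => G' f - G f) -> cpt ip (fun f => G' f - G f) ->
  fredholm G z -> fredholm G' z.
Proof.
move=> lG lG' bK cK hG u C uC cau.
have lK : linear (fun f => G' f - G f).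
  by move=> a x y; rewrite lG lG' scalerBr opprD addrACA.
have [k [g [hk hg]]] := cpt_subseq cV lK bK cK uC.
have cau' : vcauchy ip (fun n => pencil G z (u (k n))).
  have hz : vcvg ip (fun n => z *: (G' (u (k n)) - G (u (k n)))) (z *: g).
    apply: (@vcvg_map _ _ _ ( *:%R z) (normc z)) hg; last by move=> x; rewrite nrmZ.
    by move=> x y; rewrite scalerBr.
  move=> eps e0; have e2 : 0 < eps / 2 by rewrite divr_gt0.
  have [N hN] := cau _ e2; have [N' hN'] := vcvg_cauchy hz e2.
  exists (maxn N N') => m n; rewrite !geq_max => /andP[m1 m2] /andP[n1 n2].
  have kge i : (i <= k i)%N.
    by elim: i => // i IH; exact: leq_ltn_trans IH (hk _ _ (ltnSn i)).
  have E i : pencil G z (u (k i)) =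
      pencil G' z (u (k i)) + z *: (G' (u (k i)) - G (u (k i))).
    by rewrite /pencil scalerBr addrA subrK.
  rewrite !E opprD addrACA (splitr eps); apply: le_lt_trans (nrmD _ _ _) _.
  by rewrite ltrD ?hN'// hN// (leq_trans _ (kge _)).
have [k' [g' [hk' hg']]] := hG _ C (fun n => uC (k n)) cau'.
exists (k \o k'), g'; split=> // m n mn /=; exact/hk/hk'.
Qed.

End weyl.

Section essential_spectrum.
Context (R : realType) (V : lmodType R[i]) (ip : {dot V for Num.conj}).
Hypothesis cV : complete_ip ip.
Implicit Types (u v f g h e : V) (s : seq V) (z w : R[i]).
Local Notation nrm := (hnorm ip).
Variables (T : operator V) (a M : R) (G : V -> V).
Hypotheses (lG : linear G) (sG : sym_op ip G) (bG : bounded_by ip M G).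
Hypothesis rT : resolvent_at T a G.

Lemma op_shift_resolventP z u h :
  op_shift T (- z) (u, h) <-> exists2 f, u = G f & pencil G (z + a%:C%C) f = h.
Proof.
rewrite /op_shift /pencil rT /= scaleNr opprK; split => [[f [-> hf]]|[f -> <-]].
  by exists f => //; rewrite scalerDl opprD addrA addrAC -hf addrK.
by exists f; rewrite scalerDl opprD addrA addrAC subrK.
Qed.

(** Since f is [pencil G w f] plus w G f, bounds on f and on G f in terms of the pencil imply each
    other. *)
Lemma resolvent_setP z : resolvent_set ip T z <-> invertible ip G (z + a%:C%C).
Proof.
set w := z + _; split => [[ex [C hC]]|[[c hc] sur]]; split.
- exists (1 + normc w * C) => f.
  rewrite -[f in leLHS](subrK (w *: G f)); apply: le_trans (nrmD _ _ _) _.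
  rewrite mulrDl mul1r lerD2l nrmZ -mulrA ler_wpM2l ?normc_ge0//.
  by apply: hC; apply/op_shift_resolventP; exists f.
- by move=> h; have [u [/op_shift_resolventP[f _ hf] _]] := ex h; exists f.
- move=> h; have [f hf] := sur h; exists (G f); split.
    by apply/op_shift_resolventP; exists f.
  move=> u /op_shift_resolventP[f' -> hf']; congr G; apply/eqP.
  rewrite -subr_eq0; apply/eqP.
  apply: (bounded_below_inj (pencil_linear w lG) hc).
  by rewrite (linB (pencil_linear w lG)) hf hf' subrr.
- exists (`|M| * `|c|) => _ h /op_shift_resolventP[f -> <-].
  apply: le_trans (bG f) _; rewrite -mulrA.
  apply: (@le_trans _ _ (`|M| * nrm f)); first by rewrite ler_wpM2r ?nrm_ge0// ler_norm.
  rewrite ler_wpM2l//; apply: le_trans (hc f) _.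
  by rewrite ler_wpM2r ?nrm_ge0// ler_norm.
Qed.

Lemma eigenspaceP z f : Defs.eigenspace T z f <-> pencil G (z + a%:C%C) f = 0.
Proof.
rewrite /Defs.eigenspace /= rT; set w := z + _; split => [[g [-> h]]|/eqP].
  have wG : w *: G g = g by rewrite /w scalerDl h subrK.
  by rewrite /pencil -(linZ _ _ lG) wG subrr.
rewrite /pencil subr_eq0 => /eqP h; exists (w *: f); rewrite (linZ _ _ lG) -h.
by rewrite /w scalerDl addrK.
Qed.

Lemma kernel_subspace z : is_subspace [set f | pencil G z f = 0].
Proof.
split=> [|b u v /= hu hv]; first by rewrite /= (lin0 (pencil_linear z lG)).
by rewrite (pencil_linear z lG) hu hv scaler0 addr0.
Qed.

Lemma spectrum_real z : Defs.spectrum ip T z -> complex.Im z = 0.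
Proof.
move=> sz; apply/eqP; apply: contra_notT sz => z0; apply/resolvent_setP.
by apply: (invertible_nonreal cV lG sG bG); rewrite raddfD /= addr0.
Qed.

Lemma conj_shift z : complex.Im z = 0 -> Num.conj (z + a%:C%C) = z + a%:C%C.
Proof. by case: z => x y /= ->; apply/eqP; rewrite eq_complex /= addr0 oppr0 !eqxx. Qed.

(** The kernel N of the pencil is finite-dimensional, since an orthonormal sequence in it would
    violate the Fredholm property, and it is nonzero for z in the spectrum. Pencils at nearby points
    preserve N and its complement, are a nonzero scalar on N and bounded below on the complement; so
    z is isolated. *)
Lemma fredholm_not_essential z : fredholm ip G (z + a%:C%C) -> ~ essential_spectrum ip T z.
Proof.
set w := z + _ => F [sz]; apply; have z0 := spectrum_real sz.
have lD := pencil_linear w lG; have bD := pencil_bounded w bG.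
have [[s [ps Ns sN]]|[x [Nx x1 xo]]] := finite_basis_or_orthonormal_seq ip (kernel_subspace w); last first.
  exfalso; have [||k [g [hk hg]]] := F x 1.
  - by move=> n; rewrite -(@ler_pXn2r _ 2)// ?nnegrE ?nrm_ge0// nrm_sqr x1 expr1n.
  - by move=> eps e0; exists 0%N => m n _ _; rewrite !Nx subrr nrm0.
  - exact: (orthonormal_seq_dist x1 xo hk) (vcvg_cauchy hg).
have wr : Num.conj w = w by exact: conj_shift.
(* Otherwise unit vectors orthogonal to N with images tending to 0 would have a limit point that
   lies in N and is orthogonal to N, yet has norm 1. *)
have [c c0 hc] : exists2 c : R, 0 < c & forall b, (forall e, e \in s -> ip b e = 0) ->
    nrm b <= c * nrm (pencil G w b).
  apply: contrapT => nc.
  have /choice[b hb] (n : nat) : exists b, [/\ forall e, e \in s -> ip b e = 0,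
      nrm b = 1 & nrm (pencil G w b) < n.+1%:R^-1].
    have [b bs hb] : exists2 b, (forall e, e \in s -> ip b e = 0) &
        n.+1%:R * nrm (pencil G w b) < nrm b.
      apply: contrapT => h; apply: nc; exists n.+1%:R => // b bs.
      by rewrite leNgt; apply/negP => hb; apply: h; exists b.
    have b0 : 0 < nrm b by apply: le_lt_trans hb; rewrite mulr_ge0 ?nrm_ge0.
    exists ((nrm b)^-1%:C%C *: b); split.
    - by move=> e es; rewrite ipZl bs// mulr0.
    - by rewrite nrmZR ger0_norm ?invr_ge0 ?nrm_ge0// mulVf// lt0r_neq0.
    - rewrite (linZ _ _ lD) nrmZR ger0_norm ?invr_ge0 ?nrm_ge0//.
      by rewrite mulrC ltr_pdivrMr// mulrC ltr_pdivlMr// mulrC.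
  have [n|| k [g [hk hg]]] := F b 1.
  - by have [_ ->] := hb n.
  - move=> eps e0; have [|N hN] := inv_natS_small (eps := eps / 2); first by rewrite divr_gt0.
    exists N => m n hm hn; apply: le_lt_trans (nrmB _ _ _) _; rewrite (splitr eps).
    have [_ _ h1] := hb m; have [_ _ h2] := hb n.
    by rewrite ltrD ?(lt_trans h1 (hN _ hm)) ?(lt_trans h2 (hN _ hn)).
  - have Dg : pencil G w g = 0.
      apply: (vcvg_uniq (ip := ip) (x := pencil G w \o (b \o k))).
        exact: vcvg_map (linB lD) bD hg.
      move=> eps e0; have [N hN] := inv_natS_small e0.
      exists N => n hn; rewrite subr0 /=; have [_ _ h1] := hb (k n).
      apply: lt_trans h1 (hN _ _); apply: leq_trans hn _.
      by elim: (n) => // i IH; exact: leq_ltn_trans IH (hk _ _ (ltnSn i)).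
    have g0 : g = 0.
      rewrite -(sN g Dg) fproj_orth0// => e es.
      by apply: vcvg_ip_eq hg _ => n /=; have [h1 _ _] := hb (k n); exact: h1.
    have [N /(_ N (leqnn N))] := hg 1 ltr01.
    by rewrite g0 subr0 /=; have [_ -> _] := hb (k N); rewrite ltxx.
have nN : exists2 f, f != 0 & pencil G w f = 0.
  apply: contrapT => hn; apply: sz; apply/resolvent_setP.
  have inj f : pencil G w f = 0 -> f = 0.
    by move=> h; apply/eqP; apply: contraPT hn => f0; apply; exists f.
  apply: (invertible_of_bounded_below cV lG sG bG); last by rewrite wr.
  exists c => f; apply: hc => e es; have := inj e (Ns e es) => ->; exact: ip0r.
split=> //.
- have w0 : w != 0.
    apply/eqP => w0; have [f f0] := nN; rewrite /pencil w0 scale0r subr0 => /eqP.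
    by rewrite (negPf f0).
  (* Within this radius the perturbation (v - w) G uses up at most half of the lower bound 1 / c on
     the complement of N. *)
  pose rho := (2 * c * (`|M| + 1))^-1.
  have M1 : 0 < `|M| + 1 by rewrite ltr_wpDl.
  have rho0 : 0 < rho by rewrite invr_gt0 !mulr_gt0.
  exists rho => // z' sz' zz'; apply: contrapT => zne; apply: sz'; apply/resolvent_setP.
  pose w' := z' + a%:C%C; rewrite -/w'.
  have dw : normc (w' - w) < rho.
    by move: zz'; rewrite normc_def ltcR /w' /w opprD addrACA subrr addr0; case: (z' - z).
  have ww' : w' != w by apply/eqP => /addIr.
  have key (v : R[i]) : normc (v - w) < rho -> v != w -> exists c', forall f, nrm f <= c' * nrm (pencil G v f).
    (* On N one has f = w G f, so the pencil at v acts there as multiplication by t. *)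
    move=> vw vnw; pose t := (w - v) / w.
    have t0 : 0 < normc t.
      rewrite lt_def normc_ge0 andbT normc_eq0 mulf_eq0 invr_eq0 (negPf w0) orbF subr_eq0 eq_sym.
      exact: vnw.
    have lv := pencil_linear v lG.
    have Na f : pencil G w f = 0 -> pencil G v f = t *: f.
      rewrite /pencil => /eqP; rewrite subr_eq0 => /eqP fG; rewrite {1 3}fG.
      by rewrite scalerA -scalerBl /t divfK.
    have orth b e : (forall e, e \in s -> ip b e = 0) -> e \in s -> ip (pencil G v b) e = 0.
      move=> bs es; have Ge : w *: G e = e by move/eqP: (Ns e es); rewrite subr_eq0 => /eqP.
      have -> : pencil G v b = b - v *: G b by [].
      rewrite ipBl bs// ipZl sG -[G e](scalerK w0) Ge ipZr bs// !mulr0 subr0 //.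
    exists ((normc t)^-1 + 4 * c) => f.
    pose x := fproj ip s f; pose b := f - x.
    have bs e : e \in s -> ip b e = 0 by move=> es; exact: ip_sub_fproj.
    have Nx : pencil G w x = 0 by exact: (subspace_fproj ip f (kernel_subspace w) Ns).
    have Df : pencil G v f = t *: x + pencil G v b.
      by rewrite -Na// -(linD _ _ lv) /b addrC subrK.
    have hx : normc t * nrm x <= nrm (pencil G v f).
      rewrite -nrmZ -(sN x Nx) -(linZ _ _ (fproj_linear _ _)).
      have -> : fproj ip s (t *: x) = fproj ip s (pencil G v f).
        rewrite Df (linD _ _ (fproj_linear _ _)) (fproj_orth0 (v := pencil G v b)) ?addr0//.
        by move=> e; exact: orth.
      exact: bessel.
    have hb1 : nrm (pencil G v b) <= 2 * nrm (pencil G v f).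
      have -> : pencil G v b = pencil G v f - t *: x by rewrite Df addrAC subrr add0r.
      by apply: le_trans (nrmB _ _ _) _; rewrite nrmZ mulrDl mul1r lerD2l.
    have hb2 : nrm b <= 2 * c * nrm (pencil G v b).
      have h1 : nrm (pencil G w b) <= nrm (pencil G v b) + rho * (`|M| + 1) * nrm b.
        have -> : pencil G w b = pencil G v b + (v - w) *: G b.
          by rewrite /pencil scalerBl addrA subrK.
        apply: le_trans (nrmD _ _ _) _; rewrite lerD2l nrmZ -mulrA.
        apply: ler_pM; rewrite ?normc_ge0 ?nrm_ge0 ?(ltW vw)//; apply: le_trans (bG b) _.
        by rewrite ler_wpM2r ?nrm_ge0//; apply: le_trans (ler_norm _) _; rewrite lerDl.
      have h2 : c * (rho * (`|M| + 1)) = 2^-1 by rewrite /rho; field; rewrite !lt0r_neq0.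
      have := hc b bs; have := ler_wpM2l (ltW c0) h1; rewrite mulrDr mulrA h2; lra.
    rewrite -[f in leLHS](subrK x) -/b; apply: le_trans (nrmD _ _ _) _.
    rewrite addrC mulrDl lerD//; first by rewrite mulrC ler_pdivlMr// mulrC.
    apply: le_trans hb2 _; have := ler_wpM2l (ltW c0) hb1; lra.
  apply: (invertible_of_bounded_below cV lG sG bG); first exact: key.
  have [||c' hc'] := key (Num.conj w').
  - by rewrite -wr -rmorphB /= normc_conj.
  - by apply: contra ww' => /eqP h; rewrite -[w']conjCK h wr.
  - exact: bounded_below_inj (pencil_linear _ lG) hc'.
- by have [f f0 hf] := nN; exists f => //; exact/eigenspaceP.
- exists (size s), (fun i => s`_i) => f /eigenspaceP /sN {1}<-.
  exists (fun i => ip f s`_i); rewrite /fproj (big_nth 0) big_mkord //.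
Qed.

(** Invertibility around w isolates 0 in the spectrum of the symmetric pencil at w, which is then
    bounded below on its range, hence on the complement of its kernel. The kernel part of a bounded
    sequence is finite-dimensional. *)
Lemma isolated_fredholm w (rho : R) : w != 0 -> Num.conj w = w -> 0 < rho ->
  (forall v : R[i], v != w -> normc (v - w) < rho -> invertible ip G v) ->
  (forall x : nat -> V, (forall n, pencil G w (x n) = 0) ->
     (forall n, rip ip (x n) (x n) = 1) -> ~ forall m n, (m < n)%N -> ip (x n) (x m) = 0) ->
  fredholm ip G w.
Proof.
move=> w0 wr rho0 iso fin u C uC cau.
have [[s [ps Ns sN]]|[x [Nx x1 xo]]] := finite_basis_or_orthonormal_seq ip (kernel_subspace w); last first.
  by have := fin x Nx x1 xo.
have lD := pencil_linear w lG; have bD := pencil_bounded w bG.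
have sD : sym_op ip (pencil G w) by move=> f g; rewrite pencil_adj// wr.
have nw0 : 0 < normc w by rewrite lt_def normc_ge0 andbT normc_eq0.
(* For v = w / (1 - y) one has v - w = w y / (1 - y); the first bound on |y| keeps 1 - y above 1/2,
   and the second then keeps |v - w| below rho. *)
pose dl := Num.min 2^-1 (rho / (2 * normc w)).
have dl0 : 0 < dl by rewrite lt_min invr_gt0 ltr0n /= divr_gt0 ?mulr_gt0.
(* pencil G w - y = (1 - y) pencil G (w / (1 - y)) *)
have inv (y : R) : y != 0 -> `|y| < dl ->
    exists c, forall f, nrm f <= c * nrm (pencil G w f - y%:C%C *: f).
  rewrite lt_min => y0 /andP[y1 y2].
  have y3 : 2^-1 < 1 - y by have := ler_norm y; lra.
  have y4 : 0 < 1 - y by apply: lt_trans y3; rewrite invr_gt0.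
  have y5 : 1 - y != 0 by rewrite lt0r_neq0.
  pose v := w * ((1 - y)^-1)%:C%C.
  have vw : v - w = w * (y / (1 - y))%:C%C.
    rewrite /v -{2}[w]mulr1 -mulrBr -(rmorph1 (real_complex R)) -rmorphB /=.
    by congr (_ * _%:C%C); field.
  have [|| [c hc] _] := iso v.
  - rewrite -subr_eq0 vw mulf_eq0 (negPf w0) /=.
    by rewrite (eq_complex _ 0) /= eqxx andbT mulf_eq0 invr_eq0 (negPf y0) (negPf y5).
  - rewrite vw ComplexField.Normc.normcM normcR normrM normrV ?unitfE// (ger0_norm (ltW y4)).
    rewrite mulrA ltr_pdivrMr//; move: y2; rewrite ltr_pdivlMr ?mulr_gt0// => y2.
    nra.
  exists (`|c| * (1 - y)^-1) => f; have -> : pencil G w f - y%:C%C *: f = (1 - y)%:C%C *: pencil G v f.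
    rewrite /pencil scalerBr scalerA /v mulrCA -rmorphM /= divff// rmorph1 mulr1.
    by rewrite rmorphB rmorph1 /= scalerBl scale1r addrAC.
  rewrite nrmZR (ger0_norm (ltW y4)) mulrA divfK//; apply: le_trans (hc f) _.
  by rewrite ler_wpM2r ?nrm_ge0// ler_norm.
pose x := dl / 4; have x0 : 0 < x by rewrite divr_gt0.
have xdl : x + x < dl by rewrite /x; lra.
have low := range_bounded_below lD sD bD inv x0 xdl.
have x20 : 0 < 2 * x by rewrite mulr_gt0.
have lowcl g : in_closure ip (range (pencil G w)) g -> 2 * x * nrm g <= nrm (pencil G w g).
  move=> /in_closure_seq[y yR yg].
  have hy n : 2 * x * nrm (y n) <= nrm (pencil G w (y n)) by have [v _ <-] := yR n.
  apply/ler_addgt0Pr => eps e0; have e2 : 0 < eps / 2 by rewrite divr_gt0.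
  have [N hN] := vcvg_map (linB lD) bD yg e2.
  have [|N' hN'] := yg (eps / 2 / (2 * x)); first by rewrite divr_gt0.
  have := hN _ (leq_maxl N N'); have := hN' _ (leq_maxr N N').
  set n := maxn N N'; rewrite ltr_pdivlMr//= => h1 h2.
  have h3 : nrm (pencil G w (y n)) <= nrm (pencil G w g) + eps / 2.
    by rewrite -lerBlDl; apply: le_trans (nrmB_ge _ _ _) (ltW h2).
  have h4 : nrm g <= nrm (y n) + nrm (y n - g).
    by rewrite -lerBlDl; apply: le_trans (nrmB_ge _ _ _) _; rewrite nrm_distC.
  have := hy n; have := ler_wpM2l (ltW x20) h4; lra.
(* If g is the projection of b on the closure of the range, b - g lies in the kernel; as it is also
   orthogonal to the kernel, b = g. *)
have lowN b : (forall e, e \in s -> ip b e = 0) -> 2 * x * nrm b <= nrm (pencil G w b).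
  move=> bs; apply: lowcl.
  have sR : is_subspace (range (pencil G w)).
    split; first by exists 0 => //; rewrite (lin0 lD).
    by move=> r _ _ [f _ <-] [g _ <-]; exists (r *: f + g) => //; rewrite lD.
  have [g gR og] := projection_thm b cV sR.
  have Nbg : pencil G w (b - g) = 0.
    apply: (ip_ext (ip := ip)) => v; rewrite ip0l sD; apply: og; by exists v.
  suff /eqP : b - g = 0 by rewrite subr_eq0 => /eqP ->.
  rewrite -(sN _ Nbg) fproj_orth0// => e es; rewrite ipBl bs// sub0r.
  have [y yR yg] := in_closure_seq gR.
  rewrite (vcvg_ip_eq (z := 0) yg) ?oppr0// => n; have [v _ <-] := yR n.
  by rewrite sD (Ns e es) ip0r.
have [k [g [hk hg]]] := cpt_subseq cV (fproj_linear ip s) (c := 1)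
  (fun f => le_trans (bessel f ps) (eq_ind _ (fun t => nrm f <= t) (lexx _) _ (esym (mul1r _))))
  (cpt_fproj ip s) uC.
have cb : vcauchy ip (fun n => u (k n) - fproj ip s (u (k n))).
  move=> eps e0; have [|N hN] := cau (eps * (2 * x)); first by rewrite mulr_gt0.
  exists N => m n hm hn.
  have kge i : (i <= k i)%N.
    by elim: i => // i IH; exact: leq_ltn_trans IH (hk _ _ (ltnSn i)).
  have Df v : pencil G w (v - fproj ip s v) = pencil G w v.
    rewrite (linB lD); have := subspace_fproj ip v (kernel_subspace w) Ns.
    by move=> /= ->; rewrite subr0.
  rewrite -(ltr_pM2l x20); apply: le_lt_trans (lowN _ _) _.
    by move=> e es; rewrite ipBl !ip_sub_fproj// subrr.
  by rewrite (linB lD) !Df mulrC; apply: hN; exact: leq_trans (kge _).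
have [g' hg'] := cV cb; exists k, (g' + g); split=> //.
by apply: vcvg_ext (vcvgD hg' hg) => n /=; rewrite subrK.
Qed.

Lemma not_essential_fredholm z : ~ essential_spectrum ip T z -> fredholm ip G (z + a%:C%C).
Proof.
set w := z + _ => ne.
have [rz|sz] := pselect (resolvent_set ip T z).
  by apply: (fredholm_invertible cV lG); apply/resolvent_setP.
have [_ [e e0 iso] [f0 f00 /eigenspaceP ff0] fin] : discrete_spectrum ip T z.
  by apply: contrapT => nd; apply: ne; split.
apply: (isolated_fredholm (rho := e)) => //.
- by apply: contraNneq f00 => w0; move: ff0; rewrite -/w w0 /pencil scale0r subr0 => ->.
- exact/conj_shift/spectrum_real.
- move=> v vw ve; have -> : v = (v - a%:C%C) + a%:C%C by rewrite subrK.
  apply/resolvent_setP; apply: contrapT => sv; move/eqP: vw; apply.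
  rewrite -[v](subrK a%:C%C) (iso _ sv)// normc_def ltcR.
  have -> : v - a%:C%C - z = v - w by rewrite /w opprD addrA addrAC.
  by case: (v - w) ve.
- move=> x Nx; apply: finite_dimensional_no_orthonormal_seq fin _ => n.
  exact/eigenspaceP.
Qed.

End essential_spectrum.

Lemma essential_spectrum_cpt_perturbation (R : realType) (V : lmodType R[i])
    (ip : {dot V for Num.conj}) (T T' : operator V) (a M M' : R) (G G' : V -> V) :
  complete_ip ip -> linear G -> sym_op ip G -> bounded_by ip M G -> resolvent_at T a G ->
  linear G' -> sym_op ip G' -> bounded_by ip M' G' -> resolvent_at T' a G' ->
  cpt ip (fun f => G' f - G f) -> essential_spectrum ip T' = essential_spectrum ip T.
Proof.
move=> cV lG sG bG rT lG' sG' bG' rT' cK.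
have bK : bounded_by ip (M' + M) (fun f => G' f - G f).
  by move=> f; apply: le_trans (nrmB _ _ _) _; rewrite mulrDl lerD ?bG ?bG'.
have sw f : hnorm ip (G f - G' f) = hnorm ip (G' f - G f) by rewrite nrm_distC.
have cK' : cpt ip (fun f => G f - G' f).
  by apply: (cpt_bounded_by_comp (c := 1) cK) => f; rewrite mul1r sw.
have bK' : bounded_by ip (M' + M) (fun f => G f - G' f) by move=> f; rewrite sw bK.
apply/seteqP; split => z ez; apply: contrapT => nez.
  have F := not_essential_fredholm cV lG sG bG rT nez.
  have := fredholm_not_essential cV lG' sG' bG' rT' (fredholm_cpt_perturbation cV lG lG' bK cK F).
  exact.
have F := not_essential_fredholm cV lG' sG' bG' rT' nez.
have := fredholm_not_essential cV lG sG bG rT (fredholm_cpt_perturbation cV lG' lG bK' cK' F).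
exact.
Qed.

(** * Square integrable sections *)

Section measurable_frames.
Context dX (X : measurableType dX) (R : realType) (r : nat) (E : hbundle X R r).
Local Notation msec := (measurable_section (@bundle_meas _ _ _ _ E)).
Implicit Types (f g h s : sections E) (b : seq (sections E)).

Lemma measurable_section_scaleD (c : X -> R[i]) f g : Cmeasurable_fun setT c ->
  msec f -> msec g -> msec (fun x => c x *: f x + g x).
Proof.
move=> [cr ci] mf mg; have [U [UT chU]] := hb_cg E.
have /choice[phi H] := chU; have /choice[psi ch] := H.
apply: (coord_section UT ch) => n i j.
have mV h : msec h -> Cmeasurable_fun (U n) (fun x => phi n x (h x) i j).
  by move=> mh; exact: (chart_coord (ch n) mh).
have mc : Cmeasurable_fun (U n) c by split; exact: measurable_funTS.
have := CmeasurableD (CmeasurableM mc (mV _ mf)) (mV _ mg).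
have E1 x : U n x -> c x * phi n x (f x) i j + phi n x (g x) i j =
    phi n x (c x *: f x + g x) i j.
  by move=> Ux; rewrite (chart_linear (ch n) Ux) !mxE.
by move=> [mr mi]; split; [apply: eq_measurable_fun mr|apply: eq_measurable_fun mi] => x /set_mem Ux;
  rewrite E1.
Qed.

Lemma eq_measurable_section f g : (forall x, f x = g x) -> msec f -> msec g.
Proof. by move=> fg; rewrite (functional_extensionality_dep fg). Qed.

Lemma measurable_section_scale (c : X -> R[i]) f : Cmeasurable_fun setT c ->
  msec f -> msec (fun x => c x *: f x).
Proof.
move=> mc mf; apply: eq_measurable_section (measurable_section_scaleD mc mf
  (@measurable_section0 _ _ _ _ E)) => x.
by rewrite addr0.
Qed.

Lemma measurable_sectionB f g : msec f -> msec g -> msec (fun x => f x - g x).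
Proof.
move=> mf mg.
apply: eq_measurable_section (measurable_section_scaleD (Cmeasurable_cst setT (-1)) mg mf) => x.
by rewrite scaleN1r addrC.
Qed.

Lemma fnormE x (v : E x) : fnorm v = hnorm (herm E x) v. Proof. by []. Qed.

Lemma measurable_fnorm f : msec f -> measurable_fun setT (fun x => fnorm (f x)).
Proof.
move=> mf; apply: (@measurableT_comp _ _ _ _ _ _ (@Num.sqrt R)).
  by apply: continuous_measurable_fun => x; exact: sqrt_continuous.
exact: measurable_sqfnorm.
Qed.

Lemma measurable_inv_ge0 (g : X -> R) : measurable_fun setT g -> (forall x, 0 <= g x) ->
  measurable_fun setT (fun x => (g x)^-1).
Proof.
move=> mg g0; under eq_fun do rewrite -powR_inv1//.
by apply: (@measurableT_comp _ _ _ _ _ _ (fun y : R => y `^ (-1))) => //; exact: measurable_powR.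
Qed.

Lemma measurable_fproj b f : (forall s, s \in b -> msec s) -> msec f ->
  msec (fun x => fproj (herm E x) [seq s x | s <- b] (f x)).
Proof.
elim: b => [|s b IH] mb mf.
  apply: eq_measurable_section (@measurable_section0 _ _ _ _ E) => x.
  by rewrite /fproj big_nil.
apply: eq_measurable_section (@measurable_section_scaleD (fun x => herm E x (f x) (s x)) s
  (fun x => fproj (herm E x) [seq t x | t <- b] (f x)) _ _ _).
- by move=> x; rewrite /fproj /= big_cons.
- by apply: herm_meas => //; apply: mb; rewrite mem_head.
- by apply: mb; rewrite mem_head.
- by apply: IH => // t tb; apply: mb; rewrite in_cons tb orbT.
Qed.

Lemma measurable_gram_schmidt b : (forall s, s \in b -> msec s) ->
  exists b' : seq (sections E), (forall s, s \in b' -> msec s) /\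
    forall x, [seq s x | s <- b'] = gram_schmidt (herm E x) [seq s x | s <- b].
Proof.
elim: b => [|s b IH] mb; first by exists [::].
have [|b' [mb' hb']] := IH; first by move=> t tb; apply: mb; rewrite in_cons tb orbT.
have ms : msec s by apply: mb; rewrite mem_head.
pose rr : sections E := fun x => s x - fproj (herm E x) [seq t x | t <- b'] (s x).
have mrr : msec rr by apply: measurable_sectionB => //; exact: measurable_fproj.
pose e : sections E := fun x => (fnorm (rr x))^-1%:C%C *: rr x.
exists (e :: b'); split.
  move=> t; rewrite in_cons => /orP[/eqP->|/mb'//].
  apply: measurable_section_scale => //; split; last exact: measurable_cst.
  apply: measurable_inv_ge0; first exact: measurable_fnorm.
  by move=> x; exact: nrm_ge0.
by move=> x /=; rewrite hb' /e /rr hb'.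
Qed.

(* The vectors of the frame may vanish, so that no linear independence is needed. *)
Lemma exists_parseval_frame : exists b : seq (sections E),
  (forall s, s \in b -> msec s) /\
  forall x, pons (herm E x) [seq s x | s <- b] /\
    forall v : E x, fproj (herm E x) [seq s x | s <- b] v = v.
Proof.
have [U [UT chU]] := hb_cg E.
have /choice[phi H] := chU; have /choice[psi ch] := H.
(* On disjoint pieces the index [n x] of the chart used at x is unique, so the measurability of the
   glued sections is checked on each piece. *)
pose W := seqDU U.
have mU n : measurable (U n) := chart_dom (ch n).
have mW n : measurable (W n) by exact: seqDU_measurable.
have WU n x : W n x -> U n x by case.
have /choice[n hn] x : exists n, W n x.
  have : (\bigcup_n W n) x by rewrite -seqDU_bigcup_eq UT.
  by move=> [n _ Wx]; exists n.
have Wn m x : W m x -> n x = m.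
  move=> Wm; apply: contrapT => /eqP nm.
  have := @trivIset_seqDU _ U; move=> /trivIsetP/(_ _ _ I I nm) E0.
  by have : (W (n x) `&` W m) x by []; rewrite E0.
pose s (j : 'I_r) : sections E := fun x => psi (n x) x (delta_mx j 0).
have ms j : msec (s j).
  move=> A mA; rewrite (_ : [set x | _] = \bigcup_m (W m `&`
      [set x | U m x /\ A (existT _ x (psi m x (delta_mx j 0)))])); last first.
    apply/seteqP; split => [x /= Ax|x [m _ [Wx [_ Ax]]]].
      by exists (n x) => //; split; [exact: hn|split => //; apply: WU; exact: hn].
    by rewrite /= /s (Wn _ _ Wx).
  apply: bigcupT_measurable => m; apply: measurableI => //.
  have mp : measurable_fun setT (fun x : X => (x, delta_mx j 0 : cmatrix R r 1)).
    by apply: measurable_fun_pairD => //; exact: measurable_cst.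
  have := mp measurableT _ (chartV_meas (ch m) mA).
  by rewrite setTI; congr measurable; apply/seteqP; split => x.
have [|b [mb hb]] := @measurable_gram_schmidt [seq s j | j <- enum 'I_r].
  by move=> _ /mapP[j _ ->].
exists b; split=> // x; rewrite hb; split; first exact: pons_gram_schmidt.
move=> v; set t := gram_schmidt _ _.
have ts j : fproj (herm E x) t (s j x) = s j x.
  by apply: fproj_gram_schmidt; rewrite -map_comp; apply/mapP; exists j; rewrite ?mem_enum.
have Ux : U (n x) x by apply: WU; exact: hn.
have lpsi : linear (psi (n x) x).
  move=> a u w; apply: (can_inj (chartK (ch (n x)) Ux)).
  by rewrite (chart_linear (ch (n x)) Ux) !(chartVK (ch (n x)) Ux).
have -> : v = \sum_j phi (n x) x v j 0 *: s j x.
  rewrite -[LHS](chartK (ch (n x)) Ux) {1}[phi _ _ v]matrix_sum_delta.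
  under eq_bigr do rewrite big_ord1.
  elim/big_rec2: _ => [|j y z _ <-]; first by have := lpsi (-1) 0 0; rewrite scaler0 addr0 scaleN1r addNr.
  by rewrite lpsi.
elim/big_ind: _ => [|u w hu hw|i _].
- by rewrite (lin0 (fproj_linear _ _)).
- by rewrite (linD _ _ (fproj_linear _ _)) hu hw.
- by rewrite (linZ _ _ (fproj_linear _ _)) ts.
Qed.

End measurable_frames.

(** * Completeness of the space of square integrable sections *)

Section L2_space.
Context dX (X : measurableType dX) (R : realType).
Context (mu : {measure set X -> \bar R}) (r : nat) (E : hbundle X R r).
Local Notation msec := (measurable_section (@bundle_meas _ _ _ _ E)).
Local Notation sqint := (@sqint _ X R mu r E).
Local Notation ip := (L2dot mu E).
Local Notation nrm := (hnorm ip).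
Implicit Types (f g : L2 mu E) (s : sections E).

Lemma sqintP s : sqint s <-> msec s /\ (\int[mu]_x (sqfnorm (s x))%:E < +oo)%E.
Proof. by split=> [/asboolP//|h]; apply/asboolP. Qed.

(* The class of s, or 0 when s is not square integrable. *)
Definition L2of s : L2 mu E :=
  if pselect (sqint s) is left h then \pi_(L2 mu E)%qT (exist sqint s h) else 0.

Lemma L2ofE s : sqint s -> {ae mu, forall x, L2rep (L2of s) x = s x}.
Proof.
move=> hs; rewrite /L2of; case: pselect => // h.
exact: (L2rep_pi (exist _ s h : L2pre mu E)).
Qed.

Lemma L2repB f g : {ae mu, forall x, L2rep (f - g) x = L2rep f x - L2rep g x}.
Proof.
have := L2rep_linear (-1) g f; rewrite scaleN1r addrC.
by apply: filterS => x ->; rewrite scaleN1r addrC.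
Qed.

Lemma sqfnormE x (v : E x) : sqfnorm v = hnorm (herm E x) v ^+ 2.
Proof. by rewrite nrm_sqr. Qed.

Lemma measurable_esqfnorm s : msec s -> measurable_fun setT (fun x => (sqfnorm (s x))%:E).
Proof. by move=> ms; apply/measurable_EFinP; exact: measurable_sqfnorm. Qed.

Lemma nrm_L2rep f : (nrm f ^+ 2)%:E = (\int[mu]_x (sqfnorm (L2rep f x))%:E)%E.
Proof.
rewrite nrm_sqr /rip /L2dot /= /L2ip /Cintegral /= /Rintegral fineK//.
apply: integrable_fin_num => //; exact: sqint_integrable (L2rep_sqint f).
Qed.

Lemma nrm_L2_ae f s : msec s -> {ae mu, forall x, L2rep f x = s x} ->
  (nrm f ^+ 2)%:E = (\int[mu]_x (sqfnorm (s x))%:E)%E.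
Proof.
move=> ms fs; rewrite nrm_L2rep; apply: ge0_ae_eq_integral => //.
- exact/measurable_esqfnorm/L2rep_meas.
- exact: measurable_esqfnorm.
- by move=> x _; rewrite lee_fin sqfnorm_ge0.
- by move=> x _; rewrite lee_fin sqfnorm_ge0.
- by apply: filterS fs => x -> _.
Qed.

Lemma sqint_ae_le s (c : R) f : msec s ->
  {ae mu, forall x, sqfnorm (s x) <= c * sqfnorm (L2rep f x)} -> sqint s.
Proof.
move=> ms h; apply/sqintP; split=> //.
have cf : (\int[mu]_x (`|c| * sqfnorm (L2rep f x))%:E = (`|c| * nrm f ^+ 2)%:E)%E.
  under eq_integral do rewrite EFinM.
  rewrite ge0_integralZl//; first by rewrite -nrm_L2rep.
  - exact/measurable_esqfnorm/L2rep_meas.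
  - by move=> x _; rewrite lee_fin sqfnorm_ge0.
apply: le_lt_trans (ltry (`|c| * nrm f ^+ 2)); rewrite -cf.
apply: ae_ge0_le_integral => //.
- by move=> x _; rewrite lee_fin sqfnorm_ge0.
- exact: measurable_esqfnorm.
- by move=> x _; rewrite lee_fin mulr_ge0// sqfnorm_ge0.
- apply/measurable_EFinP; apply: measurable_funM => //.
  exact/measurable_sqfnorm/L2rep_meas.
- apply: filterS h => x h _; rewrite lee_fin; apply: le_trans h _.
  by rewrite ler_wpM2r ?sqfnorm_ge0// ler_norm.
Qed.

Lemma cvgn_of_geometric_steps (y : nat -> R) (K : R) :
  (forall n, `|y n.+1 - y n| <= K * 2^-1 ^+ n) -> cvgn y.
Proof.
move=> h; pose u n := y n.+1 - y n.
have cu : cvgn (series u).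
  apply: normed_cvg; apply: (@series_le_cvg _ _ (geometric K 2^-1)).
  - by move=> n; exact: normr_ge0.
  - by move=> n; exact: le_trans (normr_ge0 _) (h n).
  - exact: h.
  - apply: is_cvg_geometric_series; rewrite ger0_norm ?invr_ge0//.
    by rewrite invf_lt1// ltr1n.
have -> : y = (fun n => series u n + y 0%N).
  by apply/funext => n; rewrite /u seriesEnat /= telescope_sumr// subrK.
exact: is_cvgD cu (is_cvg_cst _).
Qed.

(** Riesz-Fischer. As the fibre varies with the point, pointwise limits are taken of coordinates in
    a measurable Parseval frame and then reassembled. *)
Theorem L2_complete : complete_ip ip.
Proof.
move=> x cx; have [b [mb hb]] := exists_parseval_frame E.
(* With steps of squared norm at most 8^-n, the functions 4^n |d n|^2 have integrals at most 2^-n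
   and an almost everywhere finite sum; hence the steps decay pointwise like 2^-n. *)
pose e (n : nat) : R := 8^-1 ^+ n.
have e0 n : 0 < e n by rewrite exprn_gt0// invr_gt0.
have /choice[N hN] n : exists N, forall i j, (N <= i)%N -> (N <= j)%N ->
    nrm (x i - x j) ^+ 2 < e n.
  have [|N hN] := cx (Num.sqrt (e n)); first by rewrite sqrtr_gt0.
  exists N => i j hi hj; rewrite -[e n]sqr_sqrtr ?(ltW (e0 n))//.
  by rewrite ltr_sqr ?nnegrE ?nrm_ge0 ?sqrtr_ge0//; exact: hN.
(* Summing makes [k m] at least [N n] for every n <= m. *)
pose k n := (\sum_(i < n.+1) N i)%N.
have kN m n : (n <= m)%N -> (N n <= k m)%N.
  by move=> nm; rewrite /k (bigD1 (inord n)) //= inordK ?leq_addr.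
pose y n := L2rep (x (k n)).
pose d n : sections E := fun t => y n.+1 t - y n t.
have my n : msec (y n) by exact: L2rep_meas.
have md n : msec (d n) by exact: measurable_sectionB.
have intd n : (\int[mu]_t (sqfnorm (d n t))%:E <= (e n)%:E)%E.
  rewrite -(nrm_L2_ae (md n) (L2repB _ _)) lee_fin ltW// hN// kN//.
have ae_sum : {ae mu, forall t, exists C : R, forall n, 4 ^+ n * sqfnorm (d n t) <= C}.
  pose F n t := (4 ^+ n * sqfnorm (d n t))%:E.
  have F0 n t : (0 <= F n t)%E by rewrite lee_fin mulr_ge0 ?exprn_ge0 ?sqfnorm_ge0.
  have mF n : measurable_fun setT (F n).
    by apply/measurable_EFinP; apply: measurable_funM => //; exact: measurable_sqfnorm.
  have IF n : (\int[mu]_t F n t <= (2 / (2 ^ (n + 1))%:R)%:E)%E.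
    rewrite /F; under eq_integral do rewrite EFinM.
    rewrite ge0_integralZl//.
    - apply: (@le_trans _ _ ((4 ^+ n)%:E * (e n)%:E)%E).
        by apply: lee_wpmul2l; rewrite ?lee_fin ?exprn_ge0.
      rewrite -EFinM lee_fin /e -exprMn.
      have -> : 4 * 8^-1 = 2^-1 :> R by lra.
      by rewrite natrX addn1 exprS invfM mulrA divff ?mul1r ?exprVn.
    - exact: measurable_esqfnorm.
    - by move=> t _; rewrite lee_fin sqfnorm_ge0.
  have intF : mu.-integrable setT (fun t => \sum_(0 <= n <oo) F n t)%E.
    apply/integrableP; split; first exact: ge0_emeasurable_sum.
    under eq_integral do rewrite gee0_abs ?nneseries_ge0//.
    rewrite integral_nneseries//; apply: le_lt_trans (lee_nneseries _ _) _.
    - by move=> n _ _; exact: integral_ge0.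
    - by move=> n _; exact: IF.
    - rewrite (cvg_lim _ (@cvg_geometric_eseries_half R 2 0))//; exact: ltry.
  apply: filterS (integrable_ae measurableT intF) => t /(_ I) Ft.
  exists (fine (\sum_(0 <= n <oo) F n t)%E) => n.
  rewrite -lee_fin fineK//; apply: le_trans (nneseries_lim_ge n.+1 _) => //.
  by rewrite big_nat_recr//= leeDr// sume_ge0.
pose c (s : sections E) n t := herm E t (y n t) (s t).
have cstep : {ae mu, forall t, exists C : R, forall s n, s \in b ->
    normc (c s n.+1 t - c s n t) <= C * 2^-1 ^+ n}.
  apply: filterS ae_sum => t [C hC]; exists (Num.sqrt C) => s n sb.
  rewrite /c -ipBl; apply: le_trans (ip_CS _ _ _) _.
  have [ps _] := hb t; have s1 : hnorm (herm E t) (s t) <= 1.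
    by apply: (pons_le1 ps); exact: map_f.
  apply: (@le_trans _ _ (hnorm (herm E t) (d n t))).
    by rewrite -[leRHS]mulr1 ler_wpM2l ?nrm_ge0.
  rewrite -ler_sqr ?nnegrE ?nrm_ge0 ?mulr_ge0 ?sqrtr_ge0 ?exprn_ge0 ?invr_ge0//.
  have C0 : 0 <= C by apply: le_trans (hC 0%N); rewrite mulr_ge0 ?exprn_ge0 ?sqfnorm_ge0.
  rewrite -sqfnormE exprMn sqr_sqrtr// -exprM mulnC exprM !exprVn ler_pdivlMr ?exprn_gt0//.
  have -> : 2 ^+ 2 = 4 :> R by rewrite expr2; lra.
  by rewrite mulrC.
(* Upper limits are measurable without any convergence, and almost everywhere they are the
   limits. *)
pose lre s t := fine (limn_esup (fun n => (complex.Re (c s n t))%:E)).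
pose lim_ s t := fine (limn_esup (fun n => (complex.Im (c s n t))%:E)).
pose lc s t : R[i] := Complex (lre s t) (lim_ s t).
have mc s n : s \in b -> Cmeasurable_fun setT (c s n).
  by move=> sb; apply: herm_meas => //; exact: mb.
have mlc s : s \in b -> Cmeasurable_fun setT (lc s).
  move=> sb; split.
    apply: (measurableT_comp (fine_measurable measurableT)).
    by apply: measurable_fun_limn_esup => n; apply/measurable_EFinP; have [] := mc s n sb.
  apply: (measurableT_comp (fine_measurable measurableT)).
  by apply: measurable_fun_limn_esup => n; apply/measurable_EFinP; have [] := mc s n sb.
pose f0 : sections E := fun t => \sum_(s <- b) lc s t *: s t.
have mf0 : msec f0.
  rewrite /f0; elim: (b) mb mlc => [|s b' IH] mb mlc.
    apply: eq_measurable_section (@measurable_section0 _ _ _ _ E) => t.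
    by rewrite big_nil.
  apply: eq_measurable_section (@measurable_section_scaleD _ _ _ _ _ (lc s) s
    (fun t => \sum_(s <- b') lc s t *: s t) _ _ _) => [t||| ].
  - by rewrite big_cons.
  - by apply: mlc; rewrite mem_head.
  - by apply: mb; rewrite mem_head.
  - by apply: IH => s' hs'; [apply: mb|apply: mlc]; rewrite in_cons hs' orbT.
have ycvg : {ae mu, forall t, hnorm (herm E t) (y n t - f0 t) @[n --> \oo] --> (0 : R)}.
  apply: filterS cstep => t [C hC].
  have cc s : s \in b -> complex.Re (c s n t) @[n --> \oo] --> lre s t /\
      complex.Im (c s n t) @[n --> \oo] --> lim_ s t.
    move=> sb.
    have lim_of (g : nat -> R) : cvgn g -> g @ \oo --> fine (limn_esup (fun n => (g n)%:E)).
      move=> cg; have cE : (g n)%:E @[n --> \oo] --> (limn g)%:E by apply: cvg_EFin => //; exact: nearW.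
      by rewrite (cvg_limn_einf_sup cE).2.
    split; apply: lim_of; apply: (@cvgn_of_geometric_steps _ C) => n.
      rewrite -raddfB; exact: le_trans (Re_le_normc _) (hC s n sb).
    rewrite -raddfB; exact: le_trans (Im_le_normc _) (hC s n sb).
  have le n : hnorm (herm E t) (y n t - f0 t) <= \sum_(s <- b)
      (`|complex.Re (c s n t) - lre s t| + `|complex.Im (c s n t) - lim_ s t|).
    have [ps hp] := hb t; rewrite -{1}(hp (y n t)) /fproj big_map /f0 -sumrB.
    apply: le_trans (nrm_sum _ _ _) _; rewrite big_seq [leRHS]big_seq; apply: ler_sum => s sb.
    rewrite -scalerBl nrmZ -[leRHS]mulr1; apply: ler_pM; rewrite ?normc_ge0 ?nrm_ge0//.
      apply: le_trans (normc_le_ReIm _) _; rewrite !raddfB /=; exact: lexx.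
    by apply: (pons_le1 ps); exact: map_f.
  refine (@squeeze_cvgr _ _ _ _ (cst 0) (fun n => \sum_(s <- b)
      (`|complex.Re (c s n t) - lre s t| + `|complex.Im (c s n t) - lim_ s t|)) _ _ 0 _ _).
  - by apply: nearW => n; rewrite nrm_ge0 le.
  - exact: cvg_cst.
  - elim: (b) cc => [|s b' IH] cc.
      under eq_fun do rewrite big_nil; exact: cvg_cst.
    under eq_fun do rewrite big_cons.
    have [c1 c2] := cc s (mem_head _ _).
    have abs0 (g : nat -> R) l : g n @[n --> \oo] --> l -> `|g n - l| @[n --> \oo] --> (0 : R).
      by move=> gl; apply/norm_cvg0P/subr_cvg0.
    have hb' s' : s' \in b' -> s' \in s :: b' by rewrite in_cons => ->; rewrite orbT.
    have := cvgD (cvgD (abs0 _ _ c1) (abs0 _ _ c2)) (IH (fun s' h => cc s' (hb' s' h))).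
    by rewrite !addr0 => h; exact: h.
(* Fatou's lemma gives both the square integrability of [f0] and the rate of convergence. *)
have fatou_le j : (\int[mu]_t (sqfnorm (y j t - f0 t))%:E <= (e j)%:E)%E.
  pose g n t := (sqfnorm (y j t - y (n + j)%N t))%:E.
  have mg n : measurable_fun setT (g n).
    by apply: measurable_esqfnorm; exact: measurable_sectionB.
  have g0 n t : (0 <= g n t)%E by rewrite lee_fin sqfnorm_ge0.
  have -> : (\int[mu]_t (sqfnorm (y j t - f0 t))%:E = \int[mu]_t limn_einf (g^~ t))%E.
    apply: ge0_ae_eq_integral => //.
    - by apply: measurable_esqfnorm; exact: measurable_sectionB.
    - under eq_fun do rewrite -[limn_einf _]oppeK -limn_esupN.
      apply: measurableT_comp => //; apply: measurable_fun_limn_esup => n.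
      exact: measurableT_comp.
    - by move=> t _; rewrite lee_fin sqfnorm_ge0.
    - move=> t _; rewrite limn_einf_lim; apply: lime_ge; first exact: is_cvg_einfs.
      by apply: nearW => n; apply: le_ereal_inf_tmp => _ [m _ <-]; exact: g0.
    apply: filterS ycvg => t yt _; apply/esym/(cvg_limn_einf_sup _).1.
    suff h : hnorm (herm E t) (y j t - y (n + j)%N t) @[n --> \oo] -->
        hnorm (herm E t) (y j t - f0 t).
      apply: cvg_EFin; first exact: nearW.
      have h2 : sqfnorm (y j t - y (n + j)%N t) @[n --> \oo] --> sqfnorm (y j t - f0 t).
        under eq_fun do rewrite sqfnormE expr2; rewrite sqfnormE expr2.
        exact: cvgM.
      exact: h2.
    set l := hnorm _ (y j t - f0 t).
    have yt' : hnorm (herm E t) (y (n + j)%N t - f0 t) @[n --> \oo] --> (0 : R).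
      by have := yt; rewrite -(cvg_shiftn j).
    refine (@squeeze_cvgr _ _ _ _ (fun n => l - hnorm (herm E t) (y (n + j)%N t - f0 t))
       (fun n => l + hnorm (herm E t) (y (n + j)%N t - f0 t)) _ _ l _ _).
    - apply: nearW => n; rewrite lerBlDr {1}/l nrm_dist_tri /=.
      by rewrite (nrm_distC _ (y (n + j)%N t)) nrm_dist_tri.
    - rewrite -[X in _ --> X](subr0 l); apply: cvgB => //; exact: cvg_cst.
    - rewrite -[X in _ --> X](addr0 l); apply: cvgD => //; exact: cvg_cst.
  apply: le_trans (fatou mu measurableT mg (fun n t _ => g0 n t)) _.
  rewrite limn_einf_lim; apply: lime_le; first exact: is_cvg_einfs.
  apply: nearW => n; apply: le_trans (_ : (\int[mu]_t g n t <= _)%E).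
    by apply: ereal_inf_lbound; exists n => /=.
  have ms : msec (fun t => y j t - y (n + j)%N t) by exact: measurable_sectionB.
  rewrite /g -(nrm_L2_ae ms (L2repB _ _)) lee_fin ltW// hN// kN//.
  by rewrite leq_addl.
have sq0 : sqint (fun t => y 0%N t - f0 t).
  apply/sqintP; split; first exact: measurable_sectionB.
  exact: le_lt_trans (fatou_le 0%N) (ltry _).
have sqf : sqint f0.
  have [_ scl] := @sqint_submod_closed _ X R mu r E.
  have := scl (-1) _ _ sq0 (L2rep_sqint (x (k 0%N))).
  congr (sqint _); apply: functional_extensionality_dep => t.
  rewrite -[LHS]/(-1 *: (y 0%N t - f0 t) + y 0%N t).
  by rewrite scaleN1r opprB subrK.
exists (L2of f0) => eps eps0.
have dist j : nrm (x (k j) - L2of f0) ^+ 2 <= e j.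
  rewrite -lee_fin; have ms : msec (fun t => y j t - f0 t) by exact: measurable_sectionB.
  rewrite (nrm_L2_ae ms) ?fatou_le//.
  apply: filterS2 (L2repB (x (k j)) (L2of f0)) (L2ofE sqf) => t -> ->.
  by [].
have [j hj] : exists j, e j < (eps / 2) ^+ 2.
  have : e @ \oo --> (0 : R) by apply: cvg_expr; rewrite ger0_norm ?invr_ge0// invf_lt1// ltr1n.
  move=> /cvgr0_norm_lt /(_ _ (exprn_gt0 2 (divr_gt0 eps0 (ltr0n R 2)))) [j _ /(_ j (leqnn j))].
  by rewrite /= gtr0_norm// => h; exists j.
have e2 : 0 < eps / 2 by rewrite divr_gt0.
exists (N j) => i hi; apply: le_lt_trans (nrm_dist_tri _ _ (x (k j)) _) _.
rewrite (splitr eps); apply: ltrD.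
  rewrite -ltr_sqr ?nnegrE ?nrm_ge0 ?(ltW e2)//; apply: lt_trans hj.
  by apply: hN => //; exact: kN.
rewrite -ltr_sqr ?nnegrE ?nrm_ge0 ?(ltW e2)//; exact: le_lt_trans (dist j) hj.
Qed.

End L2_space.

(** * Multiplication operators on sections *)

Section multiplication_operators.
Context dX (X : measurableType dX) (R : realType).
Context (mu : {measure set X -> \bar R}) (r : nat) (E : hbundle X R r).
Local Notation msec := (measurable_section (@bundle_meas _ _ _ _ E)).
Local Notation sqint := (@sqint _ X R mu r E).
Local Notation ip := (L2dot mu E).
Local Notation nrm := (hnorm ip).
Implicit Types (f g h : L2 mu E) (s t : sections E).

Lemma ip_L2_ae f g s t : msec s -> msec t -> {ae mu, forall x, L2rep f x = s x} ->
  {ae mu, forall x, L2rep g x = t x} -> ip f g = Cintegral mu (fun x => herm E x (s x) (t x)).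
Proof.
move=> ms mt fs gt; apply: ae_eq_Cintegral.
- by apply: herm_meas; exact: L2rep_meas.
- exact: herm_meas.
- by apply: filterS2 fs gt => x -> ->.
Qed.

Section scalar.
Variables (phi : X -> R) (C : R).
Hypotheses (mphi : measurable_fun setT phi) (bphi : forall x, `|phi x| <= C).

Definition smul f : L2 mu E := L2of mu (fun x => (phi x)%:C%C *: L2rep f x).

Lemma Cmeasurable_real (u : X -> R) : measurable_fun setT u ->
  Cmeasurable_fun setT (fun x => (u x)%:C%C).
Proof. by move=> mu'; split => //; exact: measurable_cst. Qed.

Lemma measurable_smul_section s : msec s -> msec (fun x => (phi x)%:C%C *: s x).
Proof. by apply: measurable_section_scale; exact: Cmeasurable_real. Qed.

Lemma sqfnormZR x (y : R) (v : E x) : sqfnorm (y%:C%C *: v) = y ^+ 2 * sqfnorm v.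
Proof. by rewrite sqfnormZ /= expr0n addr0. Qed.

Lemma smulE f : {ae mu, forall x, L2rep (smul f) x = (phi x)%:C%C *: L2rep f x}.
Proof.
apply: L2ofE; apply: (@sqint_ae_le _ _ _ _ _ _ _ (C ^+ 2) f).
  exact/measurable_smul_section/L2rep_meas.
apply: aeW => x; rewrite sqfnormZR ler_wpM2r ?sqfnorm_ge0//.
by rewrite -[phi x ^+ 2]real_normK ?num_real// ler_sqr ?nnegrE// (le_trans _ (bphi x)).
Qed.

Lemma nrm_smul f :
  (nrm (smul f) ^+ 2)%:E = (\int[mu]_x (phi x ^+ 2 * sqfnorm (L2rep f x))%:E)%E.
Proof.
rewrite (nrm_L2_ae (measurable_smul_section (L2rep_meas f)) (smulE f)).
by apply: eq_integral => x _; rewrite sqfnormZR.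
Qed.

Lemma smul_linear : linear smul.
Proof.
move=> a f g; apply: L2_ext; have h1 := smulE (a *: f + g); have h2 := L2rep_linear a f g.
have h3 := L2rep_linear a (smul f) (smul g).
apply: (filterS _ (filterI (filterI h1 h2) (filterI h3 (filterI (smulE f) (smulE g))))).
move=> x [[-> ->] [-> [-> ->]]].
by rewrite scalerDr !scalerA [a * _]mulrC.
Qed.

Lemma smul_sym : sym_op ip smul.
Proof.
move=> f g; have [mf mg] := (L2rep_meas f, L2rep_meas g).
rewrite (ip_L2_ae (measurable_smul_section mf) mg (smulE f) (aeW _ _)) //.
rewrite (ip_L2_ae mf (measurable_smul_section mg) (aeW _ _) (smulE g)) //.
by congr Cintegral; apply/funext => x; rewrite linearZl_LR linearZr_LR /= conjcR.
Qed.

Lemma smul_bounded : 0 <= C -> bounded_by ip C smul.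
Proof.
move=> C0 f; rewrite -ler_sqr ?nnegrE ?mulr_ge0 ?nrm_ge0// exprMn -lee_fin nrm_smul EFinM nrm_L2rep.
rewrite -ge0_integralZl//; last 3 first.
- exact/measurable_esqfnorm/L2rep_meas.
- by move=> x _; rewrite lee_fin sqfnorm_ge0.
- by rewrite lee_fin sqr_ge0.
apply: ge0_le_integral => //.
- by move=> x _; rewrite lee_fin mulr_ge0 ?sqr_ge0 ?sqfnorm_ge0.
- apply/measurable_EFinP/measurable_funM; last exact/measurable_sqfnorm/L2rep_meas.
  exact: measurable_funX.
- apply: measurable_funeM; exact/measurable_esqfnorm/L2rep_meas.
- move=> x _; rewrite -EFinM lee_fin ler_wpM2r ?sqfnorm_ge0//.
  by rewrite -[phi x ^+ 2]real_normK ?num_real// ler_sqr ?nnegrE.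
Qed.

End scalar.

Section endomorphism.
Variable W : forall x, {linear E x -> E x}.

Lemma End_linear x : linear (W x).
Proof. by move=> a u v; exact: linearP. Qed.

(** The supremum is meaningful once its set is bounded; the images of the finitely many frame
    vectors bound it. *)
Lemma fopnorm_ge0_le x : 0 <= fopnorm (W x) /\
  forall v : E x, fnorm (W x v) <= fopnorm (W x) * fnorm v.
Proof.
have [b [_ hb]] := exists_parseval_frame E; have [ps hp] := hb x.
set l := [seq _ | _ <- b] in ps hp.
pose K := \sum_(e <- l) fnorm (W x e).
have WK v : fnorm (W x v) <= K * fnorm v.
  rewrite -{1}(hp v) /fproj (lin_sum _ _ (@End_linear x)) fnormE mulr_suml; apply: le_trans (nrm_sum _ _ _) _.
  rewrite big_seq [leRHS]big_seq; apply: ler_sum => e el; rewrite (linZ _ _ (@End_linear x)) nrmZ mulrC.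
  rewrite ler_wpM2l ?nrm_ge0//; apply: le_trans (ip_CS _ _ _) _.
  by rewrite -[leRHS]mulr1 ler_wpM2l ?nrm_ge0// (pons_le1 ps).
have K0 : 0 <= K by apply: sumr_ge0 => e _; exact: nrm_ge0.
set S := [set fnorm (W x v) | v in [set v | fnorm v <= 1]].
have S0 : S (fnorm (W x 0)) by exists 0 => //=; rewrite fnormE nrm0.
have Sb : has_ubound S.
  by exists K => _ [v /= v1 <-]; apply: le_trans (WK v) _; rewrite -[leRHS]mulr1 ler_wpM2l.
have ge0 : 0 <= fopnorm (W x).
  by apply: le_trans (ub_le_sup Sb S0); rewrite fnormE nrm_ge0.
split=> // v; have [v0|v0] := eqVneq (fnorm v) 0.
  by apply: le_trans (WK v) _; rewrite v0 !mulr0.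
have vp : 0 < fnorm v by rewrite lt_def v0 fnormE nrm_ge0.
rewrite -ler_pdivrMr//.
have -> : fnorm (W x v) / fnorm v = fnorm (W x ((fnorm v)^-1%:C%C *: v)).
  by rewrite (linZ _ _ (@End_linear x)) !fnormE nrmZR ger0_norm ?invr_ge0 ?nrm_ge0// mulrC.
apply: ub_le_sup => //; exists ((fnorm v)^-1%:C%C *: v) => //=.
by rewrite !fnormE nrmZR ger0_norm ?invr_ge0 ?nrm_ge0// mulVf.
Qed.

Hypothesis mW : End_section W.

(** In a chart the coordinates of W s form a matrix-vector product of measurable entries. *)
Lemma measurable_End_section s : msec s -> msec (fun x => W x (s x)).
Proof.
move=> ms; have [U [UT chU]] := hb_cg E.
have /choice[phi H] := chU; have /choice[psi ch] := H.
apply: (coord_section UT ch) => n i j.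
have mV k : Cmeasurable_fun (U n) (fun x => phi n x (s x) k 0).
  exact: (chart_coord (ch n) ms).
have mWij k : Cmeasurable_fun (U n) (fun x => End_chart (phi n) (psi n) (W x) i k).
  have gen (re : R[i] -> R) : (forall B : set R, measurable B ->
      cmatrix_gen [set v : cmatrix R r r | B (re (v i k))]) ->
      measurable_fun (U n) (fun x => re (End_chart (phi n) (psi n) (W x) i k)).
    move=> gh mU B mB; have mB' : measurable [set v : cmatrix R r r | B (re (v i k))].
      by apply: sub_sigma_algebra; exact: gh.
    pose BB : set (X * cmatrix R r r) := setT `*` [set v : cmatrix R r r | B (re (v i k))].
    have mA : End_meas [set e : {x : X & {linear E x -> E x}} |
        U n (projT1 e) /\ BB (projT1 e, End_chart (phi n) (psi n) (projT2 e))].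
      apply: sub_sigma_algebra; exists (U n), (phi n), (psi n), BB; split=> //.
      exact: measurableX.
    have := mW mA; congr measurable; apply/seteqP; split => x /=; rewrite /BB /=; tauto.
  split; apply: gen => B mB; exists i, k, B; split=> //; [by left|by right].
have big_meas (I : Type) (l : seq I) (F : I -> X -> R[i]) :
    (forall k, Cmeasurable_fun (U n) (F k)) -> Cmeasurable_fun (U n) (fun x => \sum_(k <- l) F k x).
  move=> mF; elim: l => [|k l IH].
    under eq_fun do rewrite big_nil; exact: Cmeasurable_cst.
  under eq_fun do rewrite big_cons; exact: CmeasurableD.
have := big_meas _ (enum 'I_r) (fun k x =>
  End_chart (phi n) (psi n) (W x) i k * phi n x (s x) k 0)
  (fun k => CmeasurableM (mWij k) (mV k)).
have E1 x : U n x -> \sum_(k <- enum 'I_r)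
    End_chart (phi n) (psi n) (W x) i k * phi n x (s x) k 0 = phi n x (W x (s x)) i j.
  move=> Ux; have lphi := chart_linear (ch n) Ux.
  have lpsi : linear (psi n x).
    move=> a u w; apply: (can_inj (chartK (ch n) Ux)).
    by rewrite (chart_linear (ch n) Ux) !(chartVK (ch n) Ux).
  rewrite -[in RHS](chartK (ch n) Ux (s x)) [in RHS](matrix_sum_delta (phi n x (s x))).
  under [in RHS]eq_bigr do rewrite big_ord1.
  rewrite big_enum /= (ord1 j).
  elim/big_rec2: _ => [|k y z _ IH].
    have p0 : psi n x 0 = 0 by have := lpsi (-1) 0 0; rewrite scaler0 addr0 scaleN1r addNr.
    have h0 : phi n x 0 = 0 by have := lphi (-1) 0 0; rewrite scaler0 addr0 scaleN1r addNr.
    by rewrite p0 (lin0 (@End_linear x)) h0 mxE.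
  by rewrite lpsi (@End_linear x) lphi !mxE -IH mulrC.
move=> [mr mi]; split.
  by apply: eq_measurable_fun mr => x /set_mem Ux; rewrite E1.
by apply: eq_measurable_fun mi => x /set_mem Ux; rewrite E1.
Qed.

(** Total through the default of [L2of]: off the maximal domain its value 0 carries no information,
    so every use goes with the square integrability that [wmulE] asks for. *)
Definition wmul f : L2 mu E := L2of mu (fun x => W x (L2rep f x)).

Lemma wmulE f : sqint (fun x => W x (L2rep f x)) ->
  {ae mu, forall x, L2rep (wmul f) x = W x (L2rep f x)}.
Proof. exact: L2ofE. Qed.

Lemma mul_operator_functional f g g' :
  mul_operator mu W (f, g) -> mul_operator mu W (f, g') -> g = g'.
Proof.
by move=> h h'; apply: L2_ext; apply: filterS2 h h' => x /= -> ->.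
Qed.

Lemma mul_operator_sym f g f' g' : pointwise_selfadjoint W ->
  mul_operator mu W (f, g) -> mul_operator mu W (f', g') -> ip g f' = ip f g'.
Proof.
move=> sW h h'; have [mf mf'] := (L2rep_meas f, L2rep_meas f').
rewrite (ip_L2_ae (measurable_End_section mf) mf' h (aeW _ _)) //.
rewrite (ip_L2_ae mf (measurable_End_section mf') (aeW _ _) h') //.
by congr Cintegral; apply/funext => x; exact: sW.
Qed.

Lemma mul_operator_linear a f g f' g' : mul_operator mu W (f, g) ->
  mul_operator mu W (f', g') -> mul_operator mu W (a *: f + f', a *: g + g').
Proof.
move=> h h'; have h1 := L2rep_linear a f f'; have h2 := L2rep_linear a g g'.
apply: (filterS _ (filterI (filterI h1 h2) (filterI h h'))) => x [[/= -> ->] [-> ->]].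
by rewrite (@End_linear x).
Qed.

End endomorphism.
End multiplication_operators.

(** * Semigroups and the Laplace transform *)

Section contraction_semigroups.
Context (R : realType) (V : lmodType R[i]) (ip : {dot V for Num.conj}).
Implicit Types (u v w f g : V) (s t h eps dl : R) (U : R -> V -> V) (T : operator V).
Local Notation nrm := (hnorm ip).

Lemma at_right0_small (F : R -> R) : F t @[t --> 0^'+] --> (0 : R) -> forall eps, 0 < eps ->
  exists2 dl : R, 0 < dl & forall t, 0 < t -> t < dl -> `|F t| < eps.
Proof.
move=> cF eps e0; have [dl /= d0 hd] := cvgr0_norm_lt _ cF _ e0.
exists dl => // t t0 td; apply: hd => //=.
by rewrite /ball_ /= sub0r normrN gtr0_norm.
Qed.

Lemma sg_lin U t : contraction_semigroup ip U -> 0 <= t -> linear (U t).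
Proof. by case=> h _ _ _ _; exact: h. Qed.

Lemma sg_cont_eps U f eps : contraction_semigroup ip U -> 0 < eps ->
  exists2 dl : R, 0 < dl & forall t, 0 <= t -> t < dl -> nrm (U t f - f) < eps.
Proof.
move=> sU e0; have [dl d0 hd] := at_right0_small (sg_cont sU f) e0.
exists dl => // t; rewrite le_eqVlt => /orP[/eqP<- _|t0 td].
  by rewrite (sg_id sU) subrr nrm0.
by have := hd t t0 td; rewrite ger0_norm ?nrm_ge0.
Qed.

Lemma sg_dist U s t f : contraction_semigroup ip U -> 0 <= s -> 0 <= t ->
  nrm (U (s + t) f - U s f) <= nrm (U t f - f).
Proof.
move=> sU s0 t0; rewrite (sg_add sU)// -(linB (sg_lin sU s0)).
exact: (sg_contr sU).
Qed.

(** The vector is U t applied to U h u - u + h w, so contractivity makes the estimate at time 0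
    uniform in t. The sign is that of the generator, - T. *)
Lemma exp_semigroup_step U T u w eps : exp_semigroup ip T U -> T (u, w) -> 0 < eps ->
  exists2 dl : R, 0 < dl & forall t h : R, 0 <= t -> 0 <= h -> h < dl ->
    nrm (U (t + h) u - U t u + h%:C%C *: U t w) <= eps * h.
Proof.
move=> [sU gU] Tuw e0.
have : generator ip U (u, - w) by rewrite gU /op_opp /= opprK.
move=> gen; have [dl d0 hd] := at_right0_small gen e0; exists dl => // t h t0.
have lU := sg_lin sU t0.
rewrite le_eqVlt => /orP[/eqP<- _|h0 hdl].
  by rewrite addr0 subrr add0r scale0r nrm0 mulr0.
rewrite (sg_add sU)// ?(ltW h0)// -(linB lU) -(linZ _ _ lU) -(linD _ _ lU).
apply: le_trans (sg_contr sU _ t0) _.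
have := hd h h0 hdl; rewrite ger0_norm ?nrm_ge0//= opprK => /ltW H.
have -> : U h u - u + h%:C%C *: w = h%:C%C *: ((h^-1)%:C%C *: (U h u - u) + w).
  by rewrite scalerDr scalerA -rmorphM /= divff ?lt0r_neq0// rmorph1 scale1r.
by rewrite nrmZR gtr0_norm// mulrC ler_pM2r.
Qed.

Lemma exp_semigroup_dom U T u w t : exp_semigroup ip T U -> T (u, w) -> 0 <= t ->
  T (U t u, U t w).
Proof.
move=> eU Tuw t0; have [sU gU] := eU; have lU := sg_lin sU t0.
have : generator ip U (U t u, - U t w); last by rewrite gU /op_opp /= opprK.
rewrite /generator /=; apply/cvgrPdist_lt => eps e0.
have e2 : 0 < eps / 2 by rewrite divr_gt0.
have [dl d0 hd] := exp_semigroup_step eU Tuw e2.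
exists dl => //= h; rewrite /ball_ /= sub0r normrN => hdl h0.
rewrite sub0r normrN ger0_norm ?nrm_ge0// opprK.
rewrite gtr0_norm// in hdl.
have := hd t h t0 (ltW h0) hdl; rewrite (addrC t h) (sg_add sU)// ?(ltW h0)// => H.
have -> : (h^-1)%:C%C *: (U h (U t u) - U t u) + U t w =
    (h^-1)%:C%C *: (U h (U t u) - U t u + h%:C%C *: U t w).
  by rewrite [RHS]scalerDr scalerA -rmorphM /= mulVf ?lt0r_neq0// rmorph1 scale1r.
rewrite nrmZR gtr0_norm ?invr_gt0// mulrC ltr_pdivrMr//; apply: le_lt_trans H _.
by rewrite ltr_pM2r// ltr_pdivrMr// mulr_natr mulr2n ltrDl.
Qed.

(** [heat_operator] and [kato_dominates] each provide a semigroup of the scalar operator, and these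
    have to be identified. The difference x of two orbits solves x' = - T x with T >= 0, so |x|^2
    cannot grow; the proof discretizes this, with an error of at most h eta for a step of length
    h. *)
Theorem exp_semigroup_unique U V' T t f : exp_semigroup ip T U -> exp_semigroup ip T V' ->
  is_operator T -> densely_defined ip T -> nonnegative ip T -> 0 <= t -> U t f = V' t f.
Proof.
move=> eU eV [T0 TP Tf] dT nT; have [sU _] := eU; have [sV _] := eV.
have TB u1 w1 u2 w2 : T (u1, w1) -> T (u2, w2) -> T (u1 - u2, w1 - w2).
  move=> h1 h2; have := TP (-1) _ _ h2 h1; rewrite !scaleN1r.
  by congr T; congr pair => /=; rewrite addrC.
have dom_eq u w (tt : R) : T (u, w) -> 0 <= tt -> U tt u = V' tt u.
  move=> Tuw tt0; pose x s := U s u - V' s u; pose y s := U s w - V' s w.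
  have Txy s : 0 <= s -> T (x s, y s).
    by move=> s0; apply: TB; [exact: (exp_semigroup_dom eU)|exact: (exp_semigroup_dom eV)].
  have xb s : 0 <= s -> nrm (x s) <= 2 * nrm u.
    move=> s0; apply: le_trans (nrmB _ _ _) _; rewrite mulr_natl mulr2n.
    by rewrite lerD ?(sg_contr sU)// (sg_contr sV).
  have yb s : 0 <= s -> nrm (y s) <= 2 * nrm w.
    move=> s0; apply: le_trans (nrmB _ _ _) _; rewrite mulr_natl mulr2n.
    by rewrite lerD ?(sg_contr sU)// (sg_contr sV).
  have step eta : 0 < eta -> exists2 dl : R, 0 < dl & forall s h, 0 <= s -> 0 <= h -> h < dl ->
      nrm (x (s + h)) ^+ 2 <= nrm (x s) ^+ 2 + h * eta.
    move=> eta0.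
    pose A := 4 * nrm w ^+ 2; pose B := 2 * nrm u + 2 * nrm w.
    have A0 : 0 <= A by rewrite mulr_ge0 ?sqr_ge0.
    have B0 : 0 <= B by rewrite addr_ge0 ?mulr_ge0 ?nrm_ge0.
    pose eps := Num.min 1 (eta / (4 * (4 * B + 4))).
    have e0 : 0 < eps by rewrite lt_min ltr01 divr_gt0 ?mulr_gt0// ltr_wpDl ?mulr_ge0.
    have e1 : eps <= 1 by rewrite ge_min lexx.
    have e2 : eps * (4 * (4 * B + 4)) <= eta.
      rewrite -ler_pdivlMr ?mulr_gt0 ?ltr_wpDl ?mulr_ge0//.
      by rewrite ge_min lexx orbT.
    have [d1 d10 h1] := exp_semigroup_step eU Tuw e0.
    have [d2 d20 h2] := exp_semigroup_step eV Tuw e0.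
    pose d3 := eta / (4 * (A + 4)).
    have d30 : 0 < d3 by rewrite divr_gt0 ?mulr_gt0 ?ltr_wpDl.
    exists (Num.min (Num.min d1 d2) (Num.min d3 1)); first by rewrite !lt_min d10 d20 d30 ltr01.
    move=> s h s0 h0; rewrite !lt_min => /andP[/andP[hd1 hd2] /andP[hd3 hd4]].
    pose rr := x (s + h) - x s + h%:C%C *: y s.
    have hr : nrm rr <= 2 * eps * h.
      have -> : rr = (U (s + h) u - U s u + h%:C%C *: U s w) -
          (V' (s + h) u - V' s u + h%:C%C *: V' s w).
        rewrite /rr /x /y scalerBr [in RHS]opprD [RHS]addrACA; congr (_ + _).
        by rewrite !opprB addrACA [RHS]addrACA; congr (_ + _); exact: addrC.
      apply: le_trans (nrmB _ _ _) _; rewrite -mulrA mulr_natl mulr2n.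
      by rewrite lerD ?h1 ?h2.
    have xE : x (s + h) = (x s - h%:C%C *: y s) + rr.
      by rewrite /rr [RHS]addrC addrACA subrK subrr addr0.
    have xy0 : 0 <= rip ip (x s) (y s).
      by rewrite ripC; have := nT _ _ (Txy s s0); rewrite lecE => /andP[].
    have q1 : nrm (x s - h%:C%C *: y s) ^+ 2 <= nrm (x s) ^+ 2 + h ^+ 2 * A.
      rewrite nrmD_sqr ripNr ripZr nrmN nrmZR exprMn real_normK ?num_real//.
      have yA : nrm (y s) ^+ 2 <= A.
        have := yb s s0; have := nrm_ge0 ip (y s); have := nrm_ge0 ip w; rewrite /A; nra.
      have := mulr_ge0 h0 xy0; have := ler_wpM2l (sqr_ge0 h) yA; lra.
    have q2 : rip ip (x s - h%:C%C *: y s) rr <= B * (2 * eps * h).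
      apply: le_trans (rip_le _ _ _) _; apply: ler_pM; rewrite ?nrm_ge0//.
      apply: le_trans (nrmB _ _ _) _; rewrite nrmZR ger0_norm// /B lerD ?xb//.
      apply: le_trans (_ : _ <= 1 * nrm (y s)) _; last by rewrite mul1r yb.
      by rewrite ler_wpM2r ?nrm_ge0// ltW.
    have q3 : nrm rr ^+ 2 <= (2 * eps * h) ^+ 2.
      by rewrite ler_sqr ?nnegrE ?nrm_ge0 ?mulr_ge0// ltW.
    rewrite xE nrmD_sqr.
    have q4 : h * (A + 4) * 4 <= eta.
      have := ltW hd3; rewrite /d3 ler_pdivlMr ?mulr_gt0 ?ltr_wpDl//; lra.
    have q5 : h * (h * (A + 4) * 4) <= h * eta by rewrite ler_wpM2l.
    have q6 : h * (eps * (4 * (4 * B + 4))) <= h * eta by rewrite ler_wpM2l.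
    have q7 : (2 * eps * h) ^+ 2 <= 4 * h ^+ 2.
      have -> : (2 * eps * h) ^+ 2 = 4 * (eps ^+ 2 * h ^+ 2) by ring.
      by rewrite ler_pM2l// ler_piMl ?sqr_ge0// expr_le1// ltW.
    have q8 : 0 <= h * eps by rewrite mulr_ge0// ltW.
    have q9 : 0 <= h * eta by rewrite mulr_ge0// ltW.
    have q10 := mulr_ge0 q8 B0.
    have q11 := mulr_ge0 (sqr_ge0 h) A0.
    nra.
  (* Adding up n steps of length tt / n < dl leaves the total error tt et. *)
  have small et : 0 < et -> nrm (x tt) ^+ 2 <= tt * et.
    move=> /step[dl d0 hd].
    pose n := (Num.bound (tt / dl)).+1; pose h := tt / n%:R.
    have n0 : 0 < n%:R :> R by rewrite ltr0n.
    have h0 : 0 <= h by rewrite divr_ge0// ltW.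
    have hdl : h < dl.
      rewrite /h ltr_pdivrMr// mulrC -ltr_pdivrMr//.
      apply: lt_le_trans (archi_boundP _) _; first by rewrite divr_ge0// ltW.
      by rewrite ler_nat.
    have ind m : nrm (x (m%:R * h)) ^+ 2 <= m%:R * h * et.
      elim: m => [|m IH].
        by rewrite !mul0r /x (sg_id sU) (sg_id sV) subrr nrm0 expr0n.
      rewrite -natr1 mulrDl mul1r; apply: le_trans (hd _ _ _ h0 hdl) _; first by rewrite mulr_ge0.
      by rewrite mulrDl lerD2r.
    have nh : n%:R * h = tt by rewrite /h mulrC divfK// lt0r_neq0.
    by have := ind n; rewrite nh.
  apply/eqP; rewrite -subr_eq0 -(nrm_eq0 ip) -sqrf_eq0 eq_le sqr_ge0 andbT.
  apply/ler_addgt0Pr => eps e0; rewrite add0r.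
  have tt1 : 0 < tt + 1 by rewrite ltr_wpDl.
  apply: le_trans (small (eps / (tt + 1)) _) _; first by rewrite divr_gt0.
  by rewrite mulrC -mulrA ler_piMr ?(ltW e0)// mulrC ler_pdivrMr// mul1r lerDl.
move=> t0; apply/eqP; rewrite -subr_eq0 -(nrm_eq0 ip) eq_le nrm_ge0 andbT.
apply/ler_addgt0Pr => eps e0; rewrite add0r; have e2 : 0 < eps / 2 by rewrite divr_gt0.
have [g [w Tg] fg] := dT f _ e2.
have lU := sg_lin sU t0; have lV := sg_lin sV t0.
have -> : U t f - V' t f = U t (f - g) - V' t (f - g).
  by rewrite (linB lU) (linB lV) (dom_eq _ _ _ Tg t0) opprB addrA subrK.
apply: le_trans (nrmB _ _ _) _; rewrite (splitr eps); apply: lerD.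
  exact: le_trans (sg_contr sU _ t0) (ltW fg).
exact: le_trans (sg_contr sV _ t0) (ltW fg).
Qed.

End contraction_semigroups.

Section laplace.
Context (R : realType) (V : lmodType R[i]) (ip : {dot V for Num.conj}).
Implicit Types (u v w f g : V) (s t h eps dl : R) (U : R -> V -> V) (T : operator V).
Local Notation nrm := (hnorm ip).

Lemma exp_semigroup_continuous U f g t : contraction_semigroup ip U -> 0 < t ->
  {for t, continuous (fun s => rip ip (U s f) g)}.
Proof.
move=> sU t0; apply/cvgrPdist_lt => eps e0.
have g1 : 0 < nrm g + 1 by rewrite ltr_wpDl ?nrm_ge0.
have [|dl d0 hd] := sg_cont_eps f sU (eps := eps / (nrm g + 1)); first by rewrite divr_gt0.
have key s s' : 0 <= s -> s <= s' -> s' - s < dl ->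
    `|rip ip (U s' f) g - rip ip (U s f) g| < eps.
  move=> s0 ss' sd; rewrite -ripNl -ripDl; apply: le_lt_trans (rip_CS _ _ _) _.
  have d1 : 0 <= s' - s by rewrite subr_ge0.
  have := hd _ d1 sd; rewrite ltr_pdivlMr// => H; apply: le_lt_trans H.
  apply: ler_pM; rewrite ?nrm_ge0//; last by rewrite lerDl.
  by have := sg_dist f sU s0 d1; rewrite (addrC s) subrK.
exists (Num.min dl t) => /=; first by rewrite lt_min d0.
move=> s; rewrite /ball_ /= lt_min ltr_norml => /andP[/andP[h1 h2]].
rewrite ltr_norml => /andP[_ h3]; have [st|st] := leP s t.
  by apply: key => //; lra.
by rewrite distrC; apply: key; lra.
Qed.

Lemma exp_semigroup_derive U T u w g t : exp_semigroup ip T U -> T (u, w) -> 0 < t ->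
  is_derive t 1 (fun s => rip ip (U s u) g) (- rip ip (U t w) g).
Proof.
move=> eU Tuw t0; have [sU _] := eU.
pose p s := rip ip (U s u) g; pose q s := rip ip (U s w) g.
have cvd : h^-1 *: ((p \o shift t) (h *: 1) - p t) @[h --> 0^'] --> - q t.
  apply/cvgrPdist_lt => eps e0.
  have g1 : 0 < nrm g + 1 by rewrite ltr_wpDl ?nrm_ge0.
  have e1 : 0 < eps / 2 / (nrm g + 1) by rewrite !divr_gt0.
  have e2 : 0 < eps / 2 by rewrite divr_gt0.
  have [d1 d10 hd1] := exp_semigroup_step eU Tuw e1.
  have [d2 /= d20 hd2] := (cvgrPdist_lt _ _).1 (exp_semigroup_continuous (f := w) (g := g) sU t0) _ e2.
  have key s h : 0 <= s -> 0 < h -> h < d1 ->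
      `|p (s + h) - p s + h * q s| < eps / 2 * h.
    move=> s0 h0 hd; rewrite -ripNl -ripDl -ripZl -ripDl.
    apply: le_lt_trans (rip_CS _ _ _) _.
    apply: (@le_lt_trans _ _ (eps / 2 / (nrm g + 1) * h * nrm g)).
      by rewrite ler_wpM2r ?nrm_ge0// hd1// ltW.
    have -> : eps / 2 / (nrm g + 1) * h * nrm g = eps / 2 * h * (nrm g / (nrm g + 1)) by ring.
    by rewrite gtr_pMr ?mulr_gt0// ltr_pdivrMr// mul1r ltrDl.
  exists (Num.min d1 (Num.min d2 t)) => /=; first by rewrite !lt_min d10 d20.
  move=> h; rewrite /ball_ /= sub0r normrN !lt_min => /andP[k1 /andP[k2 k3]] h0.
  rewrite [h *: 1]mulr1 [_ *: _]mulrC; have ah : 0 < `|h| by rewrite normr_gt0.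
  rewrite -(ltr_pM2r ah) -normrM mulrBl divfK// -normrN opprB mulNr opprK.
  have [hp|hn] := leP 0 h.
    have hp' : 0 < h by rewrite lt_def h0.
    rewrite (ger0_norm hp) in k1 *; have := key t h (ltW t0) hp' k1; rewrite [h + t]addrC.
    move=> H; rewrite [q t * h]mulrC; apply: lt_trans H _.
    by rewrite ltr_pM2r// ltr_pdivrMr// mulr_natr mulr2n ltrDl.
  rewrite (ltr0_norm hn) in k1 k3 *; have hp : 0 < - h by rewrite oppr_gt0.
  (* For h < 0 the forward estimate is used from t + h, and continuity of q replaces q (t + h) by q
     t. *)
  have th : 0 <= t + h by lra.
  have := key (t + h) (- h) th hp k1; rewrite addrK.
  have := hd2 (t + h); rewrite /ball_ /= opprD addrA subrr sub0r normrN (ltr0_norm hn).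
  have k2' : - h < d2 by rewrite -(ltr0_norm hn).
  move=> /(_ k2') H1; rewrite -/(q t) -/(q (t + h)) in H1.
  have H3 : `|q (t + h) * h - q t * h| <= eps / 2 * - h.
    by rewrite -mulrBl normrM distrC (ltr0_norm hn) ler_wpM2r// ltW.
  rewrite [h + t]addrC => H2.
  have -> : p (t + h) - p t + q t * h = - (p t - p (t + h) + - h * q (t + h)) -
      (q (t + h) * h - q t * h) by ring.
  apply: le_lt_trans (ler_normB _ _) _; rewrite normrN.
  have := ltr_leD H2 H3; lra.
by apply: DeriveDef; [exact: cvgP cvd|exact: cvg_lim cvd].
Qed.

(** u is the Laplace transform of the orbit of f. Writing the time as s / 2 matches the bound at s /
    2 with G s, and turns the weight into exp (- a s / 2) / 2, which is at most exp (- s) because a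
    >= 2. *)
Lemma laplace_bound U T a u f g (G : R -> R) (B C : R) : exp_semigroup ip T U ->
  T (u, f - a%:C%C *: u) -> 2 <= a -> 0 <= B ->
  measurable_fun (`]0, +oo[%classic : set R) G -> (forall s, 0 < s -> 0 <= G s) ->
  (forall s, 0 < s -> rip ip (U (s / 2) f) g <= B * G s) ->
  (\int[lebesgue_measure]_(s in (`]0%R, +oo[%classic : set R)) (expR (- s) * G s)%:E <= C%:E)%E ->
  rip ip u g <= B * C.
Proof.
move=> eU Tu a2 B0 mG G0 hG IC; have [sU _] := eU.
pose c := a / 2; have c1 : 1 <= c by rewrite ler_pdivlMr// mul1r.
pose p s := rip ip (U (2^-1 * s) u) g; pose q s := rip ip (U (2^-1 * s) f) g.
(* F is an antiderivative of psi: the vector-valued integral is never formed, only increments of F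
   on compact intervals. *)
pose F s := - (expR (- c * s) * p s); pose psi s := expR (- c * s) * (2^-1 * q s).
have lin_derive (k s : R) : is_derive s (1 : R) (fun x : R => k * x) k.
  have := is_deriveZ k (is_derive_id s (1 : R)).
  by rewrite -[X in is_derive _ _ _ X]/(k * 1) mulr1.
have half_gt0 s : 0 < s -> 0 < 2^-1 * s by move=> s0; rewrite mulr_gt0 ?invr_gt0.
have dF s : 0 < s -> is_derive s (1 : R) F (psi s).
  move=> s0; have s2 := half_gt0 s s0.
  have dp : is_derive s (1 : R) p (- rip ip (U (2^-1 * s) (f - a%:C%C *: u)) g * 2^-1).
    exact: (is_derive1_comp (f := fun y => rip ip (U y u) g) (g := fun x => 2^-1 * x)
      (exp_semigroup_derive g eU Tu s2) (lin_derive 2^-1 s)).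
  have de : is_derive s (1 : R) (fun x => expR (- c * x)) (expR (- c * s) * - c).
    exact: (is_derive1_comp (f := expR) (g := fun x => - c * x)
      (is_derive_expR (- c * s)) (lin_derive (- c) s)).
  have := is_deriveN (is_deriveM de dp).
  have lU := sg_lin sU (ltW s2).
  rewrite -[X in is_derive _ _ _ X]/(- (expR (- c * s) * (- rip ip (U (2^-1 * s) (f - a%:C%C *: u)) g * 2^-1)
    + p s * (expR (- c * s) * - c))).
  rewrite (linB lU) (linZ _ _ lU) ripDl ripNl ripZl -/(p s) -/(q s).
  have -> : - (expR (- c * s) * (- (q s - a * p s) * 2^-1) + p s * (expR (- c * s) * - c)) = psi s.
    by rewrite /psi /c; field.
  exact.
have cF s : 0 < s -> {for s, continuous F}.
  move=> s0; have := dF s s0 => -[+ _] => /derivable1_diffP.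
  exact: differentiable_continuous.
have cpsi s : 0 < s -> {for s, continuous psi}.
  move=> s0; have s2 := half_gt0 s s0.
  have cq : {for s, continuous q}.
    have c1' : {for s, continuous (fun x : R => 2^-1 * x)} by exact: mulrl_continuous.
    have c2' := exp_semigroup_continuous (f := f) (g := g) sU s2.
    exact: (continuous_comp c1' c2').
  have ce : {for s, continuous (fun x => expR (- c * x))}.
    have c1' : {for s, continuous (fun x : R => - c * x)} by exact: mulrl_continuous.
    exact: (continuous_comp c1' (@continuous_expR R (- c * s))).
  exact: (cvgM ce (cvgM (cvg_cst _) cq)).
have psi_le s : 0 < s -> psi s <= B * (expR (- s) * G s).
  move=> s0; rewrite /psi; have e1 : expR (- c * s) <= expR (- s).
    by rewrite ler_expR mulNr lerN2 ler_peMl// ltW.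
  have q1 : q s <= B * G s by rewrite /q mulrC; exact: hG.
  have BG : 0 <= B * G s by rewrite mulr_ge0// G0.
  apply: (@le_trans _ _ (expR (- c * s) * (B * G s))).
    by rewrite ler_wpM2l ?expR_ge0//; lra.
  by rewrite mulrCA ler_wpM2l// ler_wpM2r ?G0.
have FTC (x y : R) : 0 < x -> x < y -> F y - F x <= B * C.
  move=> x0 xy; rewrite -lee_fin.
  have inpos s : s \in `[x, y] -> 0 < s by rewrite in_itv /= => /andP[xs _]; exact: lt_le_trans xs.
  have cont : {within `[x, y], continuous psi}.
    by apply: continuous_in_subspaceT => s /set_mem /= /inpos; exact: cpsi.
  have y0 : 0 < y := lt_trans x0 xy.
  rewrite EFinB -(continuous_FTC2 xy cont); first last.
  - move=> s sxy; have s0 : 0 < s.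
      by move: sxy; rewrite in_itv /= => /andP[xs _]; exact: lt_trans xs.
    by rewrite derive1E; have [_ ->] := dF s s0.
  - split.
    + move=> s; rewrite in_itv /= => /andP[xs _].
      by have [] := dF s (lt_trans x0 xs).
    + by apply: cvg_at_right_filter; exact: cF.
    + by apply: cvg_at_left_filter; exact: cF.
  have mb : measurable_fun (`]0, +oo[%classic : set R) (fun s => (B * (expR (- s) * G s))%:E).
    apply/measurable_EFinP/measurable_funM => //; apply: measurable_funM => //.
    by apply: measurable_funTS; apply: measurableT_comp => //; exact: measurable_funN.
  have b0 s : (`]0, +oo[%classic : set R) s -> (0 <= (B * (expR (- s) * G s))%:E)%E.
    by rewrite /= in_itv /= andbT => s0; rewrite lee_fin !mulr_ge0 ?expR_ge0 ?G0.
  have Ib : (\int[lebesgue_measure]_(s in (`]0%R, +oo[%classic : set R))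
      (B * (expR (- s) * G s))%:E <= (B * C)%:E)%E.
    under eq_integral do rewrite EFinM.
    rewrite ge0_integralZl//.
    - by rewrite EFinM; apply: lee_wpmul2l.
    - apply/measurable_EFinP; apply: measurable_funM => //.
      by apply: measurable_funTS; apply: measurableT_comp => //; exact: measurable_funN.
    - by move=> s; rewrite /= in_itv /= andbT => s0; rewrite lee_fin mulr_ge0 ?expR_ge0 ?G0.
  have sub : `[x, y]%classic `<=` (`]0, +oo[%classic : set R).
    by move=> s /= /inpos s0; rewrite in_itv /= s0.
  apply: le_trans (Ib); apply: le_trans (ge0_subset_integral lebesgue_measure _ _ mb b0 sub) => //.
  apply: le_integral => //.
  - by apply: continuous_compact_integrable => //; exact: segment_compact.
  - apply/integrableP; split; first exact: measurable_funS mb.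
    under eq_integral => s /set_mem /sub sp do rewrite gee0_abs ?b0//.
    apply: le_lt_trans (ltry (B * C)); apply: le_trans Ib.
    exact: (ge0_subset_integral lebesgue_measure _ _ mb b0 sub).
  - by move=> s /set_mem /inpos s0; rewrite lee_fin psi_le.
have p_le s : 0 <= s -> `|p s| <= nrm u * nrm g.
  move=> s0; apply: le_trans (rip_CS _ _ _) _; rewrite ler_wpM2r ?nrm_ge0//.
  by apply: (sg_contr sU); rewrite mulr_ge0 ?invr_ge0.
pose D := nrm u * nrm g; have D0 : 0 <= D by rewrite mulr_ge0 ?nrm_ge0.
apply/ler_addgt0Pr => eps e0.
have e3 : 0 < eps / 3 by rewrite divr_gt0.
have g1 : 0 < nrm g + 1 by rewrite ltr_wpDl ?nrm_ge0.
have [|dl d0 hd] := sg_cont_eps u sU (eps := eps / 3 / (nrm g + 1)); first by rewrite divr_gt0.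
(* The endpoints x and y are such that replacing u by its orbit at x / 2, dropping the exponential
   at x, and dropping the term at y cost eps / 3 each. *)
pose x := Num.min dl (eps / (3 * (c * (D + 1)))).
have cD : 0 < c * (D + 1) by rewrite mulr_gt0 ?ltr_wpDl// (lt_le_trans ltr01).
have x0 : 0 < x by rewrite lt_min d0 divr_gt0// mulr_gt0.
have xd : 2^-1 * x < dl.
  apply: (@lt_le_trans _ _ x); first by rewrite gtr_pMl// invf_lt1// ltr1n.
  by rewrite ge_min lexx.
have xe : x * (c * (D + 1)) <= eps / 3.
  have : x <= eps / (3 * (c * (D + 1))) by rewrite ge_min lexx orbT.
  rewrite ler_pdivlMr ?mulr_gt0//; lra.
pose y := x + 3 * (D + 1) / eps.
have xy : x < y by rewrite ltrDl divr_gt0// mulr_gt0// ltr_wpDl.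
have y0 : 0 < y := lt_trans x0 xy.
have r1 : rip ip u g - p x <= eps / 3.
  rewrite -ripNl -ripDl; apply: le_trans (rip_le _ _ _) _.
  have hx0 : 0 <= 2^-1 * x by rewrite mulr_ge0 ?invr_ge0 ?(ltW x0).
  have := hd _ hx0 xd; rewrite ltr_pdivlMr// => H; apply: le_trans (ltW H).
  by rewrite nrm_distC ler_wpM2l ?nrm_ge0// lerDl.
have r2 : p x - expR (- c * x) * p x <= eps / 3.
  rewrite -{1}[p x]mul1r -mulrBl.
  have e1 : 1 - expR (- c * x) <= c * x by have := expR_ge1Dx (- c * x); lra.
  have e2 : 0 <= 1 - expR (- c * x).
    by rewrite subr_ge0 -expR0 ler_expR mulNr oppr_le0 mulr_ge0 ?(ltW x0)// (le_trans ler01).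
  apply: le_trans (ler_norm _) _; rewrite normrM (ger0_norm e2); apply: le_trans xe.
  rewrite mulrA [x * c]mulrC; apply: ler_pM => //.
  by apply: le_trans (p_le _ (ltW x0)) _; rewrite lerDl.
have r3 : expR (- c * y) * p y <= eps / 3.
  have cy : y <= c * y by rewrite ler_peMl// ltW.
  have e1 : expR (- c * y) <= y^-1.
    rewrite mulNr expRN lef_pV2 ?posrE ?expR_gt0//.
    by apply: le_trans (expR_ge1Dx _); apply: le_trans cy _; rewrite lerDr.
  apply: le_trans (ler_norm _) _; rewrite normrM gtr0_norm ?expR_gt0//.
  apply: (@le_trans _ _ (y^-1 * D)).
    by apply: ler_pM; rewrite ?expR_ge0// p_le// ltW.
  rewrite mulrC ler_pdivrMr//.
  have : eps / 3 * (3 * (D + 1) / eps) <= eps / 3 * y.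
    by rewrite ler_pM2l// lerDr ltW.
  have -> : eps / 3 * (3 * (D + 1) / eps) = D + 1 by field; rewrite lt0r_neq0.
  lra.
have := FTC x y x0 xy; rewrite /F; lra.
Qed.

End laplace.

(** * Heat kernel bounds and compactness *)

Section kernel_bound.
Context dX (X : measurableType dX) (R : realType).
Context (mu : {measure set X -> \bar R}).
Local Notation line := (line_bundle X R).
Variables (p : R -> X -> X -> R).
Hypothesis hp : heat_kernel mu p.

Lemma measurable_kernel t x : 0 < t -> measurable_fun setT (p t x).
Proof.
move=> t0; apply: (@measurable_comp _ _ _ _ _ _ [set z : R * (X * X) | 0 < z.1]
  (fun z : R * (X * X) => p z.1 z.2.1 z.2.2) setT (fun y => (t, (x, y)))).
- rewrite [X in measurable X](_ : _ = (`]0, +oo[%classic : set R) `*` setT).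
    exact: measurableX.
  by apply/seteqP; split => z /=; rewrite in_itv /= andbT; tauto.
- by move=> _ [y _ <-].
- exact: hk_meas hp.
- by apply: measurable_fun_pair => //; apply: measurable_fun_pair.
Qed.

(** Symmetry turns the integrand p(t,x,y)^2 into that of the semigroup law for p(2t,x,x). *)
Lemma kernel_sqint t x : 0 < t -> @sqint _ X R mu 1 line (fun y => (p t x y)%:C%C) /\
  (\int[mu]_y (sqfnorm ((p t x y)%:C%C : line y))%:E = (p (t + t) x x)%:E)%E.
Proof.
move=> t0.
have E : (\int[mu]_y (sqfnorm ((p t x y)%:C%C : line y))%:E = (p (t + t) x x)%:E)%E.
  rewrite (hk_semigroup hp _ _ t0 t0); apply: eq_integral => y _.
  by rewrite line_sqfnorm (hk_sym hp y x t0) expr2.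
split=> //; apply/sqintP; split; last by rewrite E ltry.
by apply/line_sectionP; split; [exact: measurable_kernel|exact: measurable_cst].
Qed.

Lemma Re_heat_op_le t x (g : L2 mu line) : 0 < t ->
  complex.Re (heat_op p t g x) <= Num.sqrt (p (t + t) x x) * hnorm (L2dot mu line) g.
Proof.
move=> t0; have [sk Ik] := kernel_sqint x t0.
pose k : L2 mu line := L2of mu (fun y => (p t x y)%:C%C : line y).
have mk : measurable_section (@bundle_meas _ _ _ _ line) (fun y => (p t x y)%:C%C : line y).
  by have /sqintP[] := sk.
have nk : hnorm (L2dot mu line) k = Num.sqrt (p (t + t) x x).
  apply/eqP; rewrite -(@eqrXn2 _ 2)// ?nrm_ge0 ?sqrtr_ge0//.
  have : (hnorm (L2dot mu line) k ^+ 2)%:E = (p (t + t) x x)%:E.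
    by rewrite (nrm_L2_ae mk (L2ofE sk)).
  move=> [] ->; rewrite sqr_sqrtr//; apply: (hk_ge0 hp); exact: addr_gt0.
have -> : heat_op p t g x = L2dot mu line g k.
  rewrite (ip_L2_ae (L2rep_meas g) mk (aeW _ _) (L2ofE sk))//.
  rewrite /heat_op; congr Cintegral; apply/funext => y.
  by rewrite -[RHS]/(_ * Num.conj _) conjcR mulrC.
by rewrite -nk mulrC; exact: (rip_le (L2dot mu line) g k).
Qed.

Lemma nrm_L2abs r (E : hbundle X R r) (f : L2 mu E) :
  hnorm (L2dot mu line) (L2abs f) = hnorm (L2dot mu E) f.
Proof.
apply/eqP; rewrite -(@eqrXn2 _ 2)// ?nrm_ge0//; apply/eqP.
have /sqintP[ma _] := sqint_fnorm f.
suff : (hnorm (L2dot mu line) (L2abs f) ^+ 2)%:E = (hnorm (L2dot mu E) f ^+ 2)%:E by case.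
have fE : {ae mu, forall x, L2rep (L2abs f) x = (fnorm (L2rep f x))%:C%C}.
  exact: (L2rep_pi (exist (@sqint _ X R mu 1 line) _ (sqint_fnorm f))).
rewrite (nrm_L2_ae ma fE) nrm_L2rep; apply: eq_integral => x _.
by rewrite line_sqfnorm sqr_sqrtr// sqfnorm_ge0.
Qed.

(** Once the two scalar semigroups are identified, domination compares |e^{-tH} f|(x) with an
    integral of |f| against p(t,x,.), and Cauchy-Schwarz produces the diagonal value at 2t. *)
Lemma kato_kernel_bound r (E : hbundle X R r) (H : operator (L2 mu E))
    (Hp : operator (L2 mu line)) : heat_operator p Hp -> kato_dominates H Hp ->
  exists2 U, exp_semigroup (L2dot mu E) H U & forall t f, 0 < t ->
    {ae mu, forall x, sqfnorm (L2rep (U t f) x) <=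
      p (t + t) x x * hnorm (L2dot mu E) f ^+ 2}.
Proof.
move=> [[oH dH _] nH [U' eU' hU']] [U [V [eU eV kato]]]; exists U => // t f t0.
have UV g : V t g = U' t g := exp_semigroup_unique g eV eU' oH dH nH (ltW t0).
have h1 := kato t f (ltW t0); rewrite UV in h1; have h2 := hU' t (L2abs f) t0.
apply: filterS2 h1 h2 => x h1 h2.
have px : 0 <= p (t + t) x x by apply: (hk_ge0 hp); exact: addr_gt0.
move: h1; rewrite h2 lecE /= => /andP[_ h1]; have := le_trans h1 (Re_heat_op_le x _ t0).
rewrite nrm_L2abs -ler_sqr ?nnegrE ?mulr_ge0 ?sqrtr_ge0 ?nrm_ge0//.
by rewrite exprMn /fnorm (sqr_sqrtr (sqfnorm_ge0 _)) (sqr_sqrtr px).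
Qed.

End kernel_bound.

(** * Hilbert-Schmidt operators from pointwise bounds *)

Section pointwise_hilbert_schmidt.
Context (R : realType) (V : lmodType R[i]) (ip : {dot V for Num.conj}).
Local Notation nrm := (hnorm ip).

(** Countably many coefficients: bounds that hold almost everywhere for each choice hold for all
    choices off a single null set. *)
Definition gauss_int (z : int * int) : R[i] := Complex z.1%:~R z.2%:~R.

(** Rounding both coordinates toward 0 does not increase the modulus and errs by at most 1 in
    each. *)
Lemma gauss_int_approx (a : R[i]) : exists z : int * int,
  normc (gauss_int z) <= normc a /\ normc (a - gauss_int z) <= 2.
Proof.
have tr (x : R) : exists z : int, `|z%:~R| <= `|x| /\ `|x - z%:~R| <= 1.
  pose n := Num.truncn `|x|; have /andP[n1 n2] : n%:R <= `|x| < n.+1%:R by exact: truncn_itv.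
  have [x0|x0] := leP 0 x.
    exists n%:Z; rewrite (ger0_norm x0) in n1 n2.
    rewrite -pmulrn (ger0_norm x0); split; first by rewrite ger0_norm.
    by rewrite ger0_norm ?subr_ge0//; move: n2; rewrite -natr1; lra.
  exists (- n%:Z); rewrite (ltr0_norm x0) in n1 n2.
  rewrite mulrNz -pmulrn normrN (ltr0_norm x0); split; first by rewrite ger0_norm.
  by rewrite opprK ler0_norm; move: n2; rewrite -natr1; lra.
have [z1 [a1 b1]] := tr (complex.Re a); have [z2 [a2 b2]] := tr (complex.Im a).
exists (z1, z2); split.
  rewrite -ler_sqr ?nnegrE ?normc_ge0// !normc_sqr /=.
  rewrite -[z1%:~R ^+ 2]real_normK ?num_real// -[z2%:~R ^+ 2]real_normK ?num_real//.
  rewrite -[complex.Re a ^+ 2]real_normK ?num_real// -[complex.Im a ^+ 2]real_normK ?num_real//.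
  by rewrite lerD// ler_sqr ?nnegrE.
apply: le_trans (normc_le_ReIm _) _; rewrite !raddfB /=.
have -> : 2 = 1 + 1 :> R by lra.
exact: lerD.
Qed.

(* The Gaussian integers suffice because the hypothesis is homogeneous in z. *)
Lemma bessel_of_gauss_int_bound (I : Type) (s : seq I) (v : I -> V) (g : R) b : 0 <= g -> nrm b <= 1 ->
  (forall z : I -> int * int, nrm (\sum_(i <- s) gauss_int (z i) *: v i) ^+ 2 <=
     g ^+ 2 * \sum_(i <- s) normc (gauss_int (z i)) ^+ 2) ->
  \sum_(i <- s) normc (ip (v i) b) ^+ 2 <= g ^+ 2.
Proof.
move=> g0 b1 h; set Q := \sum_(i <- s) _.
have Q0 : 0 <= Q by apply: sumr_ge0 => i _; exact: sqr_ge0.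
pose al i := Num.conj (ip (v i) b).
suff key : Q <= g * Num.sqrt Q.
  have [->|Qn] := eqVneq Q 0; first exact: sqr_ge0.
  have sQ : 0 < Num.sqrt Q by rewrite sqrtr_gt0 lt_def Qn.
  have : Num.sqrt Q <= g by move: key; rewrite -{1}(sqr_sqrtr Q0) expr2 ler_pM2r.
  by rewrite -{2}(sqr_sqrtr Q0) ler_sqr ?nnegrE ?sqrtr_ge0.
(* The extremal coefficients [al] are scaled by n before rounding; the rounding error does not grow
   with n, so it disappears after division by n. *)
apply: (@ler_of_natM _ _ _ (2 * \sum_(i <- s) nrm (v i))) => n.
have /choice[z hz] i : exists z, normc (gauss_int z) <= normc (n%:R * al i) /\
    normc (n%:R * al i - gauss_int z) <= 2 by exact: gauss_int_approx.
have nal i : normc (n%:R * al i) = n%:R * normc (ip (v i) b).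
  rewrite ComplexField.Normc.normcM normc_conj; congr (_ * _).
  by rewrite -(rmorph_nat (real_complex R)) normcR ger0_norm.
have e1 : n%:R * Q <= nrm (\sum_(i <- s) (n%:R * al i) *: v i).
  apply: (@le_trans _ _ (rip ip (\sum_(i <- s) (n%:R * al i) *: v i) b)); last first.
    apply: le_trans (rip_le _ _ _) _; by rewrite -[leRHS]mulr1 ler_wpM2l ?nrm_ge0.
  rewrite /Q mulr_sumr; elim: (s) => [|i t IH]; first by rewrite !big_nil rip0l.
  rewrite !big_cons ripDl lerD//.
  rewrite /rip ipZl -mulrA [al i * _]mulrC mulc_conj -(rmorph_nat (real_complex R)) -rmorphM /=.
  exact: lexx.
apply: le_trans e1 _.
have -> : \sum_(i <- s) (n%:R * al i) *: v i =
    \sum_(i <- s) gauss_int (z i) *: v i + \sum_(i <- s) (n%:R * al i - gauss_int (z i)) *: v i.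
  by rewrite -big_split /=; apply: eq_bigr => i _; rewrite -scalerDl addrC subrK.
apply: le_trans (nrmD _ _ _) _; apply: lerD; last first.
  apply: le_trans (nrm_sum _ _ _) _; rewrite mulr_sumr; apply: ler_sum => i _.
  by rewrite nrmZ ler_wpM2r ?nrm_ge0//; have [] := hz i.
rewrite -ler_sqr ?nnegrE ?nrm_ge0 ?mulr_ge0 ?sqrtr_ge0//.
apply: le_trans (h z) _; rewrite mulrCA exprMn ler_wpM2l ?sqr_ge0// exprMn sqr_sqrtr//.
rewrite /Q mulr_sumr; apply: ler_sum => i _; rewrite -exprMn -nal.
by rewrite ler_sqr ?nnegrE ?normc_ge0//; have [] := hz i.
Qed.

End pointwise_hilbert_schmidt.

Section hilbert_schmidt_L2.
Context dX (X : measurableType dX) (R : realType).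
Context (mu : {measure set X -> \bar R}) (r : nat) (E : hbundle X R r).
Local Notation ip := (L2dot mu E).
Local Notation nrm := (hnorm ip).
Implicit Types (f g : L2 mu E) (T : L2 mu E -> L2 mu E).

Lemma L2rep_sum (I : Type) (s : seq I) (c : I -> R[i]) (F : I -> L2 mu E) :
  {ae mu, forall x, L2rep (\sum_(i <- s) c i *: F i) x = \sum_(i <- s) c i *: L2rep (F i) x}.
Proof.
elim: s => [|i s IH].
  have := L2repB (0 : L2 mu E) 0; rewrite subr0 big_nil.
  by apply: filterS => x ->; rewrite subrr big_nil.
rewrite big_cons; have := L2rep_linear (c i) (F i) (\sum_(i <- s) c i *: F i).
by apply: filterS2 IH => x h ->; rewrite h big_cons.
Qed.

Lemma nrm_sum_pons (s : seq (R[i] * L2 mu E)) : pons ip [seq q.2 | q <- s] ->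
  nrm (\sum_(q <- s) q.1 *: q.2) ^+ 2 <= \sum_(q <- s) normc q.1 ^+ 2.
Proof.
elim: s => [|[c e] s IH] /=; first by rewrite !big_nil nrm0 expr0n.
move=> [n1 o1 ps]; rewrite !big_cons /= nrmD_sqr.
have -> : rip ip (c *: e) (\sum_(q <- s) q.1 *: q.2) = 0.
  rewrite /rip ipZl; suff -> : ip e (\sum_(q <- s) q.1 *: q.2) = 0 by rewrite mulr0.
  rewrite big_seq; elim/big_ind: _ => [|x y hx hy|q qs]; first exact: ip0r.
    by rewrite ipDr hx hy addr0.
  by rewrite ipZr [X in _ * X](o1 _ (map_f _ qs)) mulr0.
rewrite mulr0 addr0 lerD ?IH// nrmZ exprMn ler_piMr ?sqr_ge0// nrm_sqr.
by case: n1 => [->//|->]; rewrite rip0l.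
Qed.

(** For almost every x the map f -> (T f)(x) has norm at most sqrt (G x) on the span of a finite
    orthonormal system, so each frame coordinate contributes at most G x to the sum over the system.
    Summing before integrating keeps the bound independent of the number of vectors. *)
Theorem pointwise_bound_cpt T (G : X -> R) : linear T -> measurable_fun setT G ->
  (forall x, 0 <= G x) -> (\int[mu]_x (G x)%:E < +oo)%E ->
  (forall f, {ae mu, forall x, sqfnorm (L2rep (T f) x) <= G x * nrm f ^+ 2}) -> cpt ip T.
Proof.
move=> lT mG G0 IG hT; have [b [mb hb]] := exists_parseval_frame E.
have [S hS] : exists S : R, (\int[mu]_x (G x)%:E = S%:E)%E.
  exists (fine (\int[mu]_x (G x)%:E)%E); rewrite fineK// ge0_fin_numE//.
  by apply: integral_ge0 => x _; rewrite lee_fin.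
apply: (@hilbert_schmidt_cpt _ _ _ _ ((size b)%:R * S)) => // s ps.
pose co (z : seq (int * int)) (i : nat) := gauss_int R (nth (0, 0) z i).
pose e (i : nat) := nth (0 : L2 mu E) s i.
have ae1 (z : seq (int * int)) : {ae mu, forall x,
    sqfnorm (\sum_(i <- iota 0 (size s)) co z i *: L2rep (T (e i)) x) <=
    G x * \sum_(i <- iota 0 (size s)) normc (co z i) ^+ 2}.
  pose f := \sum_(i <- iota 0 (size s)) co z i *: e i.
  have Tf : T f = \sum_(i <- iota 0 (size s)) co z i *: T (e i).
    by rewrite (lin_sum _ _ lT); apply: eq_bigr => i _; rewrite (linZ _ _ lT).
  have h1 := L2rep_sum (iota 0 (size s)) (co z) (T \o e).
  have h2 := hT f; rewrite Tf in h2.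
  apply: filterS2 h1 h2 => x /= h1 h2; rewrite -h1; apply: le_trans h2 _; rewrite ler_wpM2l//.
  have := @nrm_sum_pons [seq (co z i, e i) | i <- iota 0 (size s)].
  by rewrite !big_map /= -map_comp (eq_map (g := e))// map_nth_iota0// take_size; exact.
have ae2 : {ae mu, forall x, \sum_(u <- s) sqfnorm (L2rep (T u) x) <= (size b)%:R * G x}.
  (* Enumerating the coefficient lists through [unpickle] makes this a countable intersection of
     sets of full measure. *)
  have : {ae mu, forall x, forall n : nat, if unpickle n is Some z then
      sqfnorm (\sum_(i <- iota 0 (size s)) co z i *: L2rep (T (e i)) x) <=
      G x * \sum_(i <- iota 0 (size s)) normc (co z i) ^+ 2 else true}.
    apply: ae_foralln => n; case: (unpickle n) => [z|]; first exact: ae1.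
    by apply: aeW.
  apply: filterS => x hx; have [ps' hb'] := hb x.
  set l := [seq _ | _ <- b] in ps' hb'.
  have -> : \sum_(u <- s) sqfnorm (L2rep (T u) x) =
      \sum_(k <- l) \sum_(i <- iota 0 (size s)) normc (herm E x (L2rep (T (e i)) x) k) ^+ 2.
    rewrite exchange_big /= (big_nth 0) /index_iota subn0.
    by apply: eq_bigr => i _; rewrite sqfnormE (parseval ps').
  have -> : (size b)%:R * G x = \sum_(k <- l) G x.
    by rewrite big_const_seq count_predT size_map iter_addr_0 mulr_natl.
  rewrite big_seq [leRHS]big_seq; apply: ler_sum => k kl.
  rewrite -[leRHS](sqr_sqrtr (G0 x)); apply: bessel_of_gauss_int_bound.
  - exact: sqrtr_ge0.
  - exact: (pons_le1 ps').
  - move=> z; rewrite (sqr_sqrtr (G0 x)) nrm_sqr.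
    have := hx (pickle (mkseq z (size s))); rewrite pickleK.
    have E1 i : i \in iota 0 (size s) -> co (mkseq z (size s)) i = gauss_int R (z i).
      by rewrite mem_iota add0n => /andP[_ si]; rewrite /co nth_mkseq.
    have -> : \sum_(i <- iota 0 (size s)) co (mkseq z (size s)) i *: L2rep (T (e i)) x =
        \sum_(i <- iota 0 (size s)) gauss_int R (z i) *: L2rep (T (e i)) x.
      by rewrite big_seq [RHS]big_seq; apply: eq_bigr => i /E1 ->.
    have -> : \sum_(i <- iota 0 (size s)) normc (co (mkseq z (size s)) i) ^+ 2 =
        \sum_(i <- iota 0 (size s)) normc (gauss_int R (z i)) ^+ 2.
      by rewrite big_seq [RHS]big_seq; apply: eq_bigr => i /E1 ->.
    exact.
have mT u : measurable_fun setT (fun x => (sqfnorm (L2rep (T u) x))%:E).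
  exact/measurable_esqfnorm/L2rep_meas.
rewrite -lee_fin -sumEFin.
under eq_bigr do rewrite nrm_L2rep.
rewrite -ge0_integral_sum//; last by move=> u x _; rewrite lee_fin sqfnorm_ge0.
rewrite EFinM -hS -ge0_integralZl//; last 2 first.
- exact/measurable_EFinP.
- by move=> x _; rewrite lee_fin.
apply: ae_ge0_le_integral => //.
- by move=> x _; apply: sume_ge0 => u _; rewrite lee_fin sqfnorm_ge0.
- exact: emeasurable_sum.
- by move=> x _; rewrite mule_ge0// lee_fin.
- by apply: measurable_funeM; exact/measurable_EFinP.
- by apply: filterS ae2 => x h _; rewrite sumEFin -EFinM lee_fin.
Qed.

End hilbert_schmidt_L2.

(* Split according to whether [y <= kappa * F `^ q^-1]. *)
Lemma weighted_young (R : realType) (q kappa F F1 n2 y u : R) : 1 <= q -> 0 < kappa ->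
  0 < F -> 0 <= F1 -> 0 <= n2 -> 0 <= y -> 0 <= u -> u <= F1 * F * n2 ->
  y * u <= kappa * F `^ q^-1 * u + kappa `^ (1 - q) * F `^ q^-1 * n2 * (y `^ q * F1).
Proof.
move=> q1 k0 F0 F10 n0 y0 u0 uF; have q0 : 0 < q by apply: lt_le_trans q1.
have FF : 0 < F `^ q^-1 by rewrite powR_gt0.
have kk : 0 < kappa `^ (1 - q) by rewrite powR_gt0.
have Fq : F `^ q^-1 `^ (1 - q) = F `^ q^-1 / F.
  rewrite -powRrM mulrBr mulr1 mulVf ?lt0r_neq0//.
  by rewrite powRB ?(lt0r_neq0 F0) ?implybT// powRr1 ?(ltW F0).
set f := F `^ q^-1 in FF Fq *; set k := kappa `^ (1 - q) in kk *.
have yq0 : 0 <= y `^ q by rewrite powR_ge0.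
have L0 : 0 < kappa * f by rewrite mulr_gt0.
have t2 : 0 <= k * f * n2 * (y `^ q * F1).
  by rewrite mulr_ge0 ?mulr_ge0 ?(ltW kk) ?(ltW FF).
have [yL|yL] := leP y (kappa * f).
  by apply: le_trans (ler_wpM2r u0 yL) _; rewrite lerDl.
have yp : 0 < y by apply: lt_trans yL.
apply: (@le_trans _ _ (k * f * n2 * (y `^ q * F1))); last first.
  by rewrite lerDr mulr_ge0// ltW.
have yE : y = y `^ q * y `^ (1 - q).
  rewrite -powRD; last by rewrite (lt0r_neq0 yp) implybT.
  by rewrite addrC subrK powRr1.
have yLq : y `^ (1 - q) <= k * (f / F).
  rewrite -Fq -powRM ?(ltW k0) ?(ltW FF)//.
  rewrite -opprB !powRN lef_pV2 ?posrE ?powR_gt0//.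
  by apply: ge0_ler_powR; rewrite ?nnegrE ?subr_ge0// ltW.
apply: (@le_trans _ _ (y `^ q * (k * (f / F)) * (F1 * F * n2))).
  by rewrite {1}yE; apply: ler_pM => //; rewrite ?mulr_ge0 ?powR_ge0// ler_wpM2l.
by rewrite le_eqVlt; apply/orP; left; apply/eqP; field; exact: lt0r_neq0.
Qed.

(** * Weighted resolvent estimates *)

Section weighted_estimates.
Context dX (X : measurableType dX) (R : realType).
Context (mu : {measure set X -> \bar R}) (r : nat) (E : hbundle X R r).
Local Notation ip := (L2dot mu E).
Local Notation nrm := (hnorm ip).
Implicit Types (f u : L2 mu E).
Variables (H : operator (L2 mu E)) (U : R -> L2 mu E -> L2 mu E).
Hypothesis eU : exp_semigroup ip H U.
Variables (F1 : X -> R) (F2 : R -> R) (q C : R).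
Hypotheses (q1 : 1 <= q) (mF1 : measurable_fun setT F1) (F1_gt0 : forall x, 0 < F1 x).
Hypotheses (mF2 : measurable_fun (`]0, +oo[%classic : set R) F2)
  (F2_gt0 : forall t : R, 0 < t -> 0 < F2 t).
Hypothesis diag_bound : forall (t : R) f, 0 < t ->
  {ae mu, forall x, sqfnorm (L2rep (U t f) x) <= F1 x * F2 (t + t) * nrm f ^+ 2}.
Hypothesis laplace_F2 : (\int[lebesgue_measure]_(t in (`]0%R, +oo[%classic : set R))
  (expR (- t) * F2 t `^ (2 * q)^-1)%:E <= C%:E)%E.

Definition wint (w : X -> R) : \bar R := (\int[mu]_x ((w x ^+ 2) `^ q * F1 x)%:E)%E.

Lemma measurable_wint (w : X -> R) : measurable_fun setT w ->
  measurable_fun setT (fun x => ((w x ^+ 2) `^ q * F1 x)%:E).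
Proof.
move=> mw; apply/measurable_EFinP/measurable_funM => //.
apply: (@measurableT_comp _ _ _ _ _ _ (@powR R ^~ q) _ (fun x => w x ^+ 2)).
  exact: measurable_powR.
exact: measurable_funX.
Qed.

Lemma wint_integrand_ge0 (w : X -> R) x : (0 <= ((w x ^+ 2) `^ q * F1 x)%:E)%E.
Proof. by rewrite lee_fin mulr_ge0 ?powR_ge0// ltW. Qed.

(** Interpolation between contractivity and the diagonal bound: [weighted_young] is applied
    pointwise with y = phi^2 and u = |U t f|^2, leaving kappa free. *)
Lemma smul_semigroup_bound (phi : X -> R) (M N kappa t : R) f : measurable_fun setT phi ->
  (forall x, `|phi x| <= M) -> (wint phi <= N%:E)%E -> 0 < kappa -> 0 < t ->
  nrm (smul phi (U t f)) ^+ 2 <=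
    (kappa + kappa `^ (1 - q) * N) * F2 (t + t) `^ q^-1 * nrm f ^+ 2.
Proof.
move=> mphi bphi hN k0 t0; set n2 := nrm f ^+ 2; set Fq := F2 (t + t) `^ q^-1.
have F0 : 0 < F2 (t + t) by apply: F2_gt0; exact: addr_gt0.
have n20 : 0 <= n2 by exact: sqr_ge0.
have Fq0 : 0 <= Fq by exact: powR_ge0.
have kF0 : 0 <= kappa * Fq by rewrite mulr_ge0// ltW.
have c0 : 0 <= kappa `^ (1 - q) * Fq * n2.
  by apply: mulr_ge0 => //; apply: mulr_ge0 => //; exact: powR_ge0.
have w0 x : 0 <= (phi x ^+ 2) `^ q * F1 x by rewrite -lee_fin; exact: wint_integrand_ge0.
have nU : nrm (U t f) ^+ 2 <= n2.
  by rewrite ler_sqr ?nnegrE ?nrm_ge0//; apply: (sg_contr eU.1); exact: ltW.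
have ms := measurable_esqfnorm (L2rep_meas (U t f)).
have I1 : (\int[mu]_x (kappa * Fq * sqfnorm (L2rep (U t f) x))%:E <= (kappa * Fq * n2)%:E)%E.
  under eq_integral do rewrite EFinM.
  rewrite ge0_integralZl//; last by move=> x _; rewrite lee_fin sqfnorm_ge0.
  by rewrite -nrm_L2rep -EFinM lee_fin ler_wpM2l.
have I2 : (\int[mu]_x (kappa `^ (1 - q) * Fq * n2 * ((phi x ^+ 2) `^ q * F1 x))%:E <=
    (kappa `^ (1 - q) * Fq * n2 * N)%:E)%E.
  under eq_integral do rewrite EFinM.
  rewrite ge0_integralZl//; last 2 first.
  - exact: measurable_wint.
  - by move=> x _; exact: wint_integrand_ge0.
  by rewrite [leRHS]EFinM lee_wpmul2l.
rewrite -lee_fin (nrm_smul mphi bphi).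
have -> : (kappa + kappa `^ (1 - q) * N) * Fq * n2 =
  kappa * Fq * n2 + kappa `^ (1 - q) * Fq * n2 * N by ring.
rewrite EFinD; apply: le_trans (leeD I1 I2).
rewrite -ge0_integralD//; last 4 first.
- by move=> x _; rewrite lee_fin mulr_ge0// sqfnorm_ge0.
- under eq_fun do rewrite EFinM; exact: measurable_funeM.
- by move=> x _; rewrite lee_fin mulr_ge0.
- under eq_fun do rewrite EFinM; apply: measurable_funeM; exact: measurable_wint.
apply: ae_ge0_le_integral => //.
- by move=> x _; rewrite lee_fin mulr_ge0 ?sqr_ge0 ?sqfnorm_ge0.
- apply/measurable_EFinP/measurable_funM; last exact/measurable_sqfnorm/L2rep_meas.
  exact: measurable_funX.
- move=> x _; apply: adde_ge0; first by rewrite lee_fin mulr_ge0// sqfnorm_ge0.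
  by rewrite lee_fin mulr_ge0.
- apply: emeasurable_funD; under eq_fun do rewrite EFinM; first exact: measurable_funeM.
  by apply: measurable_funeM; exact: measurable_wint.
- apply: filterS (diag_bound f t0) => x hx _; rewrite -EFinD lee_fin.
  apply: weighted_young => //; rewrite ?sqr_ge0 ?sqfnorm_ge0//.
  by rewrite ltW.
Qed.

(** With g = phi (phi u) the left side of the Laplace bound is |phi u|^2, and one factor |phi u|
    cancels. The result is free of M, so the truncation of the weight can be removed afterwards. *)
Lemma smul_resolvent_bound (phi : X -> R) (M N kappa a : R) u f : measurable_fun setT phi ->
  (forall x, `|phi x| <= M) -> (wint phi <= N%:E)%E -> 0 < kappa -> 2 <= a ->
  H (u, f - a%:C%C *: u) ->
  nrm (smul phi u) <= Num.sqrt (kappa + kappa `^ (1 - q) * N) * nrm f * C.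
Proof.
move=> mphi bphi hN k0 a2 Hu; set S := kappa + _; set v := smul phi u.
have N0 : 0 <= N.
  by rewrite -lee_fin; apply: le_trans hN; apply: integral_ge0 => x _; exact: wint_integrand_ge0.
have S0 : 0 <= S by rewrite addr_ge0 ?(ltW k0)// mulr_ge0// powR_ge0.
have C0 : 0 <= C.
  rewrite -lee_fin; apply: le_trans laplace_F2; apply: integral_ge0 => t _.
  by rewrite lee_fin mulr_ge0 ?expR_ge0 ?powR_ge0.
have G0 s : 0 < s -> 0 <= F2 s `^ (2 * q)^-1 by rewrite powR_ge0.
have mG : measurable_fun (`]0, +oo[%classic : set R) (fun s => F2 s `^ (2 * q)^-1).
  apply: (@measurableT_comp _ _ _ _ _ _ (@powR R ^~ _)) => //; exact: measurable_powR.
(* At time s / 2 the estimate involves F2 s to the power 1/q, whose square root has the exponent of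
   the control condition. *)
have hG s : 0 < s -> rip ip (U (s / 2) f) (smul phi v) <=
    Num.sqrt S * nrm f * nrm v * F2 s `^ (2 * q)^-1.
  move=> s0; have -> : rip ip (U (s / 2) f) (smul phi v) = rip ip (smul phi (U (s / 2) f)) v.
    by rewrite /rip (smul_sym mphi bphi).
  apply: le_trans (rip_le _ _ _) _; rewrite mulrAC ler_wpM2r ?nrm_ge0//.
  rewrite -ler_sqr ?nnegrE ?mulr_ge0 ?sqrtr_ge0 ?powR_ge0 ?nrm_ge0//.
  have s2 : 0 < s / 2 by rewrite divr_gt0.
  apply: le_trans (smul_semigroup_bound f mphi bphi hN k0 s2) _.
  rewrite -splitr !exprMn (sqr_sqrtr S0) -/S mulrAC le_eqVlt; apply/orP; left; apply/eqP.
  congr (_ * _); rewrite invfM -(powR_mulrn 2 (powR_ge0 _ _)) -powRrM.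
  by congr (_ * _ `^ _); rewrite mulrAC mulVf ?mul1r// pnatr_eq0.
have B0 : 0 <= Num.sqrt S * nrm f * nrm v by rewrite !mulr_ge0 ?sqrtr_ge0 ?nrm_ge0.
have := laplace_bound eU Hu a2 B0 mG G0 hG laplace_F2.
have -> : rip ip u (smul phi v) = nrm v * nrm v.
  by rewrite -expr2 nrm_sqr /rip -(smul_sym mphi bphi).
rewrite mulrAC; have [v0 _|v0] := eqVneq (nrm v) 0.
  by rewrite v0 !mulr_ge0 ?sqrtr_ge0 ?nrm_ge0.
by rewrite ler_pM2r// lt_def v0 nrm_ge0.
Qed.

(** Monotone convergence along the truncations min (w, n). *)
Lemma weighted_resolvent_bound (w : X -> R) (N kappa a : R) u f : measurable_fun setT w ->
  (forall x, 0 <= w x) -> (wint w <= N%:E)%E -> 0 < kappa -> 2 <= a ->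
  H (u, f - a%:C%C *: u) ->
  (\int[mu]_x (w x ^+ 2 * sqfnorm (L2rep u x))%:E <=
    ((Num.sqrt (kappa + kappa `^ (1 - q) * N) * nrm f * C) ^+ 2)%:E)%E.
Proof.
move=> mw w0 hN k0 a2 Hu; pose phi n x := Num.min (w x) n%:R.
have phi0 n x : 0 <= phi n x by rewrite le_min w0 /=.
have phi_le n x : phi n x <= w x by rewrite ge_min lexx.
have mphi n : measurable_fun setT (phi n) by exact: measurable_minr.
have bphi n x : `|phi n x| <= n%:R by rewrite ger0_norm// ge_min lexx orbT.
have hphi n : (wint (phi n) <= N%:E)%E.
  apply: le_trans hN; apply: ge0_le_integral => //.
  - by move=> x _; exact: wint_integrand_ge0.
  - exact: measurable_wint.
  - exact: measurable_wint.
  - move=> x _; rewrite lee_fin ler_wpM2r ?(ltW (F1_gt0 x))//.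
    apply: ge0_ler_powR; rewrite ?nnegrE ?sqr_ge0 ?(le_trans ler01 q1)//.
    by rewrite ler_sqr ?nnegrE.
have cv : (\int[mu]_x (phi n x ^+ 2 * sqfnorm (L2rep u x))%:E)%E @[n --> \oo] -->
    (\int[mu]_x (w x ^+ 2 * sqfnorm (L2rep u x))%:E)%E.
  have -> : (\int[mu]_x (w x ^+ 2 * sqfnorm (L2rep u x))%:E)%E =
      (\int[mu]_x limn (fun n => (phi n x ^+ 2 * sqfnorm (L2rep u x))%:E))%E.
    apply: eq_integral => x _; apply/esym/cvg_lim => //.
    apply: cvg_near_cst; near=> n; rewrite /phi; congr (_ ^+ 2 * _)%:E.
    apply: min_l; near: n; exists (Num.truncn (w x)).+1 => // n /= nw.
    apply: ltW; apply: lt_le_trans (truncnS_gt _) _; by rewrite ler_nat.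
  apply: cvg_monotone_convergence => //.
  - move=> n; apply/measurable_EFinP/measurable_funM; last exact/measurable_sqfnorm/L2rep_meas.
    exact: measurable_funX.
  - by move=> n x _; rewrite lee_fin mulr_ge0 ?sqr_ge0 ?sqfnorm_ge0.
  - move=> x _ m n mn; rewrite lee_fin ler_wpM2r ?sqfnorm_ge0// ler_sqr ?nnegrE//.
    by rewrite /phi le_min !ge_min lexx /= ler_nat mn orbT.
rewrite -(cvg_lim _ cv)//; apply: lime_le; first by apply/cvg_ex; eexists; exact: cv.
near=> n; rewrite -(nrm_smul (mphi n) (bphi n)) lee_fin.
have b0 : 0 <= Num.sqrt (kappa + kappa `^ (1 - q) * N) * nrm f * C.
  exact: le_trans (nrm_ge0 _ _) (smul_resolvent_bound (mphi n) (bphi n) (hphi n) k0 a2 Hu).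
rewrite ler_sqr ?nnegrE ?nrm_ge0//.
exact: (smul_resolvent_bound (mphi n) (bphi n) (hphi n) k0 a2 Hu).
Unshelve. all: by end_near. Qed.

(** Dominated convergence: at x the integrand vanishes as soon as n >= w x. *)
Lemma truncation_wint (w : X -> R) (eta : R) : measurable_fun setT w -> (forall x, 0 <= w x) ->
  (wint w < +oo)%E -> 0 < eta ->
  exists2 n : nat, (0 < n)%N & (wint (fun x => if n%:R < w x then w x else 0)%R <= eta%:E)%E.
Proof.
move=> mw w0 fw e0; pose v (n : nat) x := if n%:R < w x then w x else 0.
have q0 : 0 < q by exact: lt_le_trans q1.
have mv n : measurable_fun setT (v n).
  by apply: measurable_fun_ifT => //; exact: measurable_fun_ltr.
have v0 n x : 0 <= v n x by rewrite /v; case: ifP.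
have vw n x : v n x <= w x by rewrite /v; case: ifP.
have ig : mu.-integrable setT (fun x => ((w x ^+ 2) `^ q * F1 x)%:E).
  apply/integrableP; split; first exact: measurable_wint.
  by under eq_integral do rewrite gee0_abs ?wint_integrand_ge0//.
have [||_ _] := @dominated_convergence _ _ _ mu setT measurableT
  (fun n x => ((v n x ^+ 2) `^ q * F1 x)%:E) (cst 0%E)
  (fun x => ((w x ^+ 2) `^ q * F1 x)%:E) (fun n => measurable_wint (mv n)) (measurable_cst _) _ ig.
- apply: aeW => x _; apply: cvg_near_cst; exists (Num.truncn (w x)).+1 => // n /= nw.
  have wn : w x <= n%:R.
    by apply: ltW; apply: lt_le_trans (truncnS_gt _) _; rewrite ler_nat.
  by rewrite /v ltNge wn /= expr0n powR0 ?lt0r_neq0// mul0r.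
- apply: aeW => x n _; rewrite gee0_abs ?wint_integrand_ge0// lee_fin ler_wpM2r ?(ltW (F1_gt0 x))//.
  apply: ge0_ler_powR; rewrite ?nnegrE ?sqr_ge0 ?(ltW q0)//.
  by rewrite ler_sqr ?nnegrE.
rewrite integral0 => cv.
have [N _ hN] : \forall n \near \oo, (wint (v n) <= eta%:E)%E.
  have e0' : (0 < eta%:E :> \bar R)%E by rewrite lte_fin.
  have h : \forall n \near \oo, (wint (v n) < eta%:E)%E := cv _ (open_ereal_lt' e0').
  by apply: filterS h => n /ltW.
by exists N.+1 => //; exact: (hN N.+1 (leqnSn _)).
Qed.

Lemma weighted_cutoff (w1 w2 : X -> R) (M eps : R) : measurable_fun setT w1 ->
  measurable_fun setT w2 -> (forall x, 0 <= w1 x) -> (forall x, 0 <= w2 x) ->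
  0 <= M -> {ae mu, forall x, w2 x <= M} -> (wint w1 < +oo)%E ->
  (forall c : R, 0 < c -> (\int[mu]_(x in [set x | (c <= w2 x)%R]) (F1 x)%:E < +oo)%E) -> 0 < eps ->
  exists A m, [/\ measurable A, (\int[mu]_(x in A) (F1 x)%:E < +oo)%E, 0 <= m,
    {ae mu, forall x, A x -> w1 x + w2 x <= m} &
    forall a u f, 2 <= a -> H (u, f - a%:C%C *: u) -> nrm u <= nrm f ->
      (\int[mu]_x (((w1 x + w2 x) * \1_(~` A) x) ^+ 2 * sqfnorm (L2rep u x))%:E <=
         ((eps * nrm f) ^+ 2)%:E)%E].
Proof.
move=> mw1 mw2 w10 w20 M0 w2M fw1 fw2 e0; have q0 : 0 < q by exact: lt_le_trans q1.
(* The threshold n makes the weighted integral at most kappa / kappa^(1-q), so that [S] below is 2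
   kappa. D then limits the cost of the large values of w1 to eps^2 / 2, and e = eps / 4 makes that
   of the small values 8 e^2 = eps^2 / 2. *)
pose D := 2 * (1 + M) ^+ 2 * C ^+ 2 + 1; pose kappa := eps ^+ 2 / (4 * D).
have D0 : 0 < D.
  by rewrite ltr_wpDl//; apply: mulr_ge0; [apply: mulr_ge0|]; rewrite ?sqr_ge0.
have k0 : 0 < kappa by rewrite divr_gt0 ?exprn_gt0// mulr_gt0.
have kq : 0 < kappa `^ (1 - q) by rewrite powR_gt0.
have [|n n0 hn] := truncation_wint (eta := kappa / kappa `^ (1 - q)) mw1 w10 fw1.
  by rewrite divr_gt0.
set v := (fun x => _) in hn.
have mv : measurable_fun setT v.
  by apply: measurable_fun_ifT => //; exact: measurable_fun_ltr.
have v0 x : 0 <= v x by rewrite /v; case: ifP.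
pose e := eps / 4; have e40 : 0 < e by rewrite divr_gt0.
have mge (w : X -> R) (c : R) : measurable_fun setT w -> measurable [set x | (c <= w x)%R].
  by move=> mw; rewrite -[X in measurable X]setTI; apply: measurable_fun_ler.
have mle (w : X -> R) (c : R) : measurable_fun setT w -> measurable [set x | w x <= c].
  by move=> mw; rewrite -[X in measurable X]setTI; apply: measurable_fun_ler.
set B := [set x | (e <= w1 x)%R] `|` [set x | (e <= w2 x)%R].
have mB : measurable B by apply: measurableU; exact: mge.
set A := [set x | w1 x <= n%:R] `&` B.
have mA : measurable A by apply: measurableI => //; exact: mle.
have mF : measurable_fun setT (EFin \o F1) by exact/measurable_EFinP.
have F0 x : (0 <= (F1 x)%:E)%E by rewrite lee_fin ltW.
have eq0 : 0 < (e ^+ 2) `^ q by rewrite powR_gt0// exprn_gt0.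
(* Chebyshev's inequality: on this set (w1^2)^q is at least (e^2)^q. *)
have I1 : (\int[mu]_(x in [set x | (e <= w1 x)%R]) (F1 x)%:E < +oo)%E.
  apply: (@le_lt_trans _ _ (\int[mu]_(x in [set x | (e <= w1 x)%R])
      (((e ^+ 2) `^ q)^-1%:E * ((w1 x ^+ 2) `^ q * F1 x)%:E))%E).
    apply: ge0_le_integral => //.
    - exact: mge.
    - exact: measurable_funTS.
    - by apply: measurable_funTS; apply: measurable_funeM; exact: measurable_wint.
    - move=> x /= ex; rewrite -EFinM lee_fin mulrA ler_peMl ?(ltW (F1_gt0 x))//.
      rewrite mulrC ler_pdivlMr// mul1r; apply: ge0_ler_powR; rewrite ?nnegrE ?sqr_ge0 ?(ltW q0)//.
      by rewrite ler_sqr ?nnegrE// ltW.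
  apply: le_lt_trans (ge0_subset_integral mu _ measurableT _ _ (@subsetT _ _)) _.
  - exact: mge.
  - by apply: measurable_funeM; exact: measurable_wint.
  - move=> x _; rewrite -EFinM lee_fin mulr_ge0 ?invr_ge0 ?(ltW eq0)//.
    by rewrite mulr_ge0 ?powR_ge0// ltW.
  rewrite ge0_integralZl//; last 3 first.
  - exact: measurable_wint.
  - by move=> x _; exact: wint_integrand_ge0.
  - by rewrite lee_fin invr_ge0 ltW.
  by rewrite lte_mul_pinfty// lee_fin invr_ge0 ltW.
exists A, (n%:R + M); split=> //.
- apply: le_lt_trans (ge0_subset_integral mu mA mB _ _ (@subIsetr _ _ _)) _ => //.
    exact: measurable_funTS.
  pose F' x := ((F1 x)%:E * (\1_[set x | (e <= w1 x)%R] x)%:E + (F1 x)%:E * (\1_[set x | (e <= w2 x)%R] x)%:E)%E.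
  have ind (P : set X) : measurable P -> (\int[mu]_(x in P) (F1 x)%:E =
     \int[mu]_x ((F1 x)%:E * (\1_P x)%:E))%E.
    move=> mP; rewrite integral_mkcond; apply: eq_integral => x _.
    by rewrite patchE indicE; case: ifP; rewrite ?mule1 ?mule0.
  have ind0 (P : set X) x : (0 <= (F1 x)%:E * (\1_P x)%:E)%E by rewrite mule_ge0// lee_fin.
  have mind (P : set X) : measurable P -> measurable_fun setT (fun x => (F1 x)%:E * (\1_P x)%:E)%E.
    by move=> mP; apply: emeasurable_funM => //; apply/measurable_EFinP; exact: measurable_indic.
  have mg1 := mge _ e mw1; have mg2 := mge _ e mw2.
  apply: (@le_lt_trans _ _ (\int[mu]_x F' x)%E).
    rewrite ind//; apply: ge0_le_integral => //.
    - exact: mind.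
    - by apply: emeasurable_funD; exact: mind.
    - move=> x _; rewrite /F' !indicE in_setU.
      by case: (_ \in _); case: (_ \in _); rewrite /= ?mule1 ?mule0 ?adde0 ?add0e ?lexx// leeDl.
  rewrite /F' ge0_integralD//; [|exact: mind|exact: mind].
  by rewrite -!ind// lte_add_pinfty//; exact: fw2.
- by rewrite addr_ge0.
- by apply: filterS w2M => x h [/= h1 _]; rewrite lerD.
move=> a u f a2 Hu uf; set nf := nrm f; set S := kappa + kappa `^ (1 - q) * (kappa / kappa `^ (1 - q)).
have SE : S = 2 * kappa by rewrite /S mulrCA divff ?lt0r_neq0// mulr1 -[2]/(1 + 1) mulrDl mul1r.
have := weighted_resolvent_bound mv v0 hn k0 a2 Hu; rewrite -/S -/nf => K3.
have ms := measurable_esqfnorm (L2rep_meas u).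
pose c1 := 2 * (1 + M) ^+ 2; pose c2 := 8 * e ^+ 2.
have c10 : 0 <= c1 by rewrite mulr_ge0 ?sqr_ge0.
have c20 : 0 <= c2 by rewrite mulr_ge0 ?sqr_ge0.
have mvs : measurable_fun setT (fun x => (v x ^+ 2 * sqfnorm (L2rep u x))%:E).
  apply/measurable_EFinP/measurable_funM; last exact/measurable_sqfnorm/L2rep_meas.
  exact: measurable_funX.
have vs0 x : (0 <= (v x ^+ 2 * sqfnorm (L2rep u x))%:E)%E.
  by rewrite lee_fin mulr_ge0 ?sqr_ge0 ?sqfnorm_ge0.
apply: (@le_trans _ _ (\int[mu]_x (c1%:E * (v x ^+ 2 * sqfnorm (L2rep u x))%:E +
    c2%:E * (sqfnorm (L2rep u x))%:E))%E).
  apply: ae_ge0_le_integral => //.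
  - by move=> x _; rewrite lee_fin mulr_ge0 ?sqr_ge0 ?sqfnorm_ge0.
  - apply/measurable_EFinP/measurable_funM; last exact/measurable_sqfnorm/L2rep_meas.
    apply: measurable_funX; apply: measurable_funM; first exact: measurable_funD.
    by apply: measurable_indic; exact: measurableC.
  - by move=> x _; rewrite adde_ge0// mule_ge0// ?lee_fin// sqfnorm_ge0.
  - by apply: emeasurable_funD; exact: measurable_funeM.
  apply: filterS w2M => x hx _; rewrite -!EFinM -EFinD lee_fin mulrA -mulrDl ler_wpM2r ?sqfnorm_ge0//.
  rewrite indicE in_setC; have [xA|xA] := boolP (x \in A).
    by rewrite /= mulr0 expr0n addr_ge0// mulr_ge0 ?sqr_ge0.
  rewrite /= mulr1.
  (* Where w1 > n >= 1, the bound M of w2 is absorbed into M w1; elsewhere off A both functions are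
     below e. *)
  have hw : w1 x + w2 x <= (1 + M) * v x + 2 * e.
    rewrite /v; case: ifPn => nw.
      have w11 : 1 <= w1 x.
        by apply: le_trans (ltW nw); rewrite -[1]/(1%:R) ler_nat.
      have : M * 1 <= M * w1 x by rewrite ler_wpM2l.
      have := w20 x; lra.
    rewrite mulr0 add0r -leNgt in nw *.
    have [b1 b2] : w1 x < e /\ w2 x < e.
      split; rewrite ltNge; apply/negP => b; move/negP: xA; apply; apply/mem_set; split=> //.
        by left.
      by right.
    lra.
  have hv : 0 <= (1 + M) * v x by rewrite mulr_ge0// addr_ge0.
  apply: (@le_trans _ _ (((1 + M) * v x + 2 * e) ^+ 2)).
    by rewrite ler_sqr ?nnegrE ?addr_ge0// mulr_ge0// ltW.
  rewrite /c1 /c2; have := sqr_ge0 ((1 + M) * v x - 2 * e); lra.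
rewrite ge0_integralD//; last 4 first.
- by move=> x _; rewrite mule_ge0// lee_fin.
- exact: measurable_funeM.
- by move=> x _; rewrite mule_ge0// lee_fin// sqfnorm_ge0.
- exact: measurable_funeM.
rewrite !ge0_integralZl//; last by move=> x _; rewrite lee_fin sqfnorm_ge0.
rewrite -nrm_L2rep; apply: le_trans (leeD (lee_wpmul2l _ K3) (lexx _)) _; first by rewrite lee_fin.
rewrite -!EFinM -EFinD lee_fin.
apply: (@le_trans _ _ (c1 * ((Num.sqrt S * nf * C) ^+ 2) + c2 * nf ^+ 2)).
  by rewrite lerD2l ler_wpM2l// ler_sqr ?nnegrE ?nrm_ge0.
have S0 : 0 <= S by rewrite SE mulr_ge0// ltW.
rewrite !exprMn (sqr_sqrtr S0) SE.
have -> : c1 * (2 * kappa * nf ^+ 2 * C ^+ 2) + c2 * nf ^+ 2 =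
   (2 * kappa * (D - 1) + eps ^+ 2 / 2) * nf ^+ 2.
  by rewrite /c1 /c2 /D /e; field.
rewrite ler_wpM2r ?sqr_ge0//.
have : eps ^+ 2 = 2 * kappa * D + eps ^+ 2 / 2 by rewrite /kappa; field; rewrite lt0r_neq0.
have := ltW k0; lra.
Qed.

End weighted_estimates.

(** Telescoping over equal steps of [exp_semigroup_step] replaces integrating the derivative of the
    orbit. *)
Lemma exp_semigroup_dist (R : realType) (V : lmodType R[i]) (ip : {dot V for Num.conj})
    (T : operator V) U u w (t : R) : exp_semigroup ip T U -> T (u, w) -> 0 <= t ->
  hnorm ip (U t u - u) <= t * hnorm ip w.
Proof.
move=> eU Tuw t0; have sU := eU.1; apply/ler_addgt0Pr => e e0.
have t1 : 0 < t + 1 by rewrite ltr_wpDl.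
have [|dl d0 hd] := exp_semigroup_step eU Tuw (eps := e / (t + 1)); first by rewrite divr_gt0.
have [n /(_ _ (leqnn n)) hn] := inv_natS_small (divr_gt0 d0 t1); pose h := t / n.+1%:R.
have n1 : 0 < n.+1%:R :> R by rewrite ltr0n.
have h0 : 0 <= h by rewrite divr_ge0// ltW.
have hdl : h < dl.
  move: hn; rewrite ltr_pdivlMr// => hn; apply: le_lt_trans hn; rewrite /h mulrC ler_pM2l ?invr_gt0//.
  by rewrite lerDl.
have key k : hnorm ip (U (h *+ k) u - u) <= k%:R * h * (hnorm ip w + e / (t + 1)).
  elim: k => [|k IH]; first by rewrite mulr0n (sg_id sU) subrr nrm0 !mul0r.
  have hk : 0 <= h *+ k by rewrite mulrn_wge0.
  apply: le_trans (nrm_dist_tri _ _ (U (h *+ k) u) _) _; rewrite -natr1 !mulrDl !mul1r [leRHS]addrC mulrSr.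
  apply: lerD; last exact: IH.
  have := hd _ _ hk h0 hdl; set z := U _ u - _ => hz.
  rewrite -[z](addrK (h%:C%C *: U (h *+ k) w)); apply: le_trans (nrmB _ _ _) _.
  rewrite mulrDr addrC lerD//; last by rewrite mulrC.
  by rewrite nrmZR ger0_norm// ler_wpM2l// (sg_contr sU).
have := key n.+1; rewrite -mulr_natr divfK ?lt0r_neq0// mulrCA divff ?lt0r_neq0// mulr1 mulrDr.
move=> H; apply: le_trans H _; rewrite lerD2l mulrCA ler_piMr ?(ltW e0)//.
by rewrite ler_pdivrMr// mul1r lerDl.
Qed.

Section multiplication_resolvent.
Context dX (X : measurableType dX) (R : realType).
Context (mu : {measure set X -> \bar R}) (r : nat) (E : hbundle X R r).
Local Notation ip := (L2dot mu E).
Local Notation nrm := (hnorm ip).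
Local Notation sqint := (@sqint _ X R mu r E).
Implicit Types (f u : L2 mu E) (A : set X).
Local Notation chi := (fun A x => \1_A x : R).

Lemma indic_le1 A x : `|\1_A x : R| <= 1.
Proof. by rewrite indicE; case: (_ \in _); rewrite ?normr0 ?normr1. Qed.

Lemma measurable_chi A : measurable A -> measurable_fun setT (fun x => \1_A x : R).
Proof. by move=> mA; exact: measurable_indic. Qed.

Section bounded_on_cutoff.
Variables (W : forall x, {linear E x -> E x}) (w : X -> R).
Hypotheses (mW : End_section W) (mw : measurable_fun setT w) (w0 : forall x, 0 <= w x)
  (Ww : forall x (v : E x), fnorm (W x v) <= w x * fnorm v).

Lemma sqfnorm_End x (v : E x) : sqfnorm (W x v) <= w x ^+ 2 * sqfnorm v.
Proof.
rewrite -[sqfnorm v](sqr_sqrtr (sqfnorm_ge0 v)) -[leLHS](sqr_sqrtr (sqfnorm_ge0 (W x v))) -exprMn.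
by rewrite ler_sqr ?nnegrE ?mulr_ge0 ?sqrtr_ge0//; exact: Ww.
Qed.

Variables (A : set X) (m : R).
Hypotheses (mA : measurable A) (m0 : 0 <= m) (wm : {ae mu, forall x, A x -> w x <= m}).

Lemma sqfnorm_End_cutoff f : {ae mu, forall x,
  sqfnorm (W x (L2rep (smul (chi A) f) x)) <= m ^+ 2 * sqfnorm (L2rep (smul (chi A) f) x)}.
Proof.
have h := smulE (measurable_chi mA) (@indic_le1 A) f.
apply: filterS2 h wm => x -> hm; have [xA|xA] := pselect (A x).
  apply: le_trans (sqfnorm_End _) _; rewrite ler_wpM2r ?sqfnorm_ge0// ler_sqr ?nnegrE//.
  exact: hm.
by rewrite indicE memNset// scale0r (lin0 (@End_linear _ _ _ _ _ W x)) sqfnorm0 mulr0.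
Qed.

Lemma sqint_End_cutoff f : sqint (fun x => W x (L2rep (smul (chi A) f) x)).
Proof.
apply: sqint_ae_le (sqfnorm_End_cutoff f); exact/measurable_End_section/L2rep_meas.
Qed.

Lemma nrm_wmul_cutoff f : nrm (wmul W (smul (chi A) f)) <= m * nrm (smul (chi A) f).
Proof.
have ms := measurable_End_section mW (L2rep_meas (smul (chi A) f)).
rewrite -ler_sqr ?nnegrE ?mulr_ge0 ?nrm_ge0// exprMn -lee_fin.
rewrite (nrm_L2_ae ms (wmulE (sqint_End_cutoff f))) EFinM nrm_L2rep -ge0_integralZl//; last 3 first.
- exact/measurable_esqfnorm/L2rep_meas.
- by move=> x _; rewrite lee_fin sqfnorm_ge0.
- by rewrite lee_fin sqr_ge0.
apply: ae_ge0_le_integral => //.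
- by move=> x _; rewrite lee_fin sqfnorm_ge0.
- exact: measurable_esqfnorm.
- by move=> x _; rewrite mule_ge0// lee_fin ?sqr_ge0 ?sqfnorm_ge0.
- by apply: measurable_funeM; exact/measurable_esqfnorm/L2rep_meas.
- by apply: filterS (sqfnorm_End_cutoff f) => x h _; rewrite -EFinM lee_fin.
Qed.

Variables (u : L2 mu E) (b : R).
Hypotheses (b0 : 0 <= b) (off : (\int[mu]_x ((w x * \1_(~` A) x) ^+ 2 * sqfnorm (L2rep u x))%:E
  <= (b ^+ 2)%:E)%E).

Let moff : measurable_fun setT (fun x => ((w x * \1_(~` A) x) ^+ 2 * sqfnorm (L2rep u x))%:E).
Proof.
apply/measurable_EFinP/measurable_funM; last exact/measurable_sqfnorm/L2rep_meas.
by apply/measurable_funX/measurable_funM => //; apply/measurable_chi/measurableC.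
Qed.

Lemma sqint_End_of_cutoff : sqint (fun x => W x (L2rep u x)).
Proof.
have ms := measurable_End_section mW (L2rep_meas u); apply/sqintP; split=> //.
have mu2 := measurable_esqfnorm (L2rep_meas u).
apply: (@le_lt_trans _ _ (\int[mu]_x (((w x * \1_(~` A) x) ^+ 2 * sqfnorm (L2rep u x))%:E +
    (m ^+ 2)%:E * (sqfnorm (L2rep u x))%:E))%E).
  apply: ae_ge0_le_integral => //.
  - by move=> x _; rewrite lee_fin sqfnorm_ge0.
  - exact: measurable_esqfnorm.
  - by move=> x _; rewrite -EFinM -EFinD lee_fin addr_ge0// mulr_ge0 ?sqr_ge0 ?sqfnorm_ge0.
  - by apply: emeasurable_funD => //; exact: measurable_funeM.
  apply: filterS wm => x hm _; rewrite -EFinM -EFinD lee_fin -mulrDl.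
  apply: le_trans (sqfnorm_End _) _; rewrite ler_wpM2r ?sqfnorm_ge0// indicE in_setC.
  have [xA|xA] := boolP (x \in A).
    rewrite mulr0 expr0n add0r ler_sqr ?nnegrE//; exact/hm/set_mem.
  by rewrite mulr1 lerDl sqr_ge0.
rewrite ge0_integralD//; last 3 first.
- by move=> x _; rewrite lee_fin mulr_ge0 ?sqr_ge0 ?sqfnorm_ge0.
- by move=> x _; rewrite mule_ge0// lee_fin ?sqr_ge0 ?sqfnorm_ge0.
- exact: measurable_funeM.
rewrite ge0_integralZl//; last 2 first.
- by move=> x _; rewrite lee_fin sqfnorm_ge0.
- by rewrite lee_fin sqr_ge0.
by rewrite -nrm_L2rep -EFinM lte_add_pinfty ?ltry//; apply: le_lt_trans off _; rewrite ltry.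
Qed.

Lemma nrm_wmul_sub_cutoff : nrm (wmul W u - wmul W (smul (chi A) u)) <= b.
Proof.
rewrite -ler_sqr ?nnegrE ?nrm_ge0// -lee_fin; apply: le_trans off.
pose s x := W x ((\1_(~` A) x)%:C%C *: L2rep u x).
have ms : measurable_section (@bundle_meas _ _ _ _ E) s.
  apply: measurable_End_section => //.
  by apply: measurable_smul_section (L2rep_meas u); apply/measurable_chi/measurableC.
have h : {ae mu, forall x, L2rep (wmul W u - wmul W (smul (chi A) u)) x = s x}.
  have h1 := L2repB (wmul W u) (wmul W (smul (chi A) u)).
  have h2 := wmulE sqint_End_of_cutoff; have h3 := wmulE (sqint_End_cutoff u).
  have h4 := smulE (measurable_chi mA) (@indic_le1 A) u.
  apply: (filterS _ (filterI (filterI h1 h2) (filterI h3 h4))) => x [[-> ->] [-> ->]].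
  rewrite -(linB (@End_linear _ _ _ _ _ W x)) /s; congr (W x _).
  rewrite !indicE in_setC; case: (x \in A) => /=; first by rewrite scale1r subrr scale0r.
  by rewrite scale0r subr0 scale1r.
rewrite (nrm_L2_ae ms h); apply: ge0_le_integral => //.
- by move=> x _; rewrite lee_fin sqfnorm_ge0.
- exact: measurable_esqfnorm.
- move=> x _; rewrite lee_fin /s; apply: le_trans (sqfnorm_End _) _.
  by rewrite sqfnormZR mulrA exprMn.
Qed.

End bounded_on_cutoff.

Variables (H : operator (L2 mu E)) (U : R -> L2 mu E -> L2 mu E).
Hypothesis eU : exp_semigroup ip H U.
Variables (F1 : X -> R) (F2 : R -> R).
Hypotheses (mF1 : measurable_fun setT F1) (F1_gt0 : forall x, 0 < F1 x)
  (F2_gt0 : forall t : R, 0 < t -> 0 < F2 t).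
Hypothesis diag_bound : forall (t : R) f, 0 < t ->
  {ae mu, forall x, sqfnorm (L2rep (U t f) x) <= F1 x * F2 (t + t) * nrm f ^+ 2}.

Lemma cutoff_resolvent_cpt A a G : measurable A -> (\int[mu]_(x in A) (F1 x)%:E < +oo)%E ->
  0 < a -> sym_op ip G -> bounded_by ip a^-1 G ->
  (forall f, H (G f, f - a%:C%C *: G f)) -> cpt ip (fun f => smul (chi A) (G f)).
Proof.
move=> mA fA a0 sG bG HG; have sU := eU.1; apply: cpt_lim => e e0.
(* H G f = f - a G f has norm at most 2 |f|, so replacing G f by U t (G f) costs at most 2 t |f| = e
   |f|. *)
pose t := e / 2; have t0 : 0 < t by rewrite divr_gt0.
have [mc bc] := (measurable_chi mA, @indic_le1 A).
have F20 : 0 < F2 (t + t) by apply: F2_gt0; exact: addr_gt0.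
exists ((fun f => smul (chi A) (U t f)) \o G).
  apply: (cpt_comp (Bt := G) (c := a^-1)) => //.
  apply: (@pointwise_bound_cpt _ _ _ _ _ _ _ (fun x => \1_A x * F1 x * F2 (t + t))).
  - exact: (linear_comp (smul_linear mc bc) (sg_lin sU (ltW t0))).
  - by apply: measurable_funM => //; exact: measurable_funM.
  - by move=> x; rewrite !mulr_ge0// ltW.
  - under eq_integral do rewrite mulrC EFinM.
    rewrite ge0_integralZl//; last 3 first.
    + by apply/measurable_EFinP; exact: measurable_funM.
    + by move=> x _; rewrite lee_fin mulr_ge0// ltW.
    + by rewrite lee_fin ltW.
    have -> : (\int[mu]_x (\1_A x * F1 x)%:E = \int[mu]_(x in A) (F1 x)%:E)%E.
      rewrite [RHS]integral_mkcond; apply: eq_integral => x _.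
      by rewrite patchE indicE; case: ifP; rewrite ?mul1r ?mul0r.
    by rewrite lte_mul_pinfty// lee_fin ltW.
  - move=> f; apply: filterS2 (smulE mc bc (U t f)) (diag_bound f t0) => x -> hx.
    rewrite sqfnormZR; apply: (@le_trans _ _ (\1_A x * sqfnorm (L2rep (U t f) x))).
      by rewrite ler_wpM2r ?sqfnorm_ge0// indicE; case: (_ \in _); rewrite ?expr0n ?expr1n.
    by rewrite -!mulrA ler_wpM2l// mulrA.
move=> f /=; rewrite -(linB (smul_linear mc bc)).
apply: le_trans (smul_bounded mc bc ler01 _) _; rewrite mul1r nrm_distC.
apply: le_trans (exp_semigroup_dist eU (HG f) (ltW t0)) _.
rewrite /t -mulrA ler_wpM2l ?(ltW e0)// mulrC ler_pdivrMr// mulrC mulr2n mulrDl mul1r.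
apply: le_trans (nrmB _ _ _) _; rewrite lerD2l nrmZR gtr0_norm//.
by rewrite mulrC -ler_pdivlMr// mulrC.
Qed.

End multiplication_resolvent.

(** * Relative compactness and perturbation by the potential *)

Section relatively_compact_multiplication.
Context dX (X : measurableType dX) (R : realType).
Context (mu : {measure set X -> \bar R}) (r : nat) (E : hbundle X R r).
Local Notation ip := (L2dot mu E).
Local Notation nrm := (hnorm ip).
Local Notation sqint := (@sqint _ X R mu r E).
Implicit Types (f u : L2 mu E).
Variables (H : operator (L2 mu E)) (W : forall x, {linear E x -> E x}).
Hypotheses (sH : selfadjoint ip H) (nH : nonnegative ip H).
Hypotheses (mW : End_section W) (sW : pointwise_selfadjoint W).

Definition is_resolvent (a : R) (G : L2 mu E -> L2 mu E) : Prop :=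
  [/\ linear G, sym_op ip G, bounded_by ip a^-1 G & resolvent_at H a G].

(** m is fixed before a, so that eps + m / a drops below 1 for large a. *)
Hypothesis approx : forall eps : R, 0 < eps -> exists2 m : R, 0 <= m &
  forall a G, 2 <= a -> is_resolvent a G ->
    [/\ (forall f, sqint (fun x => W x (L2rep (G f) x))),
        bounded_by ip (eps + m / a) (wmul W \o G) &
        exists2 K, cpt ip K & forall f, nrm (wmul W (G f) - K f) <= eps * nrm f].

Lemma resolvent_exists (a : R) : 0 < a -> exists G, is_resolvent a G.
Proof.
by move=> a0; have [G [lG sG bG HG]] := selfadjoint_nonneg_resolvent (@L2_complete _ _ _ _ _ _) sH nH a0; exists G.
Qed.

Lemma resolvent_identity a b G G' f : is_resolvent a G -> is_resolvent b G' ->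
  G f = G' (f + (b - a)%:C%C *: G f).
Proof.
move=> [_ _ _ rG] [_ _ _ rG']; have : H (G f, f - a%:C%C *: G f) by rewrite rG; exists f.
rewrite {1}rG' => -[g [Gg]]; rewrite -Gg => fg; rewrite {1}Gg; congr G'.
apply: (addIr (- (b%:C%C *: G f))).
by rewrite -fg rmorphB /= scalerBl addrAC addrA subrK.
Qed.

(** [approx] starts at 2; the resolvent identity reaches every a > 0 by writing G as the resolvent
    at b = a + 2 composed with a bounded symmetric operator. *)
Lemma mul_operator_resolvent (a : R) G : 0 < a -> is_resolvent a G ->
  [/\ (forall f, mul_operator mu W (G f, wmul W (G f))), linear (wmul W \o G),
      exists c, bounded_by ip c (wmul W \o G) & cpt ip (wmul W \o G)].
Proof.
move=> a0 rG; pose b := a + 2; have b2 : 2 <= b by rewrite lerDr ltW.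
have b0 : 0 < b by rewrite addr_gt0.
have [G' rG'] := resolvent_exists b0; have [lG sG bG _] := rG.
pose B f := f + (b - a)%:C%C *: G f.
have GB f : G f = G' (B f) := resolvent_identity f rG rG'.
have mG f : mul_operator mu W (G f, wmul W (G f)).
  have [m _ hm] := approx ltr01; have [sq _ _] := hm b G' b2 rG'.
  by rewrite GB; exact: (wmulE (sq (B f))).
have ba : 0 <= b - a by rewrite /b addrC addKr.
have bB : bounded_by ip (1 + (b - a) * a^-1) B.
  move=> f; apply: le_trans (nrmD _ _ _) _; rewrite mulrDl mul1r lerD2l nrmZR ger0_norm//.
  by rewrite -mulrA ler_wpM2l.
have sB : sym_op ip B.
  by move=> f g; rewrite ipDl ipDr ipZl ipZr sG conjcR.
split=> //.
- move=> c f g; apply: (mul_operator_functional (mG _)) => /=.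
  by rewrite lG; exact: mul_operator_linear.
- have [m m0 hm] := approx ltr01; have [_ bd _] := hm b G' b2 rG'.
  exists ((1 + m / b) * (1 + (b - a) * a^-1)) => f /=; rewrite GB; apply: le_trans (bd _) _.
  by rewrite -mulrA ler_wpM2l// addr_ge0// divr_ge0// ltW.
- have -> : wmul W \o G = (wmul W \o G') \o B by apply/funext => f /=; rewrite GB.
  apply: (cpt_comp _ bB sB); apply: cpt_lim => e e0.
  have [m _ hm] := approx e0; have [_ _ [K cK hK]] := hm b G' b2 rG'.
  by exists K.
Qed.

Lemma op_comp_inv_shift (a : R) G : is_resolvent a G ->
  (forall f, mul_operator mu W (G f, wmul W (G f))) ->
  op_comp (mul_operator mu W) (op_inv (op_shift H a%:C%C)) = [set u | u.2 = wmul W (G u.1)].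
Proof.
move=> [_ _ _ rG] mG; apply/seteqP; split => -[f h] /=.
  move=> [g]; rewrite /op_inv /op_shift /= rG => -[f' [gE]]; rewrite -gE => /addIr ->.
  by rewrite gE => h'; apply: mul_operator_functional h' (mG f').
move=> ->; exists (G f); last exact: mG.
by rewrite /op_inv /op_shift /= rG; exists f.
Qed.

Theorem compact_mul_operator_resolvent (a : R) : 0 < a ->
  compact_operator ip (op_comp (mul_operator mu W) (op_inv (op_shift H a%:C%C))).
Proof.
move=> a0; have [G rG] := resolvent_exists a0.
have [mG lK [c bK] cK] := mul_operator_resolvent a0 rG.
rewrite (op_comp_inv_shift rG mG); split.
- split=> [|z [f f'] [g g'] /= -> ->|g /= ->]; first by rewrite /= [RHS](lin0 lK).
    by rewrite -(lK z f g).
  exact: (lin0 lK).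
- by apply/seteqP; split => // f _; exists (wmul W (G f)).
move=> u v uv [C uC]; have {}uv n : v n = wmul W (G (u n)) := uv n.
have [s [g [hs hg]]] := cpt_subseq (@L2_complete _ _ _ _ _ _) lK bK cK uC.
exists s, g; split=> //.
have -> : (fun n => nrm (v (s n) - g)) = (fun n => nrm ((wmul W \o G) (u (s n)) - g)).
  by apply/funext => n; rewrite uv.
apply/cvgr0Pnorm_lt => e e0; have [N hN] := hg e e0; exists N => // n /= Nn.
by rewrite ger0_norm ?nrm_ge0//; exact: hN.
Qed.

Theorem perturbed_mul_operator :
  [/\ dom (op_sum H (mul_operator mu W)) = dom H,
      selfadjoint ip (op_sum H (mul_operator mu W)),
      semibounded_below ip (op_sum H (mul_operator mu W)) &
      essential_spectrum ip (op_sum H (mul_operator mu W)) = essential_spectrum ip H].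
Proof.
have e4 : 0 < 4^-1 :> R by rewrite invr_gt0.
(* This a gives m / a <= 1/4, hence relative bound at most 1/2. *)
have [m m0 hm] := approx e4; pose a := 4 * m + 2.
have a2 : 2 <= a by rewrite lerDr mulr_ge0.
have a0 : 0 < a by apply: lt_le_trans a2.
have [G rG] := resolvent_exists a0; have [lG sG bG HG] := rG.
have [mG lK _ cK] := mul_operator_resolvent a0 rG.
have [_ bd _] := hm a G a2 rG.
have bK : bounded_by ip 2^-1 (wmul W \o G).
  move=> f; apply: le_trans (bd f) _; rewrite ler_wpM2r ?nrm_ge0//.
  have : m / a <= 4^-1 by rewrite ler_pdivrMr// /a; lra.
  lra.
have [oH dH _] := sH.
have h2 : 0 < 2^-1 :> R by rewrite invr_gt0.
have h1 : 2^-1 < 1 :> R by lra.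
have [D S B [G' [M' [lG' sG' bG' rG' dG]]]] := relative_perturbation (@L2_complete _ _ _ _ _ _)
  HG lG sG bG dH nH (@mul_operator_functional _ _ _ _ _ _ W)
  (fun f g f' g' => mul_operator_sym mW sW) mG lK bK h2 h1 a0.
split=> //.
apply: (essential_spectrum_cpt_perturbation (@L2_complete _ _ _ _ _ _) lG sG bG HG lG' sG' bG' rG').
apply: (cpt_bounded_by_comp (c := M') cK) => f.
by rewrite dG nrmN; exact: bG'.
Qed.

End relatively_compact_multiplication.

(** * Integration against the weighted measure *)

Section weighted_density.
Context dX (X : measurableType dX) (R : realType).
Variables (mu : {measure set X -> \bar R}) (F : X -> R).
Variables (mF : measurable_fun setT F) (F_gt0 : forall x, 0 < F x).
Local Notation nu := (weighted mu mF F_gt0).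
Import HBNNSimple.

Let mF' : measurable_fun setT (EFin \o F) := (measurable_EFinP _ _).2 mF.
Let F0 x : (0 <= (F x)%:E)%E. Proof. by rewrite lee_fin ltW. Qed.

Lemma integral_weighted_nnsfun (h : {nnsfun X >-> R}) :
  (\int[mu]_x ((h x)%:E * (F x)%:E) = \int[nu]_x (h x)%:E)%E.
Proof.
rewrite integral_nnsfun// patch_setT sintegralE.
transitivity (\int[mu]_x (\sum_(y \in range h) ((y * \1_(h @^-1` [set y]) x)%:E * (F x)%:E)))%E.
  apply: eq_integral => x _; rewrite -ge0_mule_fsuml => [|y]; last exact: nnfun_muleindic_ge0.
  by rewrite fsumEFin// -fimfunE.
rewrite ge0_integral_fsum//; last 2 first.
- move=> y; apply: emeasurable_funM => //; apply/measurable_EFinP.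
  by apply: measurable_funM => //; exact: measurable_indic.
- by move=> y x _; rewrite mule_ge0// nnfun_muleindic_ge0.
apply: eq_fsbigr => y /set_mem [z _ yE].
have y0 : 0 <= y by rewrite -yE.
under eq_integral do rewrite EFinM -muleA.
rewrite ge0_integralZl//; last 2 first.
- apply: emeasurable_funM => //; apply/measurable_EFinP; exact: measurable_indic.
- by move=> x _; rewrite mule_ge0// lee_fin.
congr (_ * _)%E; rewrite -[RHS]/(\int[mu]_(x in _) (F x)%:E)%E [RHS]integral_mkcond.
apply: eq_integral => x _; rewrite patchE indicE.
by case: (x \in _); rewrite ?mul1e ?mul0e.
Qed.

Lemma ge0_integral_weighted (f : X -> R) : measurable_fun setT f -> (forall x, 0 <= f x) ->
  (\int[mu]_x ((f x)%:E * (F x)%:E) = \int[nu]_x (f x)%:E)%E.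
Proof.
move=> mf f0; have mf' : measurable_fun setT (EFin \o f) by exact/measurable_EFinP.
pose h := nnsfun_approx measurableT mf'.
have f0' x : (0 <= (EFin \o f) x)%E by rewrite lee_fin.
have hf x : (EFin \o h n) x @[n --> \oo] --> (f x)%:E.
  exact: cvg_nnsfun_approx.
have nd x : {homo (fun n => (h n x)%:E) : m n / (m <= n)%N >-> (m <= n)%E}.
  by move=> m n mn; rewrite lee_fin; exact/lefP/nd_nnsfun_approx.
have c1 : (\int[nu]_x (h n x)%:E)%E @[n --> \oo] --> (\int[nu]_x (f x)%:E)%E.
  have -> : (\int[nu]_x (f x)%:E = \int[nu]_x limn (fun n => (h n x)%:E))%E.
    by apply: eq_integral => x _; apply/esym/cvg_lim => //; exact: hf.
  apply: cvg_monotone_convergence => //.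
  - by move=> n; apply/measurable_EFinP.
  - by move=> n x _; rewrite lee_fin.
have c2 : (\int[mu]_x ((h n x)%:E * (F x)%:E))%E @[n --> \oo] -->
    (\int[mu]_x ((f x)%:E * (F x)%:E))%E.
  have -> : (\int[mu]_x ((f x)%:E * (F x)%:E) =
      \int[mu]_x limn (fun n => (h n x)%:E * (F x)%:E))%E.
    by apply: eq_integral => x _; apply/esym/cvg_lim => //; apply: cvgeZr => //; exact: hf.
  apply: cvg_monotone_convergence => //.
  - by move=> n; apply: emeasurable_funM => //; exact/measurable_EFinP.
  - by move=> n x _; rewrite mule_ge0// lee_fin.
  - by move=> x _ m n mn; rewrite lee_wpmul2r//; exact: nd.
have E n : (\int[mu]_x ((h n x)%:E * (F x)%:E) = \int[nu]_x (h n x)%:E)%E.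
  exact: integral_weighted_nnsfun.
by rewrite -(cvg_lim _ c1)// -(cvg_lim _ c2)// (funext E).
Qed.

End weighted_density.

Lemma Lfun_infty_ae_bounded dX (X : measurableType dX) (R : realType)
    (mu : {measure set X -> \bar R}) (f : X -> R) : f \in Lfun mu +oo%E ->
  exists2 M : R, 0 <= M & {ae mu, forall x, f x <= M}.
Proof.
rewrite inE => /andP[_]; rewrite inE /= /finite_norm unlock /=.
(* The norm is 0 by convention when the whole space is null; any bound then holds almost
   everywhere. *)
case: ifPn => [_|m0 _]; last first.
  exists 0 => //; exists setT; split=> //.
  by apply/eqP; rewrite eq_le measure_ge0 andbT leNgt.
move=> H; have [M hM] := ess_supr_bounded (f := Num.norm \o f) H.
exists `|M| => //; apply: filterS hM => x /= h.
by apply: le_trans (ler_norm _) _; apply: le_trans h _; exact: ler_norm.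
Qed.

(** The compact approximation is W 1_A (H + a)^{-1}. The set A and the bound m of W on A come from
    the cut-off, before a is chosen, and m / a bounds the norm of this part. *)
Lemma kato_potential_approx dX (X : measurableType dX) (R : realType)
    (mu : {measure set X -> \bar R}) (r : nat) (E : hbundle X R r)
    (H : operator (L2 mu E)) (U : R -> L2 mu E -> L2 mu E)
    (F1 : X -> R) (F2 : R -> R) (q C : R) (W W1 W2 : forall x, {linear E x -> E x}) (M eps : R) :
  exp_semigroup (L2dot mu E) H U -> 1 <= q -> measurable_fun setT F1 -> (forall x, 0 < F1 x) ->
  measurable_fun (`]0, +oo[%classic : set R) F2 -> (forall t : R, 0 < t -> 0 < F2 t) ->
  (forall (t : R) f, 0 < t -> {ae mu, forall x,
     sqfnorm (L2rep (U t f) x) <= F1 x * F2 (t + t) * hnorm (L2dot mu E) f ^+ 2}) ->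
  (\int[lebesgue_measure]_(t in (`]0%R, +oo[%classic : set R))
     (expR (- t) * F2 t `^ (2 * q)^-1)%:E <= C%:E)%E ->
  End_section W -> (forall x v, W x v = W1 x v + W2 x v) ->
  measurable_fun setT (fun x => fopnorm (W1 x)) -> measurable_fun setT (fun x => fopnorm (W2 x)) ->
  0 <= M -> {ae mu, forall x, fopnorm (W2 x) <= M} ->
  (wint mu F1 q (fun x => fopnorm (W1 x)) < +oo)%E ->
  (forall c : R, 0 < c ->
     (\int[mu]_(x in [set x | (c <= fopnorm (W2 x))%R]) (F1 x)%:E < +oo)%E) -> 0 < eps ->
  exists2 m : R, 0 <= m & forall a G, 2 <= a -> is_resolvent H a G ->
    [/\ (forall f, @sqint _ X R mu r E (fun x => W x (L2rep (G f) x))),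
        bounded_by (L2dot mu E) (eps + m / a) (wmul W \o G) &
        exists2 K, cpt (L2dot mu E) K &
          forall f, hnorm (L2dot mu E) (wmul W (G f) - K f) <= eps * hnorm (L2dot mu E) f].
Proof.
move=> eU q1 mF1 F10 mF2 F20 diag lapl mW WE mw1 mw2 M0 w2M fw1 fw2 e0.
have w10 x : 0 <= fopnorm (W1 x) := (fopnorm_ge0_le W1 x).1.
have w20 x : 0 <= fopnorm (W2 x) := (fopnorm_ge0_le W2 x).1.
have [A [m [mA fA m0 wm off]]] :=
  weighted_cutoff eU q1 mF1 F10 mF2 F20 diag lapl mw1 mw2 w10 w20 M0 w2M fw1 fw2 e0.
have mw : measurable_fun setT (fun x => fopnorm (W1 x) + fopnorm (W2 x)) by exact: measurable_funD.
have w0 x : 0 <= fopnorm (W1 x) + fopnorm (W2 x) by rewrite addr_ge0.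
have Ww x (v : E x) : fnorm (W x v) <= (fopnorm (W1 x) + fopnorm (W2 x)) * fnorm v.
  rewrite WE mulrDl fnormE; apply: le_trans (nrmD _ _ _) _.
  by rewrite -!fnormE; apply: lerD; [exact: (fopnorm_ge0_le W1 x).2|exact: (fopnorm_ge0_le W2 x).2].
exists m => // a G a2 [lG sG bG rG].
have a0 : 0 < a by apply: lt_le_trans a2.
have HG f : H (G f, f - a%:C%C *: G f) by rewrite rG; exists f.
have Gle f : hnorm (L2dot mu E) (G f) <= hnorm (L2dot mu E) f.
  apply: le_trans (bG f) _; rewrite ler_piMl ?nrm_ge0// invf_le1//.
  by apply: le_trans a2; rewrite ler1n.
have offG f := off a (G f) f a2 (HG f) (Gle f).
have b0 f : 0 <= eps * hnorm (L2dot mu E) f by rewrite mulr_ge0 ?nrm_ge0// ltW.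
have near f : hnorm (L2dot mu E) (wmul W (G f) - wmul W (smul (fun x => \1_A x) (G f))) <=
    eps * hnorm (L2dot mu E) f.
  exact: (nrm_wmul_sub_cutoff mW mw w0 Ww mA m0 wm (b0 f) (offG f)).
have onA f := nrm_wmul_cutoff mW w0 Ww mA m0 wm (G f).
split.
- by move=> f; exact: (sqint_End_of_cutoff mW mw w0 Ww mA m0 wm (offG f)).
- move=> f /=; rewrite -[wmul W (G f)](subrK (wmul W (smul (fun x => \1_A x) (G f)))).
  apply: le_trans (nrmD _ _ _) _; rewrite mulrDl lerD//; apply: le_trans (onA f) _.
  rewrite -mulrA ler_wpM2l//.
  apply: le_trans (smul_bounded (measurable_chi mA) (@indic_le1 _ _ _ A) ler01 _) _.
  by rewrite mul1r.
exists (fun f => wmul W (smul (fun x => \1_A x) (G f))) => //.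
apply: (cpt_bounded_by_comp (c := m) (K := fun f => smul (fun x => \1_A x) (G f))) => //.
exact: (cutoff_resolvent_cpt eU mF1 F10 F20 diag mA fA a0 sG bG HG).
Qed.

(** The density hypothesis covers both alternatives of the theorem: nu is F1 dmu when q = 1, and mu
    itself when F1 = 1. *)
Lemma Lfun_wint dX (X : measurableType dX) (R : realType) (mu nu : {measure set X -> \bar R})
    (F : X -> R) (q : R) (w : X -> R) :
  (forall f : X -> R, measurable_fun setT f -> (forall x, 0 <= f x) ->
    (\int[mu]_x ((f x)%:E * (F x)%:E) = \int[nu]_x (f x)%:E)%E) ->
  1 <= q -> w \in Lfun nu (2 * q)%:E ->
  measurable_fun setT w /\ (wint mu F q w < +oo)%E.
Proof.
move=> density q1 hw; have mw : measurable_fun setT w by move: (hw); rewrite inE => /andP[+ _]; rewrite inE.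
split=> //; have q2 : 1 <= 2 * q by lra.
have /integrableP[_] := Lfun_integrable q2 hw; apply: le_lt_trans.
have mwq : measurable_fun setT (fun x => (w x ^+ 2) `^ q).
  apply: (@measurableT_comp _ _ _ _ _ _ (@powR R ^~ q) _ (fun x => w x ^+ 2)).
    exact: measurable_powR.
  exact: measurable_funX.
rewrite /wint; under eq_integral do rewrite EFinM.
rewrite density//; last by move=> x; exact: powR_ge0.
under eq_integral do rewrite -real_normK ?num_real// -powR_mulrn// -powRrM.
rewrite le_eqVlt; apply/orP; left; apply/eqP; apply: eq_integral => x _.
by rewrite gee0_abs// lee_fin powR_ge0.
Qed.

Theorem corollary2p17
  (R : realType) (dX : measure_display) (X : measurableType dX)
  (mu : {sigma_finite_measure set X -> \bar R})
  (p : R -> X -> X -> R) (p_heat : heat_kernel mu p)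
  (Hp : operator (L2 mu (line_bundle X R))) (Hp_def : heat_operator p Hp)
  (q : R) (q_ge1 : 1 <= q)
  (F1 : X -> R) (F1_control : Lq_control p q F1)
  (d : nat) (E : hbundle X R d)
  (H : operator (L2 mu E))
  (H_selfadjoint : selfadjoint (L2dot mu E) H)
  (H_nonneg : nonnegative (L2dot mu E) H)
  (H_kato : kato_dominates H Hp)
  (W W1 W2 : forall x, {linear E x -> E x})
  (W_meas : End_section W) (W1_meas : End_section W1) (W2_meas : End_section W2)
  (W_decomp : forall x v, W x v = W1 x v + W2 x v)
  (W1_selfadjoint : pointwise_selfadjoint W1)
  (W2_selfadjoint : pointwise_selfadjoint W2) :
  let F1mu := weighted mu (control_meas F1_control) (control_gt0 F1_control) in
  let absW1 := fun x => fopnorm (W1 x) in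
  let absW2 := fun x => fopnorm (W2 x) in
  [/\ q = 1, absW1 \in Lfun F1mu 2%:E, absW2 \in Lfun mu +oo%E,
      L_infty mu absW2 & L_infty F1mu absW2] \/
  [/\ 1 < q, (forall x, F1 x = 1), absW1 \in Lfun mu (2 * q)%:E,
      absW2 \in Lfun mu +oo%E & L_infty mu absW2] ->
  (forall a : R, 0 < a ->
     compact_operator (L2dot mu E)
       (op_comp (mul_operator mu W) (op_inv (op_shift H a%:C%C)))) /\
  [/\ dom (op_sum H (mul_operator mu W)) = dom H,
      selfadjoint (L2dot mu E) (op_sum H (mul_operator mu W)),
      semibounded_below (L2dot mu E) (op_sum H (mul_operator mu W)) &
      essential_spectrum (L2dot mu E) (op_sum H (mul_operator mu W)) =
      essential_spectrum (L2dot mu E) H].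
Proof.
move=> F1mu absW1 absW2 hyp; have F1_gt0 := control_gt0 F1_control.
have mF1 := control_meas F1_control.
have [F2 [mF2 F20 pF lapl]] := control_bound F1_control.
have [U eU hU] := kato_kernel_bound p_heat Hp_def H_kato.
have [C hC] : exists C : R, (\int[lebesgue_measure]_(t in (`]0%R, +oo[%classic : set R))
    (expR (- t) * F2 t `^ (2 * q)^-1)%:E <= C%:E)%E.
  move: lapl; rewrite -ge0_fin_numE => [lapl|]; first by have := fineK lapl; set c := fine _ => cE; exists c; rewrite cE.
  by apply: integral_ge0 => t _; rewrite lee_fin mulr_ge0 ?expR_ge0 ?powR_ge0.
have diag (t : R) f : 0 < t -> {ae mu, forall x,
    sqfnorm (L2rep (U t f) x) <= F1 x * F2 (t + t) * hnorm (L2dot mu E) f ^+ 2}.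
  move=> t0; apply: filterS (hU t f t0) => x h; apply: le_trans h _.
  by rewrite ler_wpM2r ?sqr_ge0// pF// addr_gt0.
have sW : pointwise_selfadjoint W.
  by move=> x u v; rewrite !W_decomp linearDl linearDr /= W1_selfadjoint W2_selfadjoint.
have absW2_ge0 x : 0 <= absW2 x := (fopnorm_ge0_le W2 x).1.
(* Both alternatives are reduced to the same facts; when F1 = 1 the integral of F1 over {|W2| >= c}
   is the mu-measure of that set. *)
have [[mw1 fw1] mw2 [M M0 hM] fw2] : [/\ measurable_fun setT absW1 /\ (wint mu F1 q absW1 < +oo)%E,
    measurable_fun setT absW2,
    exists2 M : R, 0 <= M & {ae mu, forall x, absW2 x <= M} &
    forall c : R, 0 < c ->
      (\int[mu]_(x in [set x | (c <= absW2 x)%R]) (F1 x)%:E < +oo)%E].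
  case: hyp => [[qE w1L w2L [mw2 _] [_ hw2]]|[_ F1E w1L w2L [mw2 hw2]]].
    split=> //; last 2 first.
    - exact: Lfun_infty_ae_bounded.
    - by move=> c c0; under eq_set do rewrite -[absW2 _]ger0_norm//; exact: hw2.
    apply: (Lfun_wint (ge0_integral_weighted mu (control_meas F1_control) (control_gt0 F1_control))) => //.
    by have -> : 2 * q = 2 by rewrite qE mulr1.
  have F1c : F1 = cst 1 by apply/funext.
  split=> //; last 2 first.
  - exact: Lfun_infty_ae_bounded.
  - move=> c c0; under eq_set do rewrite -[absW2 _]ger0_norm//.
    rewrite (eq_integral (cst 1%E)); last by move=> x _; rewrite F1E.
    rewrite integral_cst ?mul1e; first exact: hw2.
    rewrite -[X in measurable X]setTI; apply: measurable_fun_ler => //.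
    exact: measurableT_comp.
  apply: (Lfun_wint (nu := mu)) => // f mf f0.
  by rewrite F1c; apply: eq_integral => x _; rewrite mule1.
have approx eps : 0 < eps -> _ := kato_potential_approx eU q_ge1 mF1 F1_gt0 mF2 F20 diag hC W_meas
  W_decomp mw1 mw2 M0 hM fw1 fw2 (eps := eps).
split=> [a a0|].
  exact: (compact_mul_operator_resolvent H_selfadjoint H_nonneg approx a0).
exact: (perturbed_mul_operator H_selfadjoint H_nonneg W_meas sW approx).
Qed.
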